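(* Let $1\le p\le\infty$ and $0<\alpha<\infty$. For every nontrivial semigroup of analytic functions $\{\varphi_t\}$ with Denjoy-Wolff point $b\in\mathbb{T}$ (for which the operators $T_tf=\varphi_t'\,(f\circ\varphi_t)$ are bounded on $H(p,\infty,\alpha)$ with $\sup_{0\le t\le1}\|T_t\|<\infty$) we have $$H_0(p,\infty,\alpha)\subsetneq[\varphi_t',H(p,\infty,\alpha)].$$
   Context: A semigroup of analytic functions is a family $\{\varphi_t:t\ge 0\}$ of analytic self-maps of the unit disk $\mathbb{D}$ such that $\varphi_0$ is the identity, $\varphi_{t+s}=\varphi_t\circ\varphi_s$ for all $t,s\ge0$, and $\varphi_t\to\varphi_0$ uniformly on compact subsets of $\mathbb{D}$ as $t\to0$; it is nontrivial if some $\varphi_t$ is not the identity. $\varphi_t'=\partial\varphi_t/\partial z$. Its infinitesimal generator is $G(z)=\lim_{t\to0^+}\frac{\varphi_t(z)-z}{t}$, which for a nontrivial semigroup has a unique representation $G(z)=(\overline{b}z-1)(z-b)P(z)$ with $P$ analytic on $\mathbb{D}$, $\operatorname{Re}P\ge0$, and $b\in\overline{\mathbb{D}}$; $b$ is the Denjoy-Wolff point of the semigroup. $\mathbb{T}=\partial\mathbb{D}$ is the unit circle. For $f$ analytic in $\mathbb{D}$ and $0\le r<1$, $M_p(r,f)=\left(\int_0^{2\pi}|f(re^{i\theta})|^p\frac{d\theta}{2\pi}\right)^{1/p}$ for $p<\infty$ and $M_\infty(r,f)=\max_\theta|f(re^{i\theta})|$. $H(p,\infty,\alpha)$ is the space of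 analytic $f$ on $\mathbb{D}$ with $\|f\|_{p,\infty,\alpha}=\sup_{0\le r<1}(1-r)^\alpha M_p(r,f)<\infty$, and $H_0(p,\infty,\alpha)$ is its subspace of functions with $\lim_{r\to1^-}(1-r)^\alpha M_p(r,f)=0$. For a Banach space $X$ of analytic functions on $\mathbb{D}$ on which the $T_t$ are bounded, $[\varphi_t',X]=\{f\in X:\lim_{t\to0^+}\|\varphi_t'(f\circ\varphi_t)-f\|_X=0\}$. *)

(* Defs.v *)
From Stdlib Require Import Reals List.
From Coquelicot Require Import Coquelicot.
Open Scope R_scope.

Definition disk (z : C) : Prop := Cmod z < 1.

(* Functions on the disk are represented by total functions on [C]; nothing
   below depends on their values outside the disk. *)
Definition analytic (f : C -> C) : Prop :=
  forall z : C, disk z ->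
    ex_derive (K := C_AbsRing) (V := C_NormedModule) f z.

(* Compactness of subsets of [C], by open covers. *)
Definition compact_subset (K : C -> Prop) : Prop :=
  forall U : (C -> Prop) -> Prop,
    (forall V, U V -> open (T := C_UniformSpace) V) ->
    (forall z, K z -> exists V, U V /\ V z) ->
    exists l : list (C -> Prop),
      (forall V, In V l -> U V) /\
      (forall z, K z -> exists V, In V l /\ V z).

Record analytic_semigroup (phi : R -> C -> C) : Prop := {
  semigroup_analytic : forall t, 0 <= t -> analytic (phi t);
  semigroup_self_map : forall t z, 0 <= t -> disk z -> disk (phi t z);
  semigroup_id : forall z, disk z -> phi 0 z = z;
  semigroup_comp : forall t s z, 0 <= t -> 0 <= s -> disk z ->
    phi (t + s) z = phi t (phi s z);
  semigroup_cv : forall K, compact_subset K -> (forall z, K z -> disk z) ->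
    forall eps : posreal,
      at_right 0 (fun t => forall z, K z -> Cmod (phi t z - phi 0 z)%C < eps)
}.

Definition nontrivial (phi : R -> C -> C) : Prop :=
  exists t z, 0 <= t /\ disk z /\ phi t z <> z.

Definition is_generator (phi : R -> C -> C) (G : C -> C) : Prop :=
  forall z, disk z ->
    filterlim (fun t : R => ((phi t z - z) / RtoC t)%C)
      (at_right 0) (locally (T := C_UniformSpace) (G z)).

(* The point [b] of the Berkson-Porta representation of the generator. It is
   determined by [phi] only when the semigroup is nontrivial. *)
Definition Denjoy_Wolff_point (phi : R -> C -> C) (b : C) : Prop :=
  Cmod b <= 1 /\
  exists P : C -> C,
    analytic P /\ (forall z, disk z -> 0 <= Re (P z)) /\
    is_generator phi (fun z => ((Cconj b * z - 1) * (z - b) * P z)%C).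

(* [x ^ a] for [0 <= x] and [0 < a]. The guard is needed because
   [Rpower 0 a = 1]. *)
Definition rpow (x a : R) : R := if Req_EM_T x 0 then 0 else Rpower x a.

Definition circle_pt (r theta : R) : C := (r * cos theta, r * sin theta).

(* For [p = p_infty] and [f] analytic, the supremum is a finite maximum, so
   the projection [real] loses nothing. The case [m_infty] is irrelevant. *)
Definition Mp (p : Rbar) (r : R) (f : C -> C) : R :=
  match p with
  | Finite q =>
      rpow (RInt (fun theta => rpow (Cmod (f (circle_pt r theta))) q) 0 (2 * PI)
              / (2 * PI)) (/ q)
  | p_infty =>
      real (Lub_Rbar (fun y => exists theta, y = Cmod (f (circle_pt r theta))))
  | m_infty => 0
  end.

Definition Hnorm (p : Rbar) (alpha : R) (f : C -> C) : Rbar :=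
  Lub_Rbar (fun y => exists r, 0 <= r < 1 /\
                       y = Rpower (1 - r) alpha * Mp p r f).

Definition Hspace (p : Rbar) (alpha : R) (f : C -> C) : Prop :=
  analytic f /\ Rbar_lt (Hnorm p alpha f) p_infty.

Definition Hspace0 (p : Rbar) (alpha : R) (f : C -> C) : Prop :=
  Hspace p alpha f /\
  filterlim (fun r => Rpower (1 - r) alpha * Mp p r f) (at_left 1) (locally 0).

Definition Top (phi : R -> C -> C) (t : R) (f : C -> C) : C -> C :=
  fun z => (C_derive (phi t) z * f (phi t z))%C.

(* [S] maps [X] to itself, with operator norm at most [M] for the norm [N]. *)
Definition op_norm_le (X : (C -> C) -> Prop) (N : (C -> C) -> Rbar)
    (S : (C -> C) -> (C -> C)) (M : R) : Prop :=
  0 <= M /\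
  forall f, X f -> X (S f) /\ Rbar_le (N (S f)) (Rbar_mult M (N f)).

(* The space [[phi_t', X]]. Norms take values in [Rbar], which carries no
   uniform structure, hence the explicit [eps] for the limit. *)
Definition continuity_space (phi : R -> C -> C) (X : (C -> C) -> Prop)
    (N : (C -> C) -> Rbar) (f : C -> C) : Prop :=
  X f /\
  forall eps : posreal,
    at_right 0 (fun t => Rbar_lt (N (fun z => (Top phi t f z - f z)%C)) eps).

(* Main.v *)
Require Import Defs.
From Stdlib Require Import Reals List Lra Lia.
From Coquelicot Require Import Coquelicot.
Open Scope R_scope.

(* Conjugate the semigroup to the right half plane by W(z) = (b + z) / (b -
   z), sending b to infinity: psi_t = W o phi_t o W^-1. The Berkson-Porta
   formula makes Re psi_t(w) nondecreasing in t, so psi_t(w) - w has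
   nonnegative real part, and the Schwarz-Pick lemma bounds it and its
   derivative, in each cone |w + 1| <= k Re w, by a multiple of Re w and a
   constant, both tending to 0 with t. Hence T_t f is close to f on cones, and
   in a short time no trajectory enters a cone from outside a wider one. What
   happens outside the cones is absorbed by the uniform bound M on ||T_t||: if
   |f| <= |F| there with ||F|| <= eps, then |T_t f| <= |T_t F| at the points
   which phi_t keeps outside, and ||T_t F|| <= M eps. For f bounded take F = c
   z^n, whose norm tends to 0 as n grows; dilations then give all of H_0. For
   the function f = W^gamma with gamma = alpha + 1/p, which is not in H_0,
   take F = W^(gamma + i lam) and W^(gamma - i lam), suitably normalized,
   together with a monomial. *)

(** * Complex differentiation *)

(** The cone [|w + 1| <= k Re w] is the image of the Stolz angle [2 |b - z| <= k (1 - |z|^2)] at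
    [b]. The obstacle is the region outside these angles: no smallness of [psi_t w - w] relative to
    [Re w] is available there, and a function outside [H_0] is not a norm limit of its dilates. Only
    absolute values can be estimated there, so majorants of small norm must be produced.

    For [W^gamma] a monomial is not enough of a majorant, because [W] is unbounded near [b]. The
    exponent [gamma = alpha + 1/p] makes the [p]-mean of [|W|^gamma] over [|z| = r] grow exactly
    like [(1 - r)^(-alpha)], and this mean concentrates where [|W|] is of order [1 / (1 - r)]. The
    factor [|W^(i lam)| = exp (- lam arg W)], normalized by [exp (- lam pi / 2)], is close to 1 at
    one boundary ray of the half plane and small away from it, and [W^(- i lam)] serves the other
    ray. The bulk of the mean is thus damped, while the values outside a wide cone are kept.

    Analyticity is given as mere complex differentiability; the continuity of [phi_t'], on which the
    integral formulas rest, comes from [T_t 1 = phi_t'] being in the space. *)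

Definition cderiv (f : C -> C) (z l : C) : Prop :=
  forall eps, 0 < eps -> exists del, 0 < del /\
    forall y, Cmod (y - z)%C < del ->
      Cmod (f y - f z - l * (y - z))%C <= eps * Cmod (y - z)%C.

Definition ccont (f : C -> C) (z : C) : Prop :=
  forall eps, 0 < eps -> exists del, 0 < del /\
    forall y, Cmod (y - z)%C < del -> Cmod (f y - f z)%C < eps.

Definition copen (U : C -> Prop) : Prop :=
  forall z, U z -> exists del, 0 < del /\ forall y, Cmod (y - z)%C < del -> U y.

(* Requiring [df] to be continuous spares Goursat's theorem. *)
Definition holo (U : C -> Prop) (f df : C -> C) : Prop :=
  forall z, U z -> cderiv f z (df z) /\ ccont df z.

Lemma is_derive_cderiv (f : C -> C) (z l : C) :
  is_derive (K := C_AbsRing) (V := C_NormedModule) f z l -> cderiv f z l.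
Proof.
  intros [_ H] eps Heps.
  destruct (H z (fun P HP => HP) (mkposreal eps Heps)) as [d Hd].
  exists d; split; [apply cond_pos|].
  intros y Hy.
  specialize (Hd y Hy).
  change (Cmod (f y - f z - (y - z) * l)%C <= eps * Cmod (y - z)%C) in Hd.
  replace (f y - f z - l * (y - z))%C with (f y - f z - (y - z) * l)%C by ring.
  exact Hd.
Qed.

Lemma cderiv_is_derive (f : C -> C) (z l : C) :
  cderiv f z l -> is_derive (K := C_AbsRing) (V := C_NormedModule) f z l.
Proof.
  intros H; split.
  - apply (@is_linear_scal_l C_AbsRing C_NormedModule l).
  - intros x Hx eps.
    apply (is_filter_lim_locally_unique (K := C_AbsRing) (V := AbsRing_NormedModule C_AbsRing)) in Hx.
    rewrite <- Hx; clear x Hx.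
    destruct (H eps (cond_pos eps)) as [d [Hd Hd']].
    exists (mkposreal d Hd). intros y Hy.
    specialize (Hd' y Hy).
    change (Cmod (f y - f z - (y - z) * l)%C <= eps * Cmod (y - z)%C).
    replace (f y - f z - (y - z) * l)%C with (f y - f z - l * (y - z))%C by ring.
    exact Hd'.
Qed.

Lemma cderiv_analytic (f df : C -> C) :
  (forall z, disk z -> cderiv f z (df z)) -> analytic f.
Proof. intros H z Hz; exists (df z); apply cderiv_is_derive; auto. Qed.

Lemma cderiv_C_derive (f : C -> C) (z l : C) : cderiv f z l -> C_derive f z = l.
Proof. intros H; apply is_C_derive_unique, cderiv_is_derive, H. Qed.

Lemma analytic_cderiv (f : C -> C) (z : C) :
  analytic f -> disk z -> cderiv f z (C_derive f z).
Proof.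
  intros H Hz. destruct (H z Hz) as [l Hl]. apply is_derive_cderiv in Hl.
  now rewrite (cderiv_C_derive _ _ _ Hl).
Qed.

Lemma cderiv_ccont (f : C -> C) (z l : C) : cderiv f z l -> ccont f z.
Proof.
  intros H eps Heps. destruct (H 1 Rlt_0_1) as [d [Hd Hd']].
  set (m := 1 + Cmod l + 1).
  assert (Hm : 0 < m) by (unfold m; generalize (Cmod_ge_0 l); lra).
  exists (Rmin d (eps / m)); split.
  { apply Rmin_glb_lt; auto. apply Rdiv_lt_0_compat; auto. }
  intros y Hy.
  assert (H1 := Rlt_le_trans _ _ _ Hy (Rmin_l _ _)).
  assert (H2 := Rlt_le_trans _ _ _ Hy (Rmin_r _ _)).
  specialize (Hd' y H1).
  replace (f y - f z)%C with ((f y - f z - l * (y - z)) + l * (y - z))%C by ring.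
  eapply Rle_lt_trans. apply Cmod_triangle. rewrite Cmod_mult.
  apply (Rmult_lt_compat_r m) in H2; auto.
  replace (eps / m * m) with eps in H2 by (field; lra).
  unfold m in H2. generalize (Cmod_ge_0 (y - z)); nra.
Qed.

Lemma analytic_ccont (f : C -> C) (z : C) : analytic f -> disk z -> ccont f z.
Proof. intros H Hz. eapply cderiv_ccont. apply analytic_cderiv; eauto. Qed.

Lemma ccont_ext_loc (f g : C -> C) (U : C -> Prop) (z : C) :
  copen U -> U z -> (forall y, U y -> f y = g y) -> ccont f z -> ccont g z.
Proof.
  intros HU Hz E H eps Heps. destruct (HU z Hz) as [d [Hd Hd']].
  destruct (H eps Heps) as [d2 [Hd2 Hd2']].
  exists (Rmin d d2); split; [now apply Rmin_glb_lt|]. intros y Hy.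
  rewrite <- !E; auto.
  - apply Hd2'. eapply Rlt_le_trans; [exact Hy| apply Rmin_r].
  - apply Hd'. eapply Rlt_le_trans; [exact Hy| apply Rmin_l].
Qed.

Lemma cderiv_ext_loc (f g : C -> C) (U : C -> Prop) (z l : C) :
  copen U -> U z -> (forall y, U y -> f y = g y) -> cderiv f z l -> cderiv g z l.
Proof.
  intros HU Hz E H eps Heps. destruct (HU z Hz) as [d [Hd Hd']].
  destruct (H eps Heps) as [d2 [Hd2 Hd2']].
  exists (Rmin d d2); split; [now apply Rmin_glb_lt|]. intros y Hy.
  rewrite <- !E; auto.
  - apply Hd2'. eapply Rlt_le_trans; [exact Hy| apply Rmin_r].
  - apply Hd'. eapply Rlt_le_trans; [exact Hy| apply Rmin_l].
Qed.

Lemma ccont_const (c z : C) : ccont (fun _ => c) z.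
Proof.
  intros eps Heps; exists 1; split; [lra|]. intros y _.
  replace (c - c)%C with (RtoC 0) by ring. now rewrite Cmod_0.
Qed.

Lemma ccont_id (z : C) : ccont (fun y => y) z.
Proof. intros eps Heps; exists eps; auto. Qed.

Lemma ccont_plus (f g : C -> C) (z : C) :
  ccont f z -> ccont g z -> ccont (fun y => f y + g y)%C z.
Proof.
  intros Hf Hg eps Heps.
  destruct (Hf (eps / 2)) as [d1 [H1 H1']]; [lra|].
  destruct (Hg (eps / 2)) as [d2 [H2 H2']]; [lra|].
  exists (Rmin d1 d2); split; [now apply Rmin_glb_lt|]. intros y Hy.
  assert (A := H1' y (Rlt_le_trans _ _ _ Hy (Rmin_l _ _))).
  assert (B := H2' y (Rlt_le_trans _ _ _ Hy (Rmin_r _ _))).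
  replace (f y + g y - (f z + g z))%C with ((f y - f z) + (g y - g z))%C by ring.
  eapply Rle_lt_trans; [apply Cmod_triangle| lra].
Qed.

Lemma ccont_mult (f g : C -> C) (z : C) :
  ccont f z -> ccont g z -> ccont (fun y => f y * g y)%C z.
Proof.
  intros Hf Hg eps Heps.
  set (m := Cmod (f z) + Cmod (g z) + 1).
  assert (P1 := Cmod_ge_0 (f z)). assert (P2 := Cmod_ge_0 (g z)).
  assert (Hm : 0 < m) by (unfold m; lra).
  assert (He : 0 < Rmin 1 (eps / (2 * m))).
  { apply Rmin_glb_lt; [lra|]. apply Rdiv_lt_0_compat; lra. }
  destruct (Hf _ He) as [d1 [H1 H1']].
  destruct (Hg _ He) as [d2 [H2 H2']].
  exists (Rmin d1 d2); split; [now apply Rmin_glb_lt|]. intros y Hy.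
  assert (A := H1' y (Rlt_le_trans _ _ _ Hy (Rmin_l _ _))).
  assert (B := H2' y (Rlt_le_trans _ _ _ Hy (Rmin_r _ _))).
  assert (A1 := Rlt_le_trans _ _ _ A (Rmin_l _ _)).
  assert (A2 := Rlt_le_trans _ _ _ A (Rmin_r _ _)).
  assert (B2 := Rlt_le_trans _ _ _ B (Rmin_r _ _)).
  replace (f y * g y - f z * g z)%C
    with ((f y - f z) * (g y - g z) + ((f y - f z) * g z + f z * (g y - g z)))%C by ring.
  eapply Rle_lt_trans; [apply Cmod_triangle|].
  eapply Rle_lt_trans; [apply Rplus_le_compat_l, Cmod_triangle|].
  rewrite !Cmod_mult.
  set (e := eps / (2 * m)) in *.
  assert (Ee : e * (2 * m) = eps) by (unfold e; field; lra).
  assert (P3 := Cmod_ge_0 (f y - f z)). assert (P4 := Cmod_ge_0 (g y - g z)).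
  assert (0 < e) by (unfold e; apply Rdiv_lt_0_compat; lra).
  apply Rle_lt_trans with (1 * e + (e * Cmod (g z) + Cmod (f z) * e)).
  - apply Rplus_le_compat; [apply Rmult_le_compat; lra|].
    apply Rplus_le_compat; apply Rmult_le_compat; lra.
  - unfold m in Ee; nra.
Qed.

Lemma ccont_comp (f g : C -> C) (z : C) :
  ccont g z -> ccont f (g z) -> ccont (fun y => f (g y)) z.
Proof.
  intros Hg Hf eps Heps. destruct (Hf eps Heps) as [d [Hd Hd']].
  destruct (Hg d Hd) as [d2 [Hd2 Hd2']]. exists d2; auto.
Qed.

Lemma Cmod_minus_sym (x y : C) : Cmod (x - y)%C = Cmod (y - x)%C.
Proof. rewrite <- Cmod_opp. f_equal; ring. Qed.

Lemma Cmod_triangle_inv (x y : C) : Cmod x - Cmod y <= Cmod (x - y)%C.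
Proof.
  assert (H := Cmod_triangle (x - y) y).
  replace (x - y + y)%C with x in H by ring. lra.
Qed.

Lemma Cmod_neq_0 (z : C) : z <> 0%C -> 0 < Cmod z.
Proof. intros H; now apply Cmod_gt_0. Qed.

Lemma cderiv_inv (z : C) : z <> 0%C -> cderiv Cinv z (- / (z * z))%C.
Proof.
  intros Hz eps Heps. assert (P := Cmod_neq_0 z Hz). set (m := Cmod z) in *.
  exists (Rmin (m / 2) (eps * (m * m * m) / 2)). split.
  { apply Rmin_glb_lt; [lra|]. apply Rdiv_lt_0_compat; [|lra].
    repeat apply Rmult_lt_0_compat; lra. }
  intros y Hy.
  assert (A1 := Rlt_le_trans _ _ _ Hy (Rmin_l _ _)).
  assert (A2 := Rlt_le_trans _ _ _ Hy (Rmin_r _ _)).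
  assert (Q := Cmod_triangle_inv z y). rewrite Cmod_minus_sym in Q. fold m in Q.
  assert (Hy0 : y <> 0%C).
  { intros E; subst y. rewrite Cmod_0 in Q. lra. }
  replace (/ y - / z - - / (z * z) * (y - z))%C
    with ((y - z) * (y - z) / (z * z * y))%C by (field; auto).
  rewrite Cmod_div by (repeat apply Cmult_neq_0; auto).
  rewrite !Cmod_mult. fold m. set (d := Cmod (y - z)) in *.
  assert (P3 : 0 <= d) by apply Cmod_ge_0.
  assert (P4 : m / 2 < Cmod y) by lra.
  apply Rle_div_l; [repeat apply Rmult_lt_0_compat; lra|].
  replace (eps * d * (m * m * Cmod y)) with (d * (eps * (m * m * Cmod y))) by ring.
  apply Rmult_le_compat_l; auto.
  apply Rle_trans with (eps * (m * m * (m / 2))); [lra|].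
  apply Rmult_le_compat_l; [lra|]. apply Rmult_le_compat_l; [nra|lra].
Qed.

Lemma ccont_inv (f : C -> C) (z : C) :
  ccont f z -> f z <> 0%C -> ccont (fun y => / f y)%C z.
Proof.
  intros H H0. apply (ccont_comp Cinv f); auto.
  eapply cderiv_ccont, cderiv_inv; auto.
Qed.

Lemma ccont_opp (f : C -> C) (z : C) : ccont f z -> ccont (fun y => - f y)%C z.
Proof.
  intros H eps Heps. destruct (H eps Heps) as [d [Hd Hd']].
  exists d; split; auto. intros y Hy.
  replace (- f y - - f z)%C with (- (f y - f z))%C by ring.
  rewrite Cmod_opp; auto.
Qed.

Lemma ccont_minus (f g : C -> C) (z : C) :
  ccont f z -> ccont g z -> ccont (fun y => f y - g y)%C z.
Proof. intros; apply ccont_plus; auto; now apply ccont_opp. Qed.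

Lemma ccont_div (f g : C -> C) (z : C) :
  ccont f z -> ccont g z -> g z <> 0%C -> ccont (fun y => f y / g y)%C z.
Proof. intros; apply ccont_mult; auto; now apply ccont_inv. Qed.

Lemma Cminus_eq_0 (y z : C) : (y - z = 0)%C -> y = z.
Proof. intros H. replace y with (y - z + z)%C by ring. rewrite H; ring. Qed.

Lemma cderiv_const (c z : C) : cderiv (fun _ => c) z 0.
Proof.
  intros eps Heps; exists 1; split; [lra|]. intros y _.
  replace (c - c - 0 * (y - z))%C with (RtoC 0) by ring. rewrite Cmod_0.
  apply Rmult_le_pos; [lra| apply Cmod_ge_0].
Qed.

Lemma cderiv_id (z : C) : cderiv (fun y => y) z 1.
Proof.
  intros eps Heps; exists 1; split; [lra|]. intros y _.
  replace (y - z - 1 * (y - z))%C with (RtoC 0) by ring. rewrite Cmod_0.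
  apply Rmult_le_pos; [lra| apply Cmod_ge_0].
Qed.

Lemma cderiv_eq (f : C -> C) (z l l' : C) : cderiv f z l -> l = l' -> cderiv f z l'.
Proof. now intros H <-. Qed.

Lemma cderiv_plus (f g : C -> C) (z l m : C) :
  cderiv f z l -> cderiv g z m -> cderiv (fun y => f y + g y)%C z (l + m).
Proof.
  intros Hf Hg eps Heps.
  destruct (Hf (eps / 2)) as [d1 [H1 H1']]; [lra|].
  destruct (Hg (eps / 2)) as [d2 [H2 H2']]; [lra|].
  exists (Rmin d1 d2); split; [now apply Rmin_glb_lt|]. intros y Hy.
  assert (A := H1' y (Rlt_le_trans _ _ _ Hy (Rmin_l _ _))).
  assert (B := H2' y (Rlt_le_trans _ _ _ Hy (Rmin_r _ _))).
  replace (f y + g y - (f z + g z) - (l + m) * (y - z))%C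
    with ((f y - f z - l * (y - z)) + (g y - g z - m * (y - z)))%C by ring.
  eapply Rle_trans; [apply Cmod_triangle| lra].
Qed.

(* Caratheodory's characterization reduces the product and chain rules to continuity. *)
Lemma cderiv_slope (f g : C -> C) (z : C) :
  ccont g z -> (forall y, f y - f z = g y * (y - z))%C -> cderiv f z (g z).
Proof.
  intros Hg E eps Heps. destruct (Hg eps Heps) as [d [Hd Hd']].
  exists d; split; auto. intros y Hy. rewrite E.
  replace (g y * (y - z) - g z * (y - z))%C with ((g y - g z) * (y - z))%C by ring.
  rewrite Cmod_mult. apply Rmult_le_compat_r; [apply Cmod_ge_0|].
  left; auto.
Qed.

Definition slope (f : C -> C) (z l y : C) : C :=
  if Ceq_dec y z then l else ((f y - f z) / (y - z))%C.

Lemma slope_at (f : C -> C) (z l : C) : slope f z l z = l.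
Proof. unfold slope. destruct (Ceq_dec z z); congruence. Qed.

Lemma slope_off (f : C -> C) (z l y : C) : y <> z ->
  slope f z l y = ((f y - f z) / (y - z))%C.
Proof. intros H; unfold slope. destruct (Ceq_dec y z); congruence. Qed.

Lemma slope_spec (f : C -> C) (z l y : C) :
  (f y - f z = slope f z l y * (y - z))%C.
Proof.
  unfold slope. destruct (Ceq_dec y z) as [->|H]; [ring|].
  field. intros E; apply H. now apply Cminus_eq_0.
Qed.

Lemma slope_ccont (f : C -> C) (z l : C) : cderiv f z l -> ccont (slope f z l) z.
Proof.
  intros H eps Heps. destruct (H (eps / 2)) as [d [Hd Hd']]; [lra|].
  exists d; split; auto. intros y Hy. rewrite slope_at.
  destruct (Ceq_dec y z) as [->|Hyz].
  { rewrite slope_at. replace (l - l)%C with (RtoC 0) by ring. now rewrite Cmod_0. }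
  assert (Hn : (y - z)%C <> 0%C) by (intros E; apply Hyz; now apply Cminus_eq_0).
  assert (P := Cmod_neq_0 _ Hn).
  specialize (Hd' y Hy). rewrite (slope_spec f z l y) in Hd'.
  replace (slope f z l y * (y - z) - l * (y - z))%C
    with ((slope f z l y - l) * (y - z))%C in Hd' by ring.
  rewrite Cmod_mult in Hd'. apply Rmult_le_reg_r in Hd'; lra.
Qed.

Lemma cderiv_mult (f g : C -> C) (z l m : C) :
  cderiv f z l -> cderiv g z m ->
  cderiv (fun y => f y * g y)%C z (l * g z + f z * m).
Proof.
  intros Hf Hg.
  eapply cderiv_eq.
  - apply (cderiv_slope _ (fun y => slope f z l y * g y + f z * slope g z m y)%C).
    + apply ccont_plus; apply ccont_mult.
      * now apply slope_ccont.
      * eapply cderiv_ccont; eauto.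
      * apply ccont_const.
      * now apply slope_ccont.
    + intros y.
      replace (f y * g y - f z * g z)%C
        with ((f y - f z) * g y + f z * (g y - g z))%C by ring.
      rewrite (slope_spec f z l), (slope_spec g z m). ring.
  - rewrite !slope_at. reflexivity.
Qed.

Lemma cderiv_comp (f g : C -> C) (z l m : C) :
  cderiv g z m -> cderiv f (g z) l -> cderiv (fun y => f (g y)) z (l * m).
Proof.
  intros Hg Hf.
  eapply cderiv_eq.
  - apply (cderiv_slope _ (fun y => slope f (g z) l (g y) * slope g z m y)%C).
    + apply ccont_mult; [|now apply slope_ccont].
      apply (ccont_comp (slope f (g z) l) g).
      * eapply cderiv_ccont; eauto.
      * now apply slope_ccont.
    + intros y. cbv beta. rewrite (slope_spec f (g z) l (g y)), (slope_spec g z m y). apply Cmult_assoc.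
  - rewrite !slope_at. reflexivity.
Qed.

Lemma cderiv_scal (c : C) (f : C -> C) (z l : C) :
  cderiv f z l -> cderiv (fun y => c * f y)%C z (c * l).
Proof.
  intros H. eapply cderiv_eq.
  - apply cderiv_mult; [apply cderiv_const| exact H].
  - cbv beta; ring.
Qed.

Lemma cderiv_minus (f g : C -> C) (z l m : C) :
  cderiv f z l -> cderiv g z m -> cderiv (fun y => f y - g y)%C z (l - m).
Proof.
  intros Hf Hg. apply cderiv_plus; auto.
  eapply cderiv_eq.
  - apply (cderiv_ext_loc (fun y => (-1) * g y)%C _ (fun _ => True)).
    + intros y _; exists 1; split; [lra|auto].
    + exact I.
    + intros y _; ring.
    + apply cderiv_scal; eauto.
  - ring.
Qed.

Lemma cderiv_div (f g : C -> C) (z l m : C) :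
  cderiv f z l -> cderiv g z m -> g z <> 0%C ->
  cderiv (fun y => f y / g y)%C z ((l * g z - f z * m) / (g z * g z)).
Proof.
  intros Hf Hg H0. eapply cderiv_eq.
  - apply cderiv_mult; [exact Hf|].
    apply (cderiv_comp Cinv g); [exact Hg| now apply cderiv_inv].
  - simpl. field. auto.
Qed.

Lemma cderiv_pow (z : C) (n : nat) :
  exists l, cderiv (fun y => y ^ n)%C z l.
Proof.
  induction n as [|n [l IH]]; simpl.
  - exists 0%C. apply cderiv_const.
  - eexists. apply cderiv_mult; [apply cderiv_id| exact IH].
Qed.

(** The bridge from complex derivatives to real calculus along curves. Both parts are read off one
    estimate [K] for the complex difference quotient. *)
Lemma is_derive_curve (f : C -> C) (g1 g2 : R -> R) (s : R) (l : C) (m1 m2 : R) :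
  cderiv f (g1 s, g2 s) l -> is_derive g1 s m1 -> is_derive g2 s m2 ->
  is_derive (fun s => Re (f (g1 s, g2 s))) s (Re (l * (m1, m2))) /\
  is_derive (fun s => Im (f (g1 s, g2 s))) s (Im (l * (m1, m2))).
Proof.
  intros Hf H1 H2.
  apply is_derive_Reals in H1; apply is_derive_Reals in H2.
  assert (K : forall eps, 0 < eps -> exists d, 0 < d /\ forall h, h <> 0 -> Rabs h < d ->
    Cmod ((f (g1 (s+h)%R, g2 (s+h)%R) - f (g1 s, g2 s)) / RtoC h - l * (m1, m2))%C < eps).
  { set (z := (g1 s, g2 s)) in *. set (m := (m1, m2) : C).
    intros eps Heps.
    (* The cap 1 bounds the quotient [q] of the curve by [Cmod m + 1]; the other bound makes
       [l * (q - m)] at most [eps / 4]. *)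
    set (e1 := Rmin 1 (eps / (4 * (Cmod l + 1)))).
    assert (Pl := Cmod_ge_0 l). assert (Pm := Cmod_ge_0 m).
    assert (He1 : 0 < e1).
    { apply Rmin_glb_lt; [lra|]. apply Rdiv_lt_0_compat; lra. }
    destruct (H1 (e1 / 2)) as [d1 D1]; [lra|].
    destruct (H2 (e1 / 2)) as [d2 D2]; [lra|].
    destruct (Hf (eps / (4 * (Cmod m + 1)))) as [d3 [Hd3 D3]].
    { apply Rdiv_lt_0_compat; lra. }
    exists (Rmin (Rmin d1 d2) (d3 / (Cmod m + 1))). split.
    { repeat apply Rmin_glb_lt; try apply cond_pos. apply Rdiv_lt_0_compat; lra. }
    intros h Hh0 Hh.
    assert (B := Rlt_le_trans _ _ _ Hh (Rmin_l _ _)).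
    assert (B3 := Rlt_le_trans _ _ _ Hh (Rmin_r _ _)).
    assert (B1 := Rlt_le_trans _ _ _ B (Rmin_l _ _)).
    assert (B2 := Rlt_le_trans _ _ _ B (Rmin_r _ _)).
    specialize (D1 h Hh0 B1). specialize (D2 h Hh0 B2).
    set (y := (g1 (s + h), g2 (s + h)) : C) in *.
    assert (Hc : RtoC h <> 0%C) by (intros E; apply Hh0; now apply RtoC_inj).
    assert (Ph : 0 < Rabs h) by now apply Rabs_pos_lt.
    assert (Hq : Cmod ((y - z) / RtoC h - m)%C < e1).
    { assert (E : ((y - z) / RtoC h - m)%C =
        ((g1 (s+h) - g1 s)/h - m1, (g2 (s+h) - g2 s)/h - m2)%R :> C).
      { unfold y, z, m, Cdiv, Cinv, Cminus, Cplus, Cmult, Copp, RtoC; simpl.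
        f_equal; field; auto. }
      rewrite E. eapply Rle_lt_trans; [apply Cmod_2Rmax|]. simpl.
      apply Rle_lt_trans with (2 * Rmax (Rabs ((g1 (s+h) - g1 s)/h - m1)) (Rabs ((g2 (s+h) - g2 s)/h - m2))).
      - apply Rmult_le_compat_r.
        + eapply Rle_trans; [apply Rabs_pos| apply Rmax_l].
        + rewrite <- (sqrt_square 2) at 2 by lra. apply sqrt_le_1; lra.
      - apply Rmax_case; lra. }
    set (q := ((y - z) / RtoC h)%C) in *.
    assert (Ey : (y - z)%C = (q * RtoC h)%C) by (unfold q; field; auto).
    assert (Hqm : Cmod q < Cmod m + 1).
    { assert (T := Cmod_triangle_inv q m). assert (e1 <= 1) by apply Rmin_l. lra. }
    assert (Hyz : Cmod (y - z)%C < d3).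
    { rewrite Ey, Cmod_mult, Cmod_R.
      apply Rle_lt_trans with ((Cmod m + 1) * Rabs h).
      - apply Rmult_le_compat_r; lra.
      - apply (Rmult_lt_compat_l (Cmod m + 1)) in B3; [|lra].
        replace ((Cmod m + 1) * (d3 / (Cmod m + 1))) with d3 in B3 by (field; lra). lra. }
    specialize (D3 y Hyz). rewrite Ey in D3.
    assert (D4 : Cmod ((f y - f z) / RtoC h - l * q)%C <= eps / 4).
    { replace ((f y - f z) / RtoC h - l * q)%C
        with ((f y - f z - l * (q * RtoC h)) / RtoC h)%C by (field; auto).
      rewrite Cmod_div, Cmod_R by auto. apply Rle_div_l; [lra|].
      eapply Rle_trans; [exact D3|]. rewrite Cmod_mult, Cmod_R.
      apply Rle_trans with (eps / (4 * (Cmod m + 1)) * ((Cmod m + 1) * Rabs h)).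
      - apply Rmult_le_compat_l; [left; apply Rdiv_lt_0_compat; lra|].
        apply Rmult_le_compat_r; lra.
      - right; field; lra. }
    replace ((f y - f z) / RtoC h - l * m)%C
      with (((f y - f z) / RtoC h - l * q) + l * (q - m))%C by ring.
    eapply Rle_lt_trans; [apply Cmod_triangle|]. rewrite Cmod_mult.
    assert (Cmod l * Cmod (q - m)%C <= eps / 4).
    { apply Rle_trans with (Cmod l * (eps / (4 * (Cmod l + 1)))).
      - apply Rmult_le_compat_l; auto. left. eapply Rlt_le_trans; [exact Hq| apply Rmin_r].
      - apply Rle_trans with ((Cmod l + 1) * (eps / (4 * (Cmod l + 1)))).
        + apply Rmult_le_compat_r; [left; apply Rdiv_lt_0_compat; lra| lra].
        + right; field; lra. }
    lra. }
  split; apply is_derive_Reals; intros eps Heps; destruct (K eps Heps) as [d [Hd D]];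
    exists (mkposreal d Hd); intros h Hh0 Hh; specialize (D h Hh0 Hh);
    (eapply Rle_lt_trans; [|exact D]).
  - eapply Rle_trans; [|apply re_le_Cmod]. right; f_equal.
    unfold Re, Cdiv, Cinv, Cminus, Cplus, Cmult, Copp, RtoC; simpl; field; auto.
  - eapply Rle_trans; [|eapply Rle_trans; [apply Rmax_r| apply Rmax_Cmod]].
    right; f_equal.
    unfold Im, Cdiv, Cinv, Cminus, Cplus, Cmult, Copp, RtoC; simpl; field; auto.
Qed.

Ltac ccont_tac :=
  repeat first [ assumption | apply ccont_const | apply ccont_id
    | apply ccont_minus | apply ccont_opp | apply ccont_plus | apply ccont_div
    | apply ccont_mult | apply ccont_inv ].

(** * Mean value property and the Schwarz-Pick lemma *)

Lemma Cmod_le_Rabs (z : C) : Cmod z <= Rabs (Re z) + Rabs (Im z).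
Proof.
  replace z with (RtoC (Re z) + Ci * RtoC (Im z))%C at 1.
  - eapply Rle_trans; [apply Cmod_triangle|].
    rewrite Cmod_mult, Cmod_Ci, !Cmod_R; lra.
  - destruct z; unfold Ci, RtoC, Cplus, Cmult, Re, Im; simpl; f_equal; ring.
Qed.

Lemma im_le_Cmod (z : C) : Rabs (Im z) <= Cmod z.
Proof. eapply Rle_trans; [apply Rmax_r| apply Rmax_Cmod]. Qed.

Lemma Re_minus (a b : C) : Re (a - b)%C = Re a - Re b.
Proof. reflexivity. Qed.

Lemma Im_minus (a b : C) : Im (a - b)%C = Im a - Im b.
Proof. reflexivity. Qed.

(** Joint continuity in two real parameters is the form in which differentiation under the integral
    and uniform continuity on rectangles take their hypotheses. *)
Lemma ccont_2d (g : C -> C) (x y : R -> R -> R) (u v : R) :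
  ccont g (x u v, y u v) -> continuity_2d_pt x u v -> continuity_2d_pt y u v ->
  continuity_2d_pt (fun u v => Re (g (x u v, y u v))) u v /\
  continuity_2d_pt (fun u v => Im (g (x u v, y u v))) u v.
Proof.
  intros Hg Hx Hy.
  assert (K : forall eps : posreal,
    locally_2d (fun u' v' => Cmod (g (x u' v', y u' v') - g (x u v, y u v))%C < eps) u v).
  { intros eps. destruct (Hg eps (cond_pos eps)) as [d [Hd D]].
    assert (Hd2 : 0 < d / 2) by lra.
    generalize (locally_2d_and _ _ _ _ (Hx (mkposreal _ Hd2)) (Hy (mkposreal _ Hd2))).
    apply locally_2d_impl, locally_2d_forall. intros u' v' [H1 H2]. apply D.
    eapply Rle_lt_trans; [apply Cmod_le_Rabs|].
    rewrite Re_minus, Im_minus. simpl in *. lra. }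
  split; intros eps; generalize (K eps); apply locally_2d_impl, locally_2d_forall;
    intros u' v' H; (eapply Rle_lt_trans; [|exact H]).
  - rewrite <- Re_minus; apply re_le_Cmod.
  - rewrite <- Im_minus; apply im_le_Cmod.
Qed.

Lemma circle_pt_2d (u v : R) :
  continuity_2d_pt (fun u v => u * cos v) u v /\ continuity_2d_pt (fun u v => u * sin v) u v.
Proof.
  split; apply continuity_2d_pt_mult; try apply continuity_2d_pt_id1;
    apply (continuity_1d_2d_pt_comp _ (fun _ v => v)); try apply continuity_2d_pt_id2.
  - apply continuity_cos.
  - apply continuity_sin.
Qed.

Lemma Cmod_circle_pt (r t : R) : 0 <= r -> Cmod (circle_pt r t) = r.
Proof.
  intros Hr. unfold Cmod, circle_pt; simpl.
  replace (r * cos t * (r * cos t * 1) + r * sin t * (r * sin t * 1))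
    with (r * r * (Rsqr (sin t) + Rsqr (cos t))) by (unfold Rsqr; ring).
  rewrite sin2_cos2, Rmult_1_r. now apply sqrt_square.
Qed.

Lemma circle_pt_disk (r t : R) : 0 <= r < 1 -> disk (circle_pt r t).
Proof. intros Hr. unfold disk. rewrite Cmod_circle_pt; lra. Qed.

Lemma continuity_2d_continuous_2 (f : R -> R -> R) (u v : R) :
  continuity_2d_pt f u v -> continuous (f u) v.
Proof.
  intros H. apply continuity_pt_filterlim, continuity_pt_locally.
  intros eps. destruct (H eps) as [d D]. exists d. intros y Hy.
  apply D; auto. rewrite Rminus_eq_0, Rabs_R0. apply cond_pos.
Qed.

Lemma circle_continuous (g : C -> C) (r t : R) : ccont g (circle_pt r t) ->
  continuous (fun t => Re (g (circle_pt r t))) t /\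
  continuous (fun t => Im (g (circle_pt r t))) t.
Proof.
  intros H. destruct (circle_pt_2d r t) as [H1 H2].
  destruct (ccont_2d g _ _ r t H H1 H2) as [H3 H4].
  split; [apply (continuity_2d_continuous_2 _ r t H3)
         | apply (continuity_2d_continuous_2 _ r t H4)].
Qed.

Section MeanValue.

Variables (H dH : C -> C).
(** The origin is set apart because the mean value property will be applied to a function containing
    a difference quotient based at 0, which is known there to be continuous. *)
Hypothesis holoH : forall z, disk z -> z <> 0%C -> cderiv H z (dH z) /\ ccont dH z.
Hypothesis contH : ccont H 0%C.

Let D (r t : R) : R := Re (dH (circle_pt r t) * (cos t, sin t))%C.

Lemma circle_pt_neq_0 (r t : R) : 0 < r -> circle_pt r t <> 0%C.
Proof.
  intros Hr E. assert (P := Cmod_circle_pt r t). rewrite E, Cmod_0 in P. lra.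
Qed.

Lemma radial_derive (r t : R) : 0 < r < 1 ->
  is_derive (fun r => Re (H (circle_pt r t))) r (D r t).
Proof.
  intros Hr. destruct (holoH (circle_pt r t)) as [H1 _].
  - apply circle_pt_disk; lra.
  - apply circle_pt_neq_0; lra.
  - apply (is_derive_curve H (fun r => r * cos t) (fun r => r * sin t) r
      (dH (circle_pt r t)) (cos t) (sin t)); auto; auto_derive; auto; ring.
Qed.

(** The Cauchy-Riemann equations in polar form: the same [D] gives the radial derivative of [Re H]
    and, up to the factor [r], the angular derivative of [Im H]. *)
Lemma angular_derive (r t : R) : 0 < r < 1 ->
  is_derive (fun t => Im (H (circle_pt r t))) t (r * D r t).
Proof.
  intros Hr. destruct (holoH (circle_pt r t)) as [H1 _].
  - apply circle_pt_disk; lra.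
  - apply circle_pt_neq_0; lra.
  - evar_last.
    + apply (is_derive_curve H (fun t => r * cos t) (fun t => r * sin t) t
        (dH (circle_pt r t)) (- r * sin t) (r * cos t)); auto; auto_derive; auto; ring.
    + unfold D, Re, Im, Cmult; simpl; ring.
Qed.

Lemma radial_derive_2d (r t : R) : 0 < r < 1 -> continuity_2d_pt D r t.
Proof.
  intros Hr. destruct (holoH (circle_pt r t)) as [_ H1].
  - apply circle_pt_disk; lra.
  - apply circle_pt_neq_0; lra.
  - destruct (circle_pt_2d r t) as [C1 C2].
    destruct (ccont_2d dH _ _ r t H1 C1 C2) as [C3 C4].
    apply continuity_2d_pt_ext with (fun u v =>
      Re (dH (u * cos v, u * sin v)) * cos v - Im (dH (u * cos v, u * sin v)) * sin v).
    { reflexivity. }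
    apply continuity_2d_pt_minus; apply continuity_2d_pt_mult; auto;
      apply (continuity_1d_2d_pt_comp _ (fun _ v => v)); try apply continuity_2d_pt_id2.
    + apply continuity_cos.
    + apply continuity_sin.
Qed.

Lemma circle_ex_RInt (r : R) : 0 < r < 1 ->
  ex_RInt (fun t => Re (H (circle_pt r t))) 0 (2 * PI).
Proof.
  intros Hr. apply (ex_RInt_continuous (V := R_CompleteNormedModule)). intros t _.
  apply circle_continuous. destruct (holoH (circle_pt r t)) as [H1 _].
  - apply circle_pt_disk; lra.
  - apply circle_pt_neq_0; lra.
  - eapply cderiv_ccont; eauto.
Qed.

(** After differentiation under the integral, [r] times the result is the integral of the angular
    derivative of [Im H] over a full period, which vanishes. *)
Lemma circle_mean_derive (r : R) : 0 < r < 1 ->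
  is_derive (fun r => RInt (fun t => Re (H (circle_pt r t))) 0 (2 * PI)) r 0.
Proof.
  intros Hr.
  assert (L : locally r (fun y => 0 < y < 1)).
  { apply (open_and (fun y => 0 < y) (fun y => y < 1)); auto.
    - apply open_gt.
    - apply open_lt. }
  evar_last.
  - apply (is_derive_RInt_param (fun r t => Re (H (circle_pt r t)))).
    + generalize L; apply filter_imp. intros y Hy t _. eexists; now apply radial_derive.
    + intros t _. apply continuity_2d_pt_ext_loc with D.
      * destruct L as [d Hd]. exists d. intros u v Hu _. symmetry.
        apply is_derive_unique, radial_derive, Hd, Hu.
      * now apply radial_derive_2d.
    + generalize L; apply filter_imp. intros y Hy. now apply circle_ex_RInt.
  - apply Rmult_eq_reg_l with r; [|lra]. rewrite Rmult_0_r.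
    rewrite (RInt_ext _ (D r)).
    2:{ intros t _. apply is_derive_unique, radial_derive, Hr. }
    assert (E : is_RInt (fun t => r * D r t) 0 (2 * PI)
       (minus (Im (H (circle_pt r (2 * PI)))) (Im (H (circle_pt r 0))))).
    { apply (is_RInt_derive (V := R_CompleteNormedModule) (fun t => Im (H (circle_pt r t)))).
      - intros t _. now apply angular_derive.
      - intros t _. apply (continuous_scal_r (V := R_NormedModule)).
        now apply continuity_2d_continuous_2, radial_derive_2d. }
    unfold circle_pt in E at 1 2. rewrite cos_2PI, sin_2PI, cos_0, sin_0 in E.
    rewrite minus_eq_zero in E.
    change (is_RInt (V := R_CompleteNormedModule) (fun t => r * D r t) 0 (2 * PI) 0) in E.
    rewrite <- (is_RInt_unique (V := R_CompleteNormedModule) _ _ _ _ E) at 2. symmetry.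
    apply (RInt_scal (V := R_CompleteNormedModule)).
    apply (ex_RInt_continuous (V := R_CompleteNormedModule)). intros t _.
    now apply continuity_2d_continuous_2, radial_derive_2d.
Qed.

(** The circle mean does not depend on the radius, and on a small circle of radius [s] it is close
    to the value at 0 by continuity. *)
Lemma mean_value (r : R) : 0 < r < 1 ->
  RInt (fun t => Re (H (circle_pt r t))) 0 (2 * PI) = 2 * PI * Re (H 0%C).
Proof.
  intros Hr.
  set (A := fun r => RInt (fun t => Re (H (circle_pt r t))) 0 (2 * PI)).
  change (A r = 2 * PI * Re (H 0%C)).
  assert (PP := PI_RGT_0).
  apply cond_eq. intros eps Heps.
  destruct (contH (eps / (4 * PI))) as [d [Hd Hd']]. { apply Rdiv_lt_0_compat; lra. }
  set (s := Rmin (d / 2) (r / 2)).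
  assert (Hs : 0 < s) by (apply Rmin_glb_lt; lra).
  assert (Hs1 : s <= d / 2) by apply Rmin_l.
  assert (Hs2 : s <= r / 2) by apply Rmin_r.
  rewrite <- (eq_is_derive A s r).
  2:{ intros t Ht. apply circle_mean_derive. lra. }
  2:{ lra. }
  replace (2 * PI * Re (H 0%C)) with (RInt (fun _ => Re (H 0%C)) 0 (2 * PI)).
  2:{ rewrite RInt_const. unfold scal; simpl; unfold mult; simpl. ring. }
  unfold A.
  replace (RInt (fun t : R => Re (H (circle_pt s t))) 0 (2 * PI) - RInt (fun _ : R => Re (H 0%C)) 0 (2 * PI))
    with (RInt (fun t => minus (Re (H (circle_pt s t))) (Re (H 0%C))) 0 (2 * PI)).
  2:{ apply (RInt_minus (V := R_CompleteNormedModule)); [apply circle_ex_RInt; lra| apply ex_RInt_const]. }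
  eapply Rle_lt_trans.
  - apply (abs_RInt_le_const _ _ _ (eps / (4 * PI))).
    + lra.
    + apply (ex_RInt_minus (V := R_NormedModule)); [apply circle_ex_RInt; lra| apply ex_RInt_const].
    + intros t _. change (Rabs (Re (H (circle_pt s t) - H 0%C)%C) <= eps / (4 * PI)).
      eapply Rle_trans; [apply re_le_Cmod|]. left; apply Hd'.
      replace (circle_pt s t - 0)%C with (circle_pt s t) by ring.
      rewrite Cmod_circle_pt; lra.
  - replace ((2 * PI - 0) * (eps / (4 * PI))) with (eps / 2) by (field; lra). lra.
Qed.

End MeanValue.

Lemma disk_0 : disk 0%C.
Proof. unfold disk. rewrite Cmod_0; lra. Qed.

Lemma open_disk : copen disk.
Proof.
  intros z Hz. exists (1 - Cmod z). split; [unfold disk in Hz; lra|].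
  intros y Hy. unfold disk. assert (T := Cmod_triangle_inv y z). lra.
Qed.

Lemma open_neq_0 : copen (fun z => z <> 0%C).
Proof.
  intros z Hz. exists (Cmod z). split; [now apply Cmod_neq_0|].
  intros y Hy E. subst y. replace (0 - z)%C with (- z)%C in Hy by ring.
  rewrite Cmod_opp in Hy. lra.
Qed.

Section SchwarzPick.

Variables (h dh : C -> C).
Hypothesis holoh : holo disk h dh.
Hypothesis posh : forall z, disk z -> 0 <= Re (h z).

(** Integrating [Re h] over [|z| = r] against the nonnegative kernel [2 + 2 Re (conj c * e)], with
    [e = z / r], extracts the first Taylor coefficient in the direction [c]. The conjugate part of
    the kernel is replaced by a holomorphic expression, so that the mean value property applies. *)
Lemma caratheodory_radius (c : C) (r : R) : Cmod c = 1 -> 0 < r < 1 ->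
  0 <= 2 * Re (h 0%C) + r * Re (c * dh 0%C)%C.
Proof.
  intros Hc Hr. assert (PP := PI_RGT_0).
  assert (Hr0 : RtoC r <> 0%C) by (intros E; apply RtoC_inj in E; lra).
  (* On [|z| = r] the three terms equal [2 h], [conj c * e * h] and [c * conj e * (h - h 0)]. Adding
     [c * h 0 * conj e] restores [h] times the kernel. *)
  set (H := fun z => (2 * h z + (Cconj c / r) * (z * h z) + (r * c) * slope h 0%C (dh 0%C) z)%C).
  set (dH := fun z => (2 * dh z + (Cconj c / r) * (1 * h z + z * dh z)
     + (r * c) * ((dh z * z - (h z - h 0) * 1) / (z * z)))%C).
  assert (HH : forall z, disk z -> z <> 0%C -> cderiv H z (dH z) /\ ccont dH z).
  { intros z Hz Hz0. destruct (holoh z Hz) as [D1 D2].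
    assert (D3 := cderiv_ccont _ _ _ D1). split.
    - repeat apply cderiv_plus.
      + now apply cderiv_scal.
      + apply cderiv_scal. apply (cderiv_mult (fun z => z)); auto. apply cderiv_id.
      + apply cderiv_scal.
        apply (cderiv_ext_loc (fun z => (h z - h 0) / z)%C _ _ z _ open_neq_0 Hz0).
        * intros y Hy. rewrite slope_off by auto. now replace (y - 0)%C with y by ring.
        * eapply cderiv_eq.
          -- apply (cderiv_div (fun z => h z - h 0)%C (fun z => z)); auto.
             ++ apply cderiv_minus; [eassumption| apply cderiv_const].
             ++ apply cderiv_id.
          -- simpl. field. auto.
    - unfold dH. ccont_tac; now apply Cmult_neq_0. }
  assert (H0 : ccont H 0%C).
  { assert (D1 := proj1 (holoh 0%C disk_0)). assert (D3 := cderiv_ccont _ _ _ D1).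
    unfold H. ccont_tac; now apply slope_ccont. }
  assert (MV := mean_value H dH HH H0 r Hr).
  set (k := (c * h 0)%C).
  (* The restoring term [Re (k * conj e)] has mean zero. *)
  assert (I0 : is_RInt (fun t => Re k * cos t + Im k * sin t) 0 (2 * PI) 0).
  { generalize (Re k) (Im k); intros a b. evar_last.
    - apply (is_RInt_derive (V := R_CompleteNormedModule) (fun t => a * sin t - b * cos t)).
      + intros t _. auto_derive; auto. ring.
      + intros t _. apply (ex_derive_continuous (V := R_NormedModule)). auto_derive; auto.
    - unfold minus, plus, opp; simpl. rewrite cos_2PI, sin_2PI, cos_0, sin_0. ring. }
  assert (I1 := RInt_correct (V := R_CompleteNormedModule) _ _ _ (circle_ex_RInt H dH HH r Hr)).
  rewrite MV in I1.
  assert (I2 := is_RInt_plus (V := R_NormedModule) _ _ _ _ _ _ I1 I0).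
  assert (P : 0 <= 2 * PI * Re (H 0%C) + 0).
  { refine (is_RInt_ge_0 _ 0 (2 * PI) _ _ I2 _); [lra|].
    intros t _.
    change (0 <= Re (H (circle_pt r t)) + (Re k * cos t + Im k * sin t)).
    set (e := (cos t, sin t) : C).
    assert (Ez : circle_pt r t = (r * e)%C).
    { unfold circle_pt, e, RtoC, Cmult; simpl; f_equal; ring. }
    assert (Hec : (e * Cconj e = 1)%C).
    { unfold e, Cconj, Cmult, RtoC; simpl. assert (S := sin2_cos2 t). unfold Rsqr in S.
      f_equal; lra. }
    assert (He0 : e <> 0%C).
    { intros E. rewrite E in Hec. revert Hec. unfold Cconj, Cmult, RtoC; simpl.
      intros E2; injection E2; lra. }
    assert (Hee : Cconj e = (/ e)%C).
    { replace (Cconj e) with ((e * Cconj e) / e)%C by (field; auto). rewrite Hec. field; auto. }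
    replace (Re k * cos t + Im k * sin t) with (Re (k * Cconj e)%C)
      by (unfold e, Cconj, Cmult, Re, Im; simpl; ring).
    change (0 <= Re (H (circle_pt r t) + k * Cconj e)%C).
    assert (Hz0 := circle_pt_neq_0 r t (proj1 Hr)).
    assert (Hzd : disk (circle_pt r t)) by (apply circle_pt_disk; lra).
    assert (Hh := posh _ Hzd).
    assert (E : (H (circle_pt r t) + k * Cconj e)%C
        = (h (circle_pt r t) * (2 + Cconj c * e + c * Cconj e))%C).
    { unfold H, k. rewrite slope_off by auto. rewrite Hee, Ez. field; auto. }
    rewrite E.
    replace (2 + Cconj c * e + c * Cconj e)%C with (RtoC (2 + 2 * Re (Cconj c * e)%C)).
    - replace (Re (h (circle_pt r t) * RtoC (2 + 2 * Re (Cconj c * e)))%C)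
        with (Re (h (circle_pt r t)) * (2 + 2 * Re (Cconj c * e)%C))
        by (unfold Re, RtoC, Cmult; simpl; ring).
      apply Rmult_le_pos; auto.
      assert (B := re_le_Cmod (Cconj c * e)%C). rewrite Cmod_mult, Cmod_conj, Hc in B.
      assert (Me : Cmod e = 1).
      { assert (M := Cmod_circle_pt r t (Rlt_le _ _ (proj1 Hr))).
        rewrite Ez, Cmod_mult, Cmod_R, Rabs_pos_eq in M by lra.
        apply Rmult_eq_reg_l with r; lra. }
      rewrite Me in B. apply Rabs_le_between in B. lra.
    - unfold Re, RtoC, Cmult, Cconj, Cplus; simpl; f_equal; ring. }
  assert (E0 : Re (H 0%C) = 2 * Re (h 0%C) + r * Re (c * dh 0%C)%C).
  { replace (H 0%C) with (2 * h 0 + r * (c * dh 0))%C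
      by (unfold H; rewrite slope_at; field; auto).
    unfold Re, RtoC, Cmult, Cplus; simpl; ring. }
  rewrite E0, Rplus_0_r in P.
  apply Rmult_le_reg_l with (2 * PI); lra.
Qed.

(** The unimodular [c] is chosen with [c * dh 0 = - |dh 0|]. A fixed radius close enough to 1
    replaces the limit [r -> 1]. *)
Lemma caratheodory : Cmod (dh 0%C) <= 2 * Re (h 0%C).
Proof.
  destruct (Ceq_dec (dh 0%C) 0%C) as [E|E].
  { rewrite E, Cmod_0. assert (P := posh 0%C disk_0). lra. }
  assert (P := Cmod_neq_0 _ E). set (m := Cmod (dh 0%C)) in *.
  assert (Hm0 : RtoC m <> 0%C) by (intros E2; apply RtoC_inj in E2; lra).
  set (c := (- Cconj (dh 0) / m)%C).
  assert (Hc : Cmod c = 1).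
  { unfold c. rewrite Cmod_div, Cmod_opp, Cmod_conj, Cmod_R, Rabs_pos_eq by (auto; lra).
    fold m. field; lra. }
  assert (Hre : Re (c * dh 0%C)%C = - m).
  { replace (c * dh 0%C)%C with (- (dh 0 * Cconj (dh 0)) / m)%C by (unfold c; field; auto).
    rewrite <- Cmod2_conj. fold m. simpl.
    unfold Cdiv, Cinv, Copp, Re, RtoC, Cmult; simpl; field; lra. }
  apply Rnot_lt_le. intros L.
  assert (Ph := posh 0%C disk_0).
  (* The midpoint of [2 Re (h 0) / m] and 1: it is below 1, and [r * m] still exceeds
     [2 Re (h 0)]. *)
  set (r := (1 + 2 * Re (h 0%C) / m) / 2).
  assert (Hq : 0 <= 2 * Re (h 0%C) / m < 1).
  { split; [apply Rdiv_le_0_compat; lra| apply Rlt_div_l; lra]. }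
  assert (K := caratheodory_radius c r Hc).
  rewrite Hre in K. assert (K' : 0 < r < 1) by (unfold r; lra). specialize (K K').
  assert (E2 : r * m = (m + 2 * Re (h 0%C)) / 2) by (unfold r; field; lra).
  lra.
Qed.

End SchwarzPick.

Definition hplane (w : C) : Prop := 0 < Re w.

Lemma open_hplane : copen hplane.
Proof.
  intros z Hz. exists (Re z). split; [exact Hz|]. intros y Hy.
  assert (B := re_le_Cmod (y - z)%C). rewrite Re_minus in B.
  apply Rabs_le_between in B. unfold hplane. lra.
Qed.

Lemma hplane_neq_0 (w : C) : 0 < Re w -> w <> 0%C.
Proof. intros H ->. simpl in H; lra. Qed.

Lemma disk_one_minus (z : C) : disk z -> (1 - z)%C <> 0%C.
Proof.
  intros Hz E. apply Cminus_eq_0 in E. subst z. unfold disk in Hz.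
  rewrite Cmod_1 in Hz; lra.
Qed.

Lemma disk_sqr (z : C) : disk z <-> Re z * Re z + Im z * Im z < 1.
Proof.
  unfold disk. assert (E := Cmod2_alt z). assert (P := Cmod_ge_0 z).
  simpl in E. rewrite !Rmult_1_r in E. rewrite <- E. split; nra.
Qed.

Lemma cayley_re (z : C) : disk z -> 0 < Re ((1 + z) / (1 - z))%C.
Proof.
  intros Hz. assert (Hn := disk_one_minus z Hz). apply disk_sqr in Hz.
  assert (Hd : 0 < (1 - Re z) * (1 - Re z) + Im z * Im z).
  { assert (P := Cmod_neq_0 _ Hn). assert (E := Cmod2_alt (1 - z)%C).
    destruct z as [x y]; simpl in *. nra. }
  destruct z as [x y]; simpl in *.
  match goal with |- 0 < ?e =>
    replace e with ((1 - (x*x+y*y)) / ((1 - x) * (1 - x) + y * y)) by (field; nra) end.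
  apply Rdiv_lt_0_compat; lra.
Qed.

(** The map [z -> Re w * (1 + z) / (1 - z) + i Im w] takes the disk into the half plane and 0 to
    [w], with derivative [2 Re w] at 0; composing [q] with it reduces the claim to
    [caratheodory]. *)
Lemma schwarz_pick (q dq : C -> C) (w : C) :
  holo hplane q dq -> (forall w, hplane w -> 0 <= Re (q w)) -> hplane w ->
  Cmod (dq w) * Re w <= Re (q w).
Proof.
  intros Hq Hp Hw. set (x := Re w) in *. set (iy := (Ci * Im w)%C).
  set (g := fun z => (x * ((1 + z) / (1 - z)) + iy)%C).
  set (dg := fun z => (x * (2 / ((1 - z) * (1 - z))))%C).
  assert (Hg : forall z, disk z -> hplane (g z)).
  { intros z Hz. unfold hplane, g.
    replace (Re (x * ((1 + z) / (1 - z)) + iy)%C) with (x * Re ((1 + z) / (1 - z))%C).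
    - apply Rmult_lt_0_compat; auto. now apply cayley_re.
    - unfold iy, Ci, Cplus, Cmult, RtoC, Re; simpl; ring. }
  assert (G0 : g 0%C = w).
  { unfold g, iy, x. rewrite (surjective_pairing w) at 3.
    unfold Ci, Cdiv, Cinv, Cplus, Cminus, Copp, Cmult, RtoC, Re, Im; simpl; f_equal; field. }
  assert (DG0 : dg 0%C = (2 * x)%C).
  { unfold dg. field. }
  assert (Dg : forall z, disk z -> cderiv g z (dg z) /\ ccont dg z).
  { intros z Hz. assert (Hn := disk_one_minus z Hz). split.
    - eapply cderiv_eq.
      + apply cderiv_plus; [|apply cderiv_const]. apply cderiv_scal. apply cderiv_div; auto.
        * apply cderiv_plus; [apply cderiv_const| apply cderiv_id].
        * apply cderiv_minus; [apply cderiv_const| apply cderiv_id].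
      + simpl. unfold dg. field. auto.
    - unfold dg. ccont_tac; now apply Cmult_neq_0. }
  assert (K := caratheodory (fun z => q (g z)) (fun z => (dq (g z) * dg z)%C)).
  cbv beta in K. rewrite G0, DG0 in K. rewrite !Cmod_mult, !Cmod_R, !Rabs_pos_eq in K by (unfold hplane in Hw; fold x in Hw; lra).
  enough (Cmod (dq w) * (2 * x) <= 2 * Re (q w)) by lra.
  apply K.
  - intros z Hz. destruct (Hq _ (Hg z Hz)) as [D1 D2]. destruct (Dg z Hz) as [D3 D4]. split.
    + now apply cderiv_comp.
    + apply ccont_mult; auto. apply ccont_comp; auto. eapply cderiv_ccont; eauto.
  - intros z Hz. apply Hp, Hg, Hz.
Qed.

(** * Growth in a cone of functions with nonnegative real part *)

(** Plays the part of Gronwall's inequality: it is applied to a function times its integrating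
    factor, or to a function minus its expected bound. *)
Lemma derive_nonpos_le (f df : R -> R) (a b : R) : a <= b ->
  (forall t, a <= t <= b -> is_derive f t (df t)) ->
  (forall t, a <= t <= b -> df t <= 0) -> f b <= f a.
Proof.
  intros Hab Hd Hn.
  destruct (MVT_gen f a b df) as [c [Hc E]].
  - intros t Ht. rewrite Rmin_left, Rmax_right in Ht by auto. apply Hd; lra.
  - intros t Ht. rewrite Rmin_left, Rmax_right in Ht by auto.
    apply continuity_pt_filterlim, (ex_derive_continuous (V := R_NormedModule)).
    eexists; apply Hd; auto.
  - rewrite Rmin_left, Rmax_right in Hc by auto. assert (N := Hn c Hc). nra.
Qed.

(** Reduces bounds on moduli to real parts of rotations, to which the real mean value theorem
    applies. *)
Lemma Cmod_le_of_dir (v : C) (B : R) :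
  (forall c, Cmod c = 1 -> Re (c * v)%C <= B) -> Cmod v <= B.
Proof.
  intros H. destruct (Ceq_dec v 0%C) as [->|Hv].
  { rewrite Cmod_0. specialize (H 1%C Cmod_1). revert H.
    unfold Re, Cmult, RtoC; simpl; lra. }
  assert (P := Cmod_neq_0 _ Hv).
  assert (Hm : RtoC (Cmod v) <> 0%C) by (intros E; apply RtoC_inj in E; lra).
  specialize (H (Cconj v / Cmod v)%C).
  replace (Cconj v / Cmod v * v)%C with (v * Cconj v / Cmod v)%C in H by (field; auto).
  rewrite <- Cmod2_conj in H.
  replace (RtoC (Cmod v ^ 2) / Cmod v)%C with (RtoC (Cmod v)) in H.
  - apply H. rewrite Cmod_div, Cmod_conj, Cmod_R, Rabs_pos_eq by (auto; lra). field; lra.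
  - simpl. rewrite !RtoC_mult. field. auto.
Qed.

Lemma Re_mult_le (c v : C) : Cmod c = 1 -> Re (c * v)%C <= Cmod v.
Proof.
  intros H. assert (B := re_le_Cmod (c * v)%C). rewrite Cmod_mult, H in B.
  apply Rabs_le_between in B. lra.
Qed.

Lemma exp_le (x y : R) : x <= y -> exp x <= exp y.
Proof. intros [H|H]; [left; now apply exp_increasing| right; now rewrite H]. Qed.

Lemma Cmod_imag_unit (sg : R) : sg * sg = 1 -> Cmod (0, sg) = 1.
Proof.
  intros H. unfold Cmod; simpl.
  replace (0 * (0 * 1) + sg * (sg * 1)) with 1 by lra. apply sqrt_1.
Qed.

Section ConeGrowth.

Variables (q dq : C -> C).
Hypothesis holoq : holo hplane q dq.
Hypothesis posq : forall w, hplane w -> 0 <= Re (q w).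

Let sp (w : C) (Hw : hplane w) : Cmod (dq w) * Re w <= Re (q w) :=
  schwarz_pick q dq w holoq posq Hw.

Lemma sp_div (w : C) : hplane w -> Cmod (dq w) <= Re (q w) / Re w.
Proof. intros Hw. apply Rle_div_r; auto. Qed.

Lemma real_axis_derive (c : C) (s : R) : 0 < s ->
  is_derive (fun s => Re (c * q (s, 0))%C) s (Re (c * dq (s, 0))%C).
Proof.
  intros Hs. destruct (holoq (s, 0) Hs) as [D _].
  assert (D' := cderiv_scal c _ _ _ D).
  destruct (is_derive_curve (fun w => c * q w)%C (fun s => s) (fun _ => 0) s _ 1 0 D') as [K _].
  - auto_derive; auto.
  - auto_derive; auto.
  - replace (c * dq (s, 0))%C with (c * dq (s, 0%R) * (1, 0))%C; auto.
    change (1, 0) with (RtoC 1). ring.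
Qed.

Lemma vertical_derive (c : C) (x sg s : R) : 0 < x ->
  is_derive (fun s => Re (c * q (x, (sg * s)%R))%C) s (Re (c * (dq (x, (sg * s)%R) * (0, sg)))%C).
Proof.
  intros Hx. destruct (holoq (x, (sg * s)%R) Hx) as [D _].
  assert (D' := cderiv_scal c _ _ _ D).
  destruct (is_derive_curve (fun w => c * q w)%C (fun _ => x) (fun s => sg * s) s _ 0 sg D') as [K _].
  - auto_derive; auto.
  - auto_derive; auto; ring.
  - replace (c * (dq (x, (sg * s)%R) * (0, sg)))%C with (c * dq (x, (sg * s)%R) * (0, sg))%C; auto.
    ring.
Qed.

Lemma Re_1_mult (z : C) : Re (1 * z)%C = Re z.
Proof. now rewrite Cmult_1_l. Qed.

(** On the positive axis Schwarz-Pick bounds the logarithmic derivative of [Re q] by [1 / s], so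
    [Re q(s) / s] does not increase. *)
Lemma axis_re_right (x : R) : 1 <= x -> Re (q (x, 0)) <= Re (q 1%C) * x.
Proof.
  intros Hx.
  assert (K : Re (q (x, 0)) * / x <= Re (q (1, 0)) * / 1).
  { apply (derive_nonpos_le (fun s => Re (q (s, 0)) * / s)
      (fun s => Re (dq (s, 0)) * / s + Re (q (s, 0)) * (- / (s * s))) 1 x Hx).
    - intros t Ht. apply (is_derive_mult (K := R_AbsRing) (fun s => Re (q (s, 0))) Rinv).
      + apply (is_derive_ext (fun s => Re (1 * q (s, 0))%C)).
        * intros s; now rewrite Cmult_1_l.
        * rewrite <- (Re_1_mult (dq (t, 0))). apply real_axis_derive; lra.
      + auto_derive; [lra|]. field; lra.
      + intros; apply Rmult_comm.
    - intros t Ht. assert (Hh : hplane (t, 0)) by (unfold hplane, Re; simpl; lra).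
      assert (S := sp _ Hh). simpl in S. assert (B := re_le_Cmod (dq (t, 0))).
      apply Rabs_le_between in B.
      replace (Re (dq (t, 0)) * / t + Re (q (t, 0)) * - / (t * t))
        with ((Re (dq (t, 0)) * t - Re (q (t, 0))) / (t * t)) by (field; lra).
      apply Rle_div_l; [nra|]. rewrite Rmult_0_l. nra. }
  change (1, 0) with (RtoC 1) in K. rewrite Rinv_1, Rmult_1_r in K.
  apply Rle_div_l; [lra|]. exact K.
Qed.

(** The lower side of the same bound: [s * Re q(s)] does not decrease. *)
Lemma axis_re_left (x : R) : 0 < x <= 1 -> x * Re (q (x, 0)) <= Re (q 1%C).
Proof.
  intros Hx.
  assert (K : - (1 * Re (q (1, 0))) <= - (x * Re (q (x, 0)))).
  { apply (derive_nonpos_le (fun s => - (s * Re (q (s, 0))))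
      (fun s => - (1 * Re (q (s, 0)) + s * Re (dq (s, 0)))) x 1); [lra| |].
    - intros t Ht. apply (is_derive_opp (V := R_NormedModule) (fun s => s * Re (q (s, 0)))).
      apply (is_derive_mult (K := R_AbsRing) (fun s => s) (fun s => Re (q (s, 0)))).
      + apply (is_derive_id (K := R_AbsRing)).
      + apply (is_derive_ext (fun s => Re (1 * q (s, 0))%C)).
        * intros s; now rewrite Cmult_1_l.
        * rewrite <- (Re_1_mult (dq (t, 0))). apply real_axis_derive; lra.
      + intros; apply Rmult_comm.
    - intros t Ht. assert (Hh : hplane (t, 0)) by (unfold hplane, Re; simpl; lra).
      assert (S := sp _ Hh). simpl in S. assert (B := re_le_Cmod (dq (t, 0))).
      apply Rabs_le_between in B. nra. }
  change (1, 0) with (RtoC 1) in K. lra.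
Qed.

(** Schwarz-Pick and the two preceding bounds give [|dq(s)| <= Re q(1)] to the right of 1 and
    [|dq(s)| <= Re q(1) / s^2] to the left; both are integrated from 1. The factor [k^2 * x]
    majorizes [x] in the first case and, as [k * x >= 1], also [1 / x] in the second. *)
Lemma axis_growth (x k : R) : 1 <= k -> 0 < x -> 1 <= k * x ->
  Cmod (q (x, 0)) <= Cmod (q 1%C) * (k ^ 2 * x).
Proof.
  intros Hk Hx Hkx.
  assert (P1 := re_le_Cmod (q 1%C)). apply Rabs_le_between in P1.
  assert (P0 := Cmod_ge_0 (q 1%C)).
  destruct (Rle_dec 1 x) as [Hx1|Hx1].
  - apply Rle_trans with (Cmod (q 1%C) * x).
    2:{ apply Rmult_le_compat_l; auto. nra. }
    apply Cmod_le_of_dir. intros c Hc.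
    assert (K : Re (c * q (x, 0%R))%C - Re (q 1%C) * x <= Re (c * q (1%R, 0%R))%C - Re (q 1%C) * 1).
    { apply (derive_nonpos_le (fun s => Re (c * q (s, 0%R))%C - Re (q 1%C) * s)
        (fun s => Re (c * dq (s, 0%R))%C - Re (q 1%C)) 1 x Hx1).
      - intros t Ht. apply (is_derive_minus (V := R_NormedModule)).
        + apply real_axis_derive; lra.
        + generalize (Re (q 1%C)); intros a; auto_derive; auto; ring.
      - intros t Ht. assert (Hh : hplane (t, 0)) by (unfold hplane, Re; simpl; lra).
        assert (S := sp _ Hh). simpl in S.
        assert (B := Re_mult_le c (dq (t, 0)) Hc).
        assert (A := axis_re_right t (proj1 Ht)).
        assert (Cmod (dq (t, 0)) <= Re (q 1%C)); [|lra].
        apply Rmult_le_reg_r with t; lra. }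
    change (1, 0) with (RtoC 1) in K.
    assert (B := Re_mult_le c (q 1%C) Hc). nra.
  - assert (Hx2 : 0 < x <= 1) by lra.
    apply Rle_trans with (Cmod (q 1%C) * / x).
    2:{ apply Rmult_le_compat_l; auto. apply Rmult_le_reg_r with x; auto.
        rewrite Rinv_l by lra. nra. }
    apply Cmod_le_of_dir. intros c Hc.
    assert (K : - (Re (c * q (1%R, 0%R))%C - Re (q 1%C) * / 1) <= - (Re (c * q (x, 0%R))%C - Re (q 1%C) * / x)).
    { apply (derive_nonpos_le (fun s => - (Re (c * q (s, 0%R))%C - Re (q 1%C) * / s))
        (fun s => - (Re (c * dq (s, 0%R))%C - Re (q 1%C) * (- / (s * s)))) x 1); [lra| |].
      - intros t Ht. apply (is_derive_opp (V := R_NormedModule) (fun s => Re (c * q (s, 0%R))%C - Re (q 1%C) * / s)).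
        apply (is_derive_minus (V := R_NormedModule)).
        + apply real_axis_derive; lra.
        + generalize (Re (q 1%C)); intros a; auto_derive; [lra|]. field; lra.
      - intros t Ht. assert (Hh : hplane (t, 0)) by (unfold hplane, Re; simpl; lra).
        assert (S := sp _ Hh). simpl in S.
        assert (B := Re_mult_le (- c)%C (dq (t, 0)) ltac:(rewrite Cmod_opp; exact Hc)).
        replace (Re (- c * dq (t, 0))%C) with (- Re (c * dq (t, 0%R))%C) in B
          by (unfold Re, Cmult, Copp; simpl; ring).
        assert (A := axis_re_left t ltac:(lra)).
        assert (Cmod (dq (t, 0)) <= Re (q 1%C) * / (t * t)); [|lra].
        apply Rmult_le_reg_r with (t * t); [nra|].
        rewrite Rmult_assoc, Rinv_l by nra. nra. }
    change (1, 0) with (RtoC 1) in K. rewrite Rinv_1 in K.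
    assert (B := Re_mult_le c (q 1%C) Hc).
    assert (1 <= / x) by (rewrite <- Rinv_1; apply Rinv_le_contravar; lra).
    nra.
Qed.

(** [Re w = x] is constant on a vertical line, so Schwarz-Pick becomes a linear differential
    inequality with rate [1 / x]. The sign [sg] selects the upward or the downward direction. *)
Lemma vertical_re (x sg s : R) : 0 < x -> sg * sg = 1 -> 0 <= s ->
  Re (q (x, (sg * s)%R)) <= Re (q (x, 0)) * exp (s / x).
Proof.
  intros Hx Hsg Hs.
  assert (K : Re (q (x, (sg * s)%R)) * exp (- s / x) <= Re (q (x, sg * 0)) * exp (- 0 / x)).
  { apply (derive_nonpos_le (fun s => Re (q (x, (sg * s)%R)) * exp (- s / x))
      (fun s => Re (dq (x, (sg * s)%R) * (0%R, sg))%C * exp (- s / x)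
         + Re (q (x, (sg * s)%R)) * (- / x * exp (- s / x))) 0 s Hs).
    - intros t Ht. apply (is_derive_mult (K := R_AbsRing) (fun s => Re (q (x, (sg * s)%R))) (fun s => exp (- s / x))).
      + apply (is_derive_ext (fun s => Re (1 * q (x, (sg * s)%R))%C)).
        * intros u; now rewrite Cmult_1_l.
        * rewrite <- (Re_1_mult (dq (x, (sg * t)%R) * (0%R, sg))%C). now apply vertical_derive.
      + auto_derive; auto. unfold Rdiv; ring.
      + intros; apply Rmult_comm.
    - intros t Ht. assert (Hh : hplane (x, (sg * t)%R)) by (unfold hplane, Re; simpl; lra).
      assert (S := sp_div _ Hh). simpl in S.
      assert (B := re_le_Cmod (dq (x, (sg * t)%R) * (0%R, sg))%C). rewrite Cmod_mult in B.
      replace (Cmod (0%R, sg)) with 1 in B.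
      + apply Rabs_le_between in B. assert (E := exp_pos (- t / x)). unfold Rdiv in S. nra.
      + now rewrite Cmod_imag_unit. }
  rewrite Rmult_0_r in K. replace (- 0 / x) with 0 in K by (field; lra).
  rewrite exp_0, Rmult_1_r in K.
  replace (- s / x) with (- (s / x)) in K by (field; lra). rewrite exp_Ropp in K.
  assert (E := exp_pos (s / x)).
  apply Rle_div_l; auto.
Qed.

Lemma vertical_growth (x sg s : R) : 0 < x -> sg * sg = 1 -> 0 <= s ->
  Cmod (q (x, (sg * s)%R)) <= Cmod (q (x, 0)) * exp (s / x).
Proof.
  intros Hx Hsg Hs.
  assert (Hx0 : hplane (x, 0)) by (unfold hplane, Re; simpl; lra).
  assert (P1 := re_le_Cmod (q (x, 0))). apply Rabs_le_between in P1.
  apply Cmod_le_of_dir. intros c Hc.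
  assert (K : Re (c * q (x, (sg * s)%R))%C - Re (q (x, 0)) * exp (s / x)
     <= Re (c * q (x, (sg * 0)%R))%C - Re (q (x, 0)) * exp (0 / x)).
  { apply (derive_nonpos_le (fun s => Re (c * q (x, (sg * s)%R))%C - Re (q (x, 0)) * exp (s / x))
      (fun s => Re (c * (dq (x, (sg * s)%R) * (0%R, sg)))%C - Re (q (x, 0)) * (/ x * exp (s / x))) 0 s Hs).
    - intros t Ht. apply (is_derive_minus (V := R_NormedModule)).
      + now apply vertical_derive.
      + generalize (Re (q (x, 0))); intros a; auto_derive; auto. unfold Rdiv; ring.
    - intros t Ht. assert (Hh : hplane (x, (sg * t)%R)) by (unfold hplane, Re; simpl; lra).
      assert (S := sp_div _ Hh). simpl in S.
      assert (B := Re_mult_le c (dq (x, (sg * t)%R) * (0%R, sg))%C Hc). rewrite Cmod_mult in B.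
      replace (Cmod (0%R, sg)) with 1 in B.
      + assert (V := vertical_re x sg t Hx Hsg (proj1 Ht)).
        unfold Rdiv in S. assert (0 < / x) by now apply Rinv_0_lt_compat. nra.
      + now rewrite Cmod_imag_unit. }
  rewrite Rmult_0_r in K. replace (0 / x) with 0 in K by (field; lra).
  rewrite exp_0, Rmult_1_r in K.
  assert (B := Re_mult_le c (q (x, 0)) Hc).
  assert (1 <= exp (s / x)).
  { rewrite <- exp_0. apply exp_le. apply Rdiv_le_0_compat; lra. }
  nra.
Qed.

(** The shift by 1 makes the cone avoid the finite boundary as well: it forces [k * Re w >= 1]. The
    complement in the disk therefore shrinks to the unit circle as [k] grows. *)
Definition cone (k : R) (w : C) : Prop := 0 < Re w /\ Cmod (w + 1)%C <= k * Re w.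

Definition cone_bound (k : R) : R := k ^ 2 * exp k.

(** The path from 1 to [w] runs along the axis to [Re w], which costs [k^2], and then vertically by
    at most [k * Re w], which costs [exp k]. Schwarz-Pick turns the bound on [q] into the bound on
    [dq]. *)
Lemma cone_growth (k : R) (w : C) : 1 <= k -> cone k w ->
  Cmod (q w) <= cone_bound k * Cmod (q 1%C) * Re w /\
  Cmod (dq w) <= cone_bound k * Cmod (q 1%C).
Proof.
  intros Hk [Hx Hw].
  assert (M : Cmod (q w) <= cone_bound k * Cmod (q 1%C) * Re w).
  { destruct w as [x y]. simpl in Hx, Hw. simpl Re.
    assert (B1 := re_le_Cmod ((x, y) + 1)%C). assert (B2 := im_le_Cmod ((x, y) + 1)%C).
    simpl in B1, B2. rewrite Rplus_0_r in B2. apply Rabs_le_between in B1.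
    assert (Hkx : 1 <= k * x) by lra.
    assert (Hs : exists sg, sg * sg = 1 /\ y = sg * Rabs y).
    { destruct (Rle_dec 0 y); [exists 1|exists (-1)]; split; try ring.
      - rewrite Rabs_pos_eq; lra.
      - rewrite Rabs_left; lra. }
    destruct Hs as [sg [Hsg Ey]].
    assert (V := vertical_growth x sg (Rabs y) Hx Hsg (Rabs_pos y)). rewrite <- Ey in V.
    assert (A := axis_growth x k Hk Hx Hkx).
    assert (E : exp (Rabs y / x) <= exp k).
    { apply exp_le. apply Rle_div_l; lra. }
    eapply Rle_trans; [exact V|].
    apply Rle_trans with (Cmod (q 1%C) * (k ^ 2 * x) * exp k).
    - apply Rmult_le_compat; auto; [apply Cmod_ge_0| left; apply exp_pos].
    - right; unfold cone_bound; ring. }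
  split; auto.
  apply Rmult_le_reg_r with (Re w); auto.
  eapply Rle_trans; [apply sp; exact Hx|].
  eapply Rle_trans; [|exact M].
  eapply Rle_trans; [apply Rle_abs| apply re_le_Cmod].
Qed.

End ConeGrowth.

(** * The semigroup in the half plane *)

Lemma segment_derive (f : C -> C) (c w h l : C) (s : R) :
  cderiv f (w + s * h)%C l ->
  is_derive (fun s => Re (c * f (w + RtoC s * h))%C) s (Re (c * (l * h))%C).
Proof.
  intros D.
  assert (E : forall s : R, (w + s * h)%C = (Re w + s * Re h, Im w + s * Im h) :> C).
  { intros u. destruct w, h; unfold Cplus, Cmult, RtoC, Re, Im; simpl; f_equal; ring. }
  rewrite E in D. assert (D' := cderiv_scal c _ _ _ D).
  destruct (is_derive_curve (fun w => c * f w)%C (fun s => Re w + s * Re h)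
    (fun s => Im w + s * Im h) s _ (Re h) (Im h) D') as [K _].
  - generalize (Re w) (Re h); intros a a'; auto_derive; auto; ring.
  - generalize (Im w) (Im h); intros a a'; auto_derive; auto; ring.
  - apply (is_derive_ext (fun s => Re (c * f (Re w + s * Re h, Im w + s * Im h)%R)%C)).
    + intros u. now rewrite <- E.
    + replace (c * (l * h))%C with (c * l * (Re h, Im h))%C; auto.
      rewrite <- (surjective_pairing h : h = (Re h, Im h)). ring.
Qed.

Lemma mean_value_ineq (f df : C -> C) (w h : C) (B : R) :
  (forall s, 0 <= s <= 1 -> cderiv f (w + s * h)%C (df (w + s * h)%C)) ->
  (forall s, 0 <= s <= 1 -> Cmod (df (w + s * h)%C) <= B) ->
  Cmod (f (w + h) - f w)%C <= B * Cmod h.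
Proof.
  intros D HB. apply Cmod_le_of_dir. intros c Hc.
  assert (K : Re (c * f (w + 1%R * h))%C - B * Cmod h * 1 <= Re (c * f (w + 0%R * h))%C - B * Cmod h * 0).
  { apply (derive_nonpos_le (fun s => Re (c * f (w + RtoC s * h))%C - B * Cmod h * s)
      (fun s => Re (c * (df (w + RtoC s * h)%C * h))%C - B * Cmod h)); [lra| |].
    - intros t Ht. apply (is_derive_minus (V := R_NormedModule)).
      + now apply segment_derive, D.
      + generalize (B * Cmod h); intros a; auto_derive; auto; ring.
    - intros t Ht. assert (M := Re_mult_le c (df (w + t * h)%C * h)%C Hc).
      rewrite Cmod_mult in M. assert (N := HB t Ht). assert (P := Cmod_ge_0 h). nra. }
  replace (w + 1%R * h)%C with (w + h)%C in K by ring.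
  replace (w + 0%R * h)%C with w in K by ring.
  replace (c * (f (w + h) - f w))%C with (c * f (w + h)%C - c * f w)%C by ring.
  rewrite Re_minus. lra.
Qed.

(** The generator yields only right derivatives along a trajectory, whence this one-sided criterion.
    The supremum [m] of the times up to which [u 0 - eps * r <= u r] persists is attained by
    continuity, and the right-hand condition would carry it past any [m < t]. *)
Lemma dini_nondecreasing (u : R -> R) (t : R) : continuity u -> 0 <= t ->
  (forall s eps, 0 <= s -> 0 < eps ->
     exists d, 0 < d /\ forall h, 0 < h < d -> u s - eps * h <= u (s + h)) ->
  u 0 <= u t.
Proof.
  intros Hc Ht HD. apply Rnot_lt_le. intros L.
  assert (Ht0 : 0 < t) by (destruct Ht as [Ht|<-]; auto; lra).
  (* The loss [eps * t] allowed over the whole interval is half of the supposed drop. *)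
  set (eps := (u 0 - u t) / (2 * t)).
  assert (Heps : 0 < eps) by (apply Rdiv_lt_0_compat; lra).
  assert (Et : eps * t = (u 0 - u t) / 2) by (unfold eps; field; lra).
  set (E := fun s => 0 <= s <= t /\ forall r, 0 <= r <= s -> u 0 - eps * r <= u r).
  assert (E0 : E 0).
  { split; [lra|]. intros r Hr. replace r with 0 by lra. lra. }
  destruct (completeness E) as [m [Hm1 Hm2]].
  { exists t. intros s [Hs _]. lra. }
  { exists 0; auto. }
  assert (Hm0 : 0 <= m) by now apply Hm1.
  assert (Hmt : m <= t) by (apply Hm2; intros s [Hs _]; lra).
  assert (Below : forall r, 0 <= r < m -> u 0 - eps * r <= u r).
  { intros r Hr. apply Rnot_lt_le. intros Lr.
    assert (m <= r); [|lra]. apply Hm2. intros s [Hs1 Hs2].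
    apply Rnot_lt_le. intros Ls. specialize (Hs2 r). lra. }
  assert (Em : u 0 - eps * m <= u m).
  { destruct Hm0 as [Hm0|<-]; [|lra].
    apply Rnot_lt_le. intros Lm.
    destruct (proj1 (continuity_pt_locally _ _) (Hc m)
      (mkposreal (u 0 - eps * m - u m) ltac:(lra))) as [d D].
    simpl in D. set (r := Rmax 0 (m - d / 2)).
    assert (Pd := cond_pos d).
    assert (Hr : 0 <= r < m) by (unfold r; split; [apply Rmax_l| apply Rmax_lub_lt; lra]).
    assert (Hr2 : m - d / 2 <= r) by apply Rmax_r.
    assert (B := Below r Hr).
    assert (Bd : ball m d r).
    { unfold ball; simpl; unfold AbsRing_ball, abs, minus, plus, opp; simpl.
      apply Rabs_def1; lra. }
    specialize (D r Bd). apply Rabs_def2 in D. nra. }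
  destruct (Rle_lt_or_eq_dec m t Hmt) as [Hlt|Heq].
  - destruct (HD m eps Hm0 Heps) as [d [Hd D]].
    set (h := Rmin (d / 2) (t - m)).
    assert (Hh : 0 < h) by (apply Rmin_glb_lt; lra).
    assert (Hh1 : h <= d / 2) by apply Rmin_l.
    assert (Hh2 : h <= t - m) by apply Rmin_r.
    assert (m + h <= m); [|lra]. apply Hm1. split; [lra|].
    intros r Hr. destruct (Rle_lt_dec r m) as [Hrm|Hrm].
    + destruct Hrm as [Hrm| ->]; auto. apply Below; lra.
    + specialize (D (r - m)). replace (m + (r - m)) with r in D by ring. nra.
  - subst m. lra.
Qed.

(** Gives convergence of the semigroup at single points; uniformity over cones is then supplied by
    Schwarz-Pick. *)
Lemma compact_singleton (z : C) : compact_subset (fun y => y = z).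
Proof.
  intros U HU HC. destruct (HC z eq_refl) as [V [HV Vz]].
  exists (V :: nil). split.
  - intros V' [<-|[]]; auto.
  - intros y ->. exists V; split; [now left| auto].
Qed.

Section HalfPlane.

Variable b : C.
Hypothesis Hb : Cmod b = 1.

Definition to_hplane (z : C) : C := ((b + z) / (b - z))%C.
Definition to_disk (w : C) : C := (b * (w - 1) / (w + 1))%C.

Lemma unit_neq_0 : b <> 0%C.
Proof. intros E. rewrite E, Cmod_0 in Hb. lra. Qed.

Lemma b_minus_neq_0 (z : C) : disk z -> (b - z)%C <> 0%C.
Proof. intros Hz E. apply Cminus_eq_0 in E. subst z. unfold disk in Hz; lra. Qed.

Lemma hplane_succ_neq_0 (w : C) : hplane w -> (w + 1)%C <> 0%C.
Proof. intros Hw. apply hplane_neq_0. unfold hplane in Hw. destruct w; simpl in *; lra. Qed.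

Lemma to_hplane_hplane (z : C) : disk z -> hplane (to_hplane z).
Proof.
  intros Hz. assert (H0 := unit_neq_0). assert (H1 := b_minus_neq_0 z Hz).
  assert (Hu : disk (z / b)%C).
  { unfold disk. rewrite Cmod_div, Hb by auto. unfold disk in Hz. lra. }
  replace (to_hplane z) with ((1 + z / b) / (1 - z / b))%C.
  - now apply cayley_re.
  - unfold to_hplane. field. auto.
Qed.

Lemma Cmod_sqr (z : C) : Cmod z * Cmod z = Re z * Re z + Im z * Im z.
Proof. assert (E := Cmod2_alt z). simpl in E. lra. Qed.

Lemma to_disk_disk (w : C) : hplane w -> disk (to_disk w).
Proof.
  intros Hw. assert (H1 := hplane_succ_neq_0 w Hw).
  unfold disk, to_disk. rewrite Cmod_div, Cmod_mult, Hb by auto.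
  assert (P := Cmod_neq_0 _ H1). apply Rlt_div_l; [auto|].
  assert (E1 := Cmod_sqr (w + 1)%C). assert (E2 := Cmod_sqr (w - 1)%C).
  assert (P2 := Cmod_ge_0 (w - 1)%C). unfold hplane in Hw.
  destruct w as [x y]; simpl in *. nra.
Qed.

Lemma to_disk_hplane (z : C) : disk z -> to_disk (to_hplane z) = z.
Proof.
  intros Hz. assert (H0 := unit_neq_0). assert (H1 := b_minus_neq_0 z Hz).
  unfold to_disk, to_hplane. field. split; auto.
  replace (b + z + (b - z))%C with (2 * b)%C by ring.
  apply Cmult_neq_0; auto. intros E; apply RtoC_inj in E; lra.
Qed.

Lemma Ctwo_neq_0 : (2 : C) <> 0%C.
Proof. intros E; apply RtoC_inj in E; lra. Qed.

Lemma to_hplane_disk (w : C) : hplane w -> to_hplane (to_disk w) = w.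
Proof.
  intros Hw. assert (H0 := unit_neq_0). assert (H1 := hplane_succ_neq_0 w Hw).
  unfold to_disk, to_hplane. field. split; auto.
  replace (b * (w + 1) - b * (w - 1))%C with (2 * b)%C by ring.
  apply Cmult_neq_0; auto. apply Ctwo_neq_0.
Qed.

Lemma to_hplane_succ (z : C) : disk z -> (to_hplane z + 1 = 2 * b / (b - z))%C.
Proof. intros Hz. assert (H1 := b_minus_neq_0 z Hz). unfold to_hplane. field; auto. Qed.

Definition d_to_hplane (z : C) : C := (2 * b / ((b - z) * (b - z)))%C.
Definition d_to_disk (w : C) : C := (2 * b / ((w + 1) * (w + 1)))%C.

Lemma to_hplane_holo : holo disk to_hplane d_to_hplane.
Proof.
  intros z Hz. assert (H1 := b_minus_neq_0 z Hz). split.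
  - eapply cderiv_eq.
    + apply cderiv_div; auto.
      * apply cderiv_plus; [apply cderiv_const| apply cderiv_id].
      * apply cderiv_minus; [apply cderiv_const| apply cderiv_id].
    + unfold d_to_hplane. field; auto.
  - unfold d_to_hplane. ccont_tac. now apply Cmult_neq_0.
Qed.

Lemma to_disk_holo : holo hplane to_disk d_to_disk.
Proof.
  intros z Hz. assert (H1 := hplane_succ_neq_0 z Hz). split.
  - eapply cderiv_eq.
    + apply cderiv_div; auto.
      * apply cderiv_scal. apply cderiv_minus; [apply cderiv_id| apply cderiv_const].
      * apply cderiv_plus; [apply cderiv_id| apply cderiv_const].
    + unfold d_to_disk. field; auto.
  - unfold d_to_disk. ccont_tac. now apply Cmult_neq_0.
Qed.

Variable phi : R -> C -> C.
Hypothesis sg : analytic_semigroup phi.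
(** Provides the continuous derivative that [holo] asks of [psi t]. It will follow from the fact
    that [T_t] maps the constant 1 to [phi_t']. *)
Hypothesis dphi_analytic : forall t, 0 <= t -> analytic (C_derive (phi t)).

Definition psi (t : R) (w : C) : C := to_hplane (phi t (to_disk w)).
Definition dpsi (t : R) (w : C) : C :=
  (d_to_hplane (phi t (to_disk w)) * (C_derive (phi t) (to_disk w) * d_to_disk w))%C.

Lemma psi_hplane (t : R) (w : C) : 0 <= t -> hplane w -> hplane (psi t w).
Proof.
  intros Ht Hw. apply to_hplane_hplane. apply semigroup_self_map; auto.
  now apply to_disk_disk.
Qed.

Lemma psi_holo (t : R) : 0 <= t -> holo hplane (psi t) (dpsi t).
Proof.
  intros Ht w Hw. assert (Hz := to_disk_disk w Hw).
  assert (Hpz := semigroup_self_map _ sg t _ Ht Hz).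
  destruct (to_disk_holo w Hw) as [D1 D2].
  destruct (to_hplane_holo _ Hpz) as [D3 D4].
  assert (D5 := analytic_cderiv _ _ (semigroup_analytic _ sg t Ht) Hz).
  assert (D6 := analytic_ccont _ _ (dphi_analytic t Ht) Hz).
  assert (D7 := cderiv_ccont _ _ _ D1).
  split.
  - unfold psi, dpsi.
    apply (cderiv_comp to_hplane (fun w => phi t (to_disk w))); auto.
    now apply (cderiv_comp (phi t) to_disk).
  - unfold dpsi. apply ccont_mult; [|apply ccont_mult]; auto.
    + apply (ccont_comp d_to_hplane (fun w => phi t (to_disk w))); auto.
      apply (ccont_comp (phi t) to_disk); auto. eapply cderiv_ccont; eauto.
    + now apply (ccont_comp (C_derive (phi t)) to_disk).
Qed.

Lemma psi_0 (w : C) : hplane w -> psi 0 w = w.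
Proof.
  intros Hw. unfold psi. rewrite (semigroup_id _ sg) by now apply to_disk_disk.
  now apply to_hplane_disk.
Qed.

Lemma psi_plus (t s : R) (w : C) : 0 <= t -> 0 <= s -> hplane w ->
  psi (t + s) w = psi t (psi s w).
Proof.
  intros Ht Hs Hw. assert (Hz := to_disk_disk w Hw). unfold psi.
  rewrite (semigroup_comp _ sg) by auto. rewrite to_disk_hplane; auto.
  now apply semigroup_self_map.
Qed.

Lemma phi_cv_0 (z : C) (eps : R) : disk z -> 0 < eps ->
  exists d, 0 < d /\ forall t, 0 <= t < d -> Cmod (phi t z - z)%C < eps.
Proof.
  intros Hz Heps.
  destruct (semigroup_cv _ sg _ (compact_singleton z)
    ltac:(intros y ->; exact Hz) (mkposreal eps Heps)) as [d Hd].
  exists d; split; [apply cond_pos|]. intros t [[Ht| <-] Htd].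
  - specialize (Hd t). rewrite <- (semigroup_id _ sg z Hz) at 2.
    apply (fun H1 => Hd H1 Ht z eq_refl).
    unfold ball; simpl; unfold AbsRing_ball, abs, minus, plus, opp; simpl.
    apply Rabs_def1; lra.
  - rewrite (semigroup_id _ sg z Hz). replace (z - z)%C with (RtoC 0) by ring.
    now rewrite Cmod_0.
Qed.

Lemma psi_cv_0 (w : C) (eps : R) : hplane w -> 0 < eps ->
  exists d, 0 < d /\ forall t, 0 <= t < d -> Cmod (psi t w - w)%C < eps.
Proof.
  intros Hw Heps. assert (Hz := to_disk_disk w Hw).
  destruct (to_hplane_holo _ Hz) as [D _]. apply cderiv_ccont in D.
  destruct (D eps Heps) as [d1 [Hd1 D1]].
  destruct (phi_cv_0 _ d1 Hz Hd1) as [d [Hd D2]].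
  exists d; split; auto. intros t Ht. unfold psi.
  rewrite <- (to_hplane_disk w Hw) at 2. auto.
Qed.

(* Schwarz-Pick along the segment from [w] to [w'] and Gronwall. *)
Lemma psi_lipschitz (t : R) (w w' : C) : 0 <= t -> hplane w ->
  Cmod (w' - w)%C <= Re w / 2 ->
  Cmod (psi t w' - psi t w)%C <= 2 * exp 1 / Re w * Cmod (w' - w)%C * Re (psi t w).
Proof.
  intros Ht Hw Hd. set (h := (w' - w)%C) in *.
  assert (Hx : 0 < Re w) by exact Hw.
  assert (Hs : forall s, 0 <= s <= 1 -> Re w / 2 <= Re (w + s * h)%C).
  { intros s Hs. replace (Re (w + s * h)%C) with (Re w + s * Re h)
      by (destruct w, h; simpl; ring).
    assert (B := re_le_Cmod h). apply Rabs_le_between in B. nra. }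
  assert (Hh : forall s, 0 <= s <= 1 -> hplane (w + s * h)%C).
  { intros s Hs'. unfold hplane. specialize (Hs s Hs'). lra. }
  assert (SP : forall s, 0 <= s <= 1 ->
    Cmod (dpsi t (w + s * h)%C) <= 2 / Re w * Re (psi t (w + s * h)%C)).
  { intros s Hs'.
    assert (S := schwarz_pick _ _ _ (psi_holo t Ht)
      (fun v Hv => Rlt_le _ _ (psi_hplane t v Ht Hv)) (Hh s Hs')).
    assert (N := Hs s Hs'). assert (P := Cmod_ge_0 (dpsi t (w + s * h)%C)).
    apply Rmult_le_reg_l with (Re w / 2); [lra|].
    replace (Re w / 2 * (2 / Re w * Re (psi t (w + s * h)%C))) with (Re (psi t (w + s * h)%C)) by (field; lra).
    nra. }
  (* The growth rate along the segment is at most [2 / Re w] times [|h| <= Re w / 2], that is 1;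
     hence the factor [exp 1]. *)
  assert (Gr : forall s, 0 <= s <= 1 -> Re (psi t (w + s * h)%C) <= exp 1 * Re (psi t w)).
  { intros s Hs'.
    assert (K : Re (1 * psi t (w + s * h)%C)%C * exp (- s) <= Re (1 * psi t (w + 0%R * h)%C)%C * exp (- 0)).
    { apply (derive_nonpos_le (fun s => Re (1 * psi t (w + RtoC s * h)%C)%C * exp (- s))
        (fun s => Re (1 * (dpsi t (w + RtoC s * h)%C * h))%C * exp (- s)
           + Re (1 * psi t (w + RtoC s * h)%C)%C * (- exp (- s)))); [lra| |].
      - intros r Hr.
        apply (is_derive_mult (K := R_AbsRing) (fun s => Re (1 * psi t (w + RtoC s * h)%C)%C) (fun s => exp (- s))).
        + apply segment_derive, psi_holo, Hh; auto; lra.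
        + auto_derive; auto. ring.
        + intros; apply Rmult_comm.
      - intros r Hr. rewrite !Re_1_mult.
        assert (S := SP r ltac:(lra)).
        assert (B := re_le_Cmod (dpsi t (w + r * h)%C * h)%C). rewrite Cmod_mult in B.
        apply Rabs_le_between in B.
        assert (Q := psi_hplane t _ Ht (Hh r ltac:(lra))). unfold hplane in Q.
        assert (E := exp_pos (- r)).
        assert (Cmod (dpsi t (w + r * h)) * Cmod h <= Re (psi t (w + r * h)%C)); [|nra].
        apply Rle_trans with (2 / Re w * Re (psi t (w + r * h)%C) * (Re w / 2)).
        + apply Rmult_le_compat; auto; apply Cmod_ge_0.
        + right; field; lra. }
    rewrite !Re_1_mult, Ropp_0, exp_0, Rmult_1_r, exp_Ropp in K.
    replace (w + 0%R * h)%C with w in K by ring.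
    assert (E := exp_pos s). apply Rle_div_l in K; auto.
    assert (E1 : exp s <= exp 1) by (apply exp_le; lra).
    assert (Q := psi_hplane t w Ht Hw). unfold hplane in Q. nra. }
  replace w' with (w + h)%C by (unfold h; ring).
  replace (2 * exp 1 / Re w * Cmod h * Re (psi t w))
    with (2 / Re w * (exp 1 * Re (psi t w)) * Cmod h) by (field; lra).
  apply (mean_value_ineq _ (dpsi t)).
  - intros s Hs'. now apply psi_holo, Hh.
  - intros s Hs'. eapply Rle_trans; [now apply SP|].
    apply Rmult_le_compat_l; auto. apply Rlt_le, Rdiv_lt_0_compat; lra.
Qed.

(** Since [psi (m + h) w = psi m (psi h w)], the small displacement at time 0 is transported by
    [psi m] through the Lipschitz estimate. So [d] is independent of [m]. *)
Lemma psi_increment (w : C) (eps : R) : hplane w -> 0 < eps ->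
  exists d, 0 < d /\ forall m h, 0 <= m -> 0 <= h < d ->
    Cmod (psi (m + h) w - psi m w)%C <= eps * Re (psi m w).
Proof.
  intros Hw Heps. assert (E := exp_pos 1). assert (Hx : 0 < Re w) by exact Hw.
  destruct (psi_cv_0 w (Rmin (Re w / 2) (eps * Re w / (2 * exp 1))) Hw) as [d [Hd D]].
  { apply Rmin_glb_lt; [lra|]. apply Rdiv_lt_0_compat; nra. }
  exists d; split; auto. intros m h Hm Hh. specialize (D h Hh).
  assert (D1 := Rlt_le_trans _ _ _ D (Rmin_l _ _)).
  assert (D2 := Rlt_le_trans _ _ _ D (Rmin_r _ _)).
  rewrite psi_plus by (auto; lra).
  eapply Rle_trans; [apply psi_lipschitz; auto; lra|].
  apply Rmult_le_compat_r; [left; now apply psi_hplane|].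
  apply Rle_trans with (2 * exp 1 / Re w * (eps * Re w / (2 * exp 1))).
  - apply Rmult_le_compat_l; [left; apply Rdiv_lt_0_compat; lra| lra].
  - right; field; lra.
Qed.

Lemma psi_continuous (w : C) (t eps : R) : hplane w -> 0 <= t -> 0 < eps ->
  exists d, 0 < d /\ forall s, 0 <= s -> Rabs (s - t) < d ->
    Cmod (psi s w - psi t w)%C < eps.
Proof.
  intros Hw Ht Heps. assert (Q := psi_hplane t w Ht Hw). unfold hplane in Q.
  (* For [s < t] the increment is measured by [Re (psi s w)]; the cap 1/2 ensures that this is at
     most [2 * Re (psi t w)]. *)
  set (e := Rmin (1/2) (eps / (4 * Re (psi t w)))).
  assert (He : 0 < e).
  { apply Rmin_glb_lt; [lra|]. apply Rdiv_lt_0_compat; lra. }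
  assert (He1 : e <= 1/2) by apply Rmin_l.
  assert (He2 : e * (4 * Re (psi t w)) <= eps).
  { apply Rle_div_r; [lra|]. apply Rmin_r. }
  destruct (psi_increment w e Hw He) as [d [Hd D]].
  exists d; split; auto. intros s Hs Hst. apply Rabs_def2 in Hst.
  destruct (Rle_dec t s) as [H|H].
  - specialize (D t (s - t) Ht). replace (t + (s - t)) with s in D by ring.
    specialize (D ltac:(lra)). nra.
  - specialize (D s (t - s) Hs). replace (s + (t - s)) with t in D by ring.
    specialize (D ltac:(lra)). rewrite Cmod_minus_sym.
    assert (Qs := psi_hplane s w Hs Hw). unfold hplane in Qs.
    assert (B := re_le_Cmod (psi t w - psi s w)%C). rewrite Re_minus in B.
    apply Rabs_le_between in B. nra.
Qed.

(* [Rabs t] extends the trajectory to negative times: Stdlib's [IVT] requires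
   continuity on the whole line. *)
Lemma trajectory_continuity (F : C -> R) (w : C) : hplane w ->
  (forall v, hplane v -> forall eps, 0 < eps -> exists d, 0 < d /\
     forall v', Cmod (v' - v)%C < d -> Rabs (F v' - F v) < eps) ->
  continuity (fun t => F (psi (Rabs t) w)).
Proof.
  intros Hw HF t. apply continuity_pt_locally. intros eps.
  destruct (HF _ (psi_hplane _ w (Rabs_pos t) Hw) eps (cond_pos eps)) as [d1 [Hd1 D1]].
  destruct (psi_continuous w (Rabs t) d1 Hw (Rabs_pos t) Hd1) as [d [Hd D]].
  exists (mkposreal d Hd). intros s Hs. apply D1, D; [apply Rabs_pos|].
  eapply Rle_lt_trans; [apply Rabs_triang_inv2| exact Hs].
Qed.

Hypothesis dw : Denjoy_Wolff_point phi b.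

Lemma generator_eps (G : C -> C) (z : C) (eps : R) : is_generator phi G -> disk z -> 0 < eps ->
  exists d, 0 < d /\ forall t, 0 < t < d -> Cmod ((phi t z - z) / RtoC t - G z)%C < eps.
Proof.
  intros HG Hz Heps.
  destruct (HG z Hz (fun y => Cmod (y - G z)%C < eps)) as [d D].
  { exists (mkposreal (eps / 2) ltac:(lra)). intros y [H1 H2].
    eapply Rle_lt_trans; [apply Cmod_le_Rabs|].
    change (Rabs (Re (y - G z)%C) < eps / 2) in H1.
    change (Rabs (Im (y - G z)%C) < eps / 2) in H2. lra. }
  exists d; split; [apply cond_pos|]. intros t Ht. apply D; [|lra].
  unfold ball; simpl; unfold AbsRing_ball, abs, minus, plus, opp; simpl.
  apply Rabs_def1; lra.
Qed.

(** In the half plane the generator becomes [2 P]: as [conj b * b = 1], the Berkson-Porta factors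
    equal [conj b * (z - b)^2], which cancels against [W'(z) = 2 b / (b - z)^2]. *)
Lemma psi_right_derivative (w : C) : hplane w -> exists l, 0 <= Re l /\
  forall eps, 0 < eps -> exists d, 0 < d /\ forall t, 0 < t < d ->
    Cmod ((psi t w - w) / RtoC t - l)%C < eps.
Proof.
  intros Hw. assert (Hz := to_disk_disk w Hw). set (z := to_disk w) in *.
  destruct dw as [_ [P [_ [HP HG]]]].
  assert (Hbb : (Cconj b * b = 1)%C).
  { rewrite Cmult_comm, <- Cmod2_conj, Hb. f_equal. ring. }
  exists (2 * P z)%C. split.
  { assert (K := HP z Hz). destruct (P z); simpl in *; lra. }
  assert (Hn := b_minus_neq_0 z Hz).
  set (G := ((Cconj b * z - 1) * (z - b) * P z)%C).
  assert (EG : (d_to_hplane z * G = 2 * P z)%C).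
  { unfold G, d_to_hplane. rewrite <- Hbb.
    transitivity (2 * (Cconj b * b) * P z)%C; [field; auto| rewrite Hbb; ring]. }
  destruct (to_hplane_holo z Hz) as [D _].
  assert (SC := slope_ccont _ _ _ D).
  intros eps Heps.
  set (A := d_to_hplane z) in *.
  set (m := Cmod A + Cmod G + 1).
  assert (P1 := Cmod_ge_0 A). assert (P2 := Cmod_ge_0 G).
  set (e := Rmin 1 (eps / (2 * m))).
  assert (He : 0 < e).
  { apply Rmin_glb_lt; [lra|]. apply Rdiv_lt_0_compat; unfold m; lra. }
  assert (He1 : e <= 1) by apply Rmin_l.
  assert (He2 : e * (2 * m) <= eps).
  { apply Rle_div_r; [unfold m; lra|]. apply Rmin_r. }
  destruct (SC e He) as [d1 [Hd1 D1]].
  destruct (phi_cv_0 z d1 Hz Hd1) as [d2 [Hd2 D2]].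
  destruct (generator_eps _ z e HG Hz He) as [d3 [Hd3 D3]].
  exists (Rmin d2 d3). split; [now apply Rmin_glb_lt|]. intros t Ht.
  assert (T2 := Rlt_le_trans _ _ _ (proj2 Ht) (Rmin_l _ _)).
  assert (T3 := Rlt_le_trans _ _ _ (proj2 Ht) (Rmin_r _ _)).
  specialize (D1 _ (D2 t ltac:(lra))). specialize (D3 t ltac:(lra)).
  rewrite slope_at in D1. fold G in D3.
  assert (Ht0 : RtoC t <> 0%C) by (intros E; apply RtoC_inj in E; lra).
  replace (psi t w - w)%C with (to_hplane (phi t z) - to_hplane z)%C
    by (unfold psi, z; now rewrite (to_hplane_disk w Hw)).
  rewrite (slope_spec to_hplane z A (phi t z)), <- EG.
  set (a := slope to_hplane z A (phi t z)) in *.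
  set (g := ((phi t z - z) / t)%C) in *.
  replace (a * (phi t z - z) / t - A * G)%C
    with ((a - A) * (g - G) + ((a - A) * G + A * (g - G)))%C
    by (unfold g; field; auto).
  eapply Rle_lt_trans; [apply Cmod_triangle|].
  eapply Rle_lt_trans; [apply Rplus_le_compat_l, Cmod_triangle|].
  rewrite !Cmod_mult.
  assert (P3 := Cmod_ge_0 (a - A)%C). assert (P4 := Cmod_ge_0 (g - G)%C).
  unfold m in He2. nra.
Qed.

(** Every point of a trajectory starts a trajectory, so the right derivative at time 0 controls all
    later times, and the Dini criterion applies. *)
Lemma psi_re_le (t : R) (w : C) : 0 <= t -> hplane w -> Re w <= Re (psi t w).
Proof.
  intros Ht Hw.
  assert (K : Re (psi (Rabs 0) w) <= Re (psi (Rabs t) w)).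
  { apply (dini_nondecreasing (fun t => Re (psi (Rabs t) w))); auto.
    - apply (trajectory_continuity Re w Hw). intros v Hv eps Heps. exists eps; split; auto.
      intros v' H. rewrite <- Re_minus. eapply Rle_lt_trans; [apply re_le_Cmod| auto].
    - intros s eps Hs Heps. rewrite (Rabs_pos_eq s) by auto.
      destruct (psi_right_derivative _ (psi_hplane s w Hs Hw)) as [l [Hl D]].
      destruct (D eps Heps) as [d [Hd D1]]. exists d; split; auto.
      intros h Hh. specialize (D1 h Hh). rewrite Rabs_pos_eq by lra.
      rewrite (Rplus_comm s h), psi_plus by (auto; lra).
      assert (Hh0 : RtoC h <> 0%C) by (intros E; apply RtoC_inj in E; lra).
      set (v := psi s w) in *.
      assert (B := re_le_Cmod ((psi h v - v) / h - l)%C).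
      rewrite Re_minus in B. apply Rabs_le_between in B.
      replace (psi h v) with (v + (psi h v - v) / h * h)%C by (field; auto).
      set (g := ((psi h v - v) / h)%C) in *.
      replace (Re (v + g * h)%C) with (Re v + Re g * h) by (destruct v, g; simpl; ring).
      nra. }
  rewrite Rabs_R0, psi_0, Rabs_pos_eq in K; auto.
Qed.

Definition disp (t : R) (w : C) : C := (psi t w - w)%C.

Lemma disp_holo (t : R) : 0 <= t -> holo hplane (disp t) (fun w => dpsi t w - 1)%C.
Proof.
  intros Ht w Hw. destruct (psi_holo t Ht w Hw) as [D1 D2]. split.
  - apply cderiv_minus; auto. apply cderiv_id.
  - apply ccont_minus; auto. apply ccont_const.
Qed.

Lemma disp_re (t : R) (w : C) : 0 <= t -> hplane w -> 0 <= Re (disp t w).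
Proof.
  intros Ht Hw. unfold disp. rewrite Re_minus. assert (K := psi_re_le t w Ht Hw). lra.
Qed.

Lemma cone_bound_pos (k : R) : 0 < k -> 0 < cone_bound k.
Proof. intros Hk. apply Rmult_lt_0_compat; [now apply pow_lt| apply exp_pos]. Qed.

Lemma hplane_1 : hplane 1%C.
Proof. unfold hplane; simpl; lra. Qed.

(** The single value [psi t 1 - 1] controls the displacement on the whole cone through
    [cone_growth]. *)
Lemma psi_close_on_cone (k eta : R) : 1 <= k -> 0 < eta ->
  exists d, 0 < d /\ forall t w, 0 <= t < d -> cone k w ->
    Cmod (psi t w - w)%C <= eta * Re w /\ Cmod (dpsi t w - 1)%C <= eta.
Proof.
  intros Hk Heta. assert (HB := cone_bound_pos k ltac:(lra)).
  destruct (psi_cv_0 1%C (eta / cone_bound k) hplane_1) as [d [Hd D]].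
  { now apply Rdiv_lt_0_compat. }
  exists d; split; auto. intros t w Ht Hw. specialize (D t Ht).
  destruct (cone_growth _ _ (disp_holo t (proj1 Ht)) (fun v Hv => disp_re t v (proj1 Ht) Hv) k w Hk Hw)
    as [B1 B2].
  change (disp t 1%C) with (psi t 1%C - 1)%C in B1, B2.
  assert (E : cone_bound k * Cmod (psi t 1%C - 1)%C <= eta).
  { apply Rlt_le. apply Rlt_div_r in D; auto. lra. }
  split.
  - eapply Rle_trans; [exact B1|]. apply Rmult_le_compat_r; auto. left; apply Hw.
  - lra.
Qed.

(* A trajectory from outside [cone (2 * k)] would have to cross the region in
   between, where it moves slowly. *)
Lemma no_fast_entry (k : R) : 2 <= k ->
  exists d, 0 < d /\ forall t w, 0 <= t < d -> hplane w ->
    cone k (psi t w) -> cone (2 * k) w.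
Proof.
  intros Hk.
  destruct (psi_close_on_cone (2 * k) (1/4)) as [d [Hd D]]; [lra|lra|].
  exists d; split; auto. intros t w Ht Hw [C1 C2].
  split; auto. apply Rnot_lt_le. intros L.
  (* The sign of [F] tells on which side of the boundary of [cone (2 * k)] a point lies; the
     intermediate value theorem gives a crossing time [s]. *)
  set (F := fun v => 2 * k * Re v - Cmod (v + 1)%C).
  assert (HF : continuity (fun t => F (psi (Rabs t) w))).
  { apply trajectory_continuity; auto. intros v Hv eps Heps.
    exists (eps / (2 * k + 1)). split; [apply Rdiv_lt_0_compat; lra|].
    intros v' Hv'. apply Rlt_div_r in Hv'; [|lra]. unfold F.
    assert (B1 := re_le_Cmod (v' - v)%C). rewrite Re_minus in B1. apply Rabs_le_between in B1.
    assert (B2 := Cmod_triangle_inv (v' + 1)%C (v + 1)%C).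
    assert (B3 := Cmod_triangle_inv (v + 1)%C (v' + 1)%C).
    replace (v' + 1 - (v + 1))%C with (v' - v)%C in B2 by ring.
    replace (v + 1 - (v' + 1))%C with (v - v')%C in B3 by ring.
    rewrite (Cmod_minus_sym v v') in B3.
    apply Rabs_def1; nra. }
  assert (F0 : F (psi (Rabs 0) w) < 0).
  { rewrite Rabs_R0, psi_0 by auto. unfold F. lra. }
  assert (Ft : 0 < F (psi (Rabs t) w)).
  { rewrite Rabs_pos_eq by lra. unfold F. nra. }
  assert (Ht0 : 0 < t).
  { destruct (proj1 Ht) as [|<-]; auto. lra. }
  destruct (IVT _ 0 t HF Ht0 F0 Ft) as [s [Hs Es]].
  rewrite Rabs_pos_eq in Es by lra. set (u := psi s w) in *.
  assert (Hu : hplane u) by (apply psi_hplane; auto; lra).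
  unfold F in Es.
  destruct (D (t - s) u) as [B _]; [lra| split; [exact Hu| lra]|].
  assert (E : psi t w = psi (t - s) u).
  { unfold u. rewrite <- psi_plus by (auto; lra). f_equal; ring. }
  rewrite E in C1, C2. set (v := psi (t - s) u) in *.
  (* From [|u + 1| = 2 k Re u] and [|v - u| <= Re u / 4] it follows that [|v + 1| > k Re v], against
     [C2]. *)
  assert (B1 := re_le_Cmod (v - u)%C). rewrite Re_minus in B1. apply Rabs_le_between in B1.
  assert (B3 := Cmod_triangle_inv (u + 1)%C (v + 1)%C).
  replace (u + 1 - (v + 1))%C with (u - v)%C in B3 by ring.
  rewrite (Cmod_minus_sym u v) in B3. unfold hplane in Hu. nra.
Qed.

(** The chain rule, combined with [W'(z) = (W(z) + 1)^2 / (2 b)] at [z] and at [phi_t z]. *)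
Lemma dphi_dpsi (t : R) (z : C) : 0 <= t -> disk z ->
  let w := to_hplane z in
  (C_derive (phi t) z = dpsi t w * (((w + 1) / (psi t w + 1)) * ((w + 1) / (psi t w + 1))))%C.
Proof.
  intros Ht Hz w. assert (Hp := semigroup_self_map _ sg t z Ht Hz).
  assert (H0 := unit_neq_0). assert (H1 := b_minus_neq_0 z Hz).
  assert (H2 := b_minus_neq_0 _ Hp). assert (H3 := Ctwo_neq_0).
  unfold dpsi, psi, w. rewrite to_disk_hplane by auto.
  unfold d_to_disk. rewrite !to_hplane_succ by auto. unfold d_to_hplane.
  field. repeat split; auto.
Qed.

Lemma dphi_close_on_cone (k eta : R) : 1 <= k -> 0 < eta ->
  exists d, 0 < d /\ forall t z, 0 <= t < d -> disk z -> cone k (to_hplane z) ->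
    Cmod (psi t (to_hplane z) - to_hplane z)%C <= eta * Re (to_hplane z) /\
    Cmod (C_derive (phi t) z - 1)%C <= eta.
Proof.
  (* With [|a| <= e] and [|c| <= 2 e] below, the error is at most [4 e + 4 e + 4 e^2 <= 10 e]. *)
  intros Hk Heta. set (e := Rmin (1/2) (eta / 10)).
  assert (He : 0 < e) by (apply Rmin_glb_lt; lra).
  assert (He1 : e <= 1/2) by apply Rmin_l.
  assert (He2 : e <= eta / 10) by apply Rmin_r.
  destruct (psi_close_on_cone k e Hk He) as [d [Hd D]].
  exists d; split; auto. intros t z Ht Hz Hc.
  rewrite (dphi_dpsi t z (proj1 Ht) Hz). cbv zeta.
  set (w := to_hplane z) in *.
  assert (Hw : hplane w) by now apply to_hplane_hplane.
  assert (Hpw : hplane (psi t w)) by (apply psi_hplane; auto; lra).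
  destruct (D t w Ht Hc) as [B1 B2]. unfold hplane in Hw.
  split; [nra|].
  assert (N1 := hplane_succ_neq_0 _ Hpw).
  set (rho := ((w + 1) / (psi t w + 1))%C).
  assert (R1 : Cmod (rho - 1)%C <= 2 * e).
  { replace (rho - 1)%C with (- (psi t w - w) / (psi t w + 1))%C by (unfold rho; field; auto).
    rewrite Cmod_div, Cmod_opp by auto.
    assert (P := Cmod_neq_0 _ N1). apply Rle_div_l; auto.
    assert (B3 := Cmod_triangle_inv (w + 1)%C (psi t w + 1)%C).
    replace (w + 1 - (psi t w + 1))%C with (- (psi t w - w))%C in B3 by ring.
    rewrite Cmod_opp in B3.
    assert (B4 := re_le_Cmod (w + 1)%C). apply Rabs_le_between in B4.
    replace (Re (w + 1)%C) with (Re w + 1) in B4 by reflexivity.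
    assert (e * Re w <= 1 / 2 * Re w) by (apply Rmult_le_compat_r; lra).
    assert (e * (Re w / 2) <= e * Cmod (psi t w + 1)%C) by (apply Rmult_le_compat_l; lra).
    lra. }
  set (a := (dpsi t w - 1)%C) in *. set (c := (rho - 1)%C) in *.
  replace (dpsi t w * (rho * rho) - 1)%C
    with (a * ((1 + c) * (1 + c)) + (2 * c + c * c))%C by (unfold a, c; ring).
  eapply Rle_trans; [apply Cmod_triangle|].
  eapply Rle_trans; [apply Rplus_le_compat_l, Cmod_triangle|].
  rewrite !Cmod_mult, Cmod_R, Rabs_pos_eq by lra.
  assert (T := Cmod_triangle 1%C c). rewrite Cmod_1 in T.
  assert (P1 := Cmod_ge_0 c). assert (P2 := Cmod_ge_0 a). assert (P3 := Cmod_ge_0 (1 + c)%C).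
  assert (T2 : Cmod (1 + c)%C <= 2) by lra.
  set (m := Cmod (1 + c)%C) in *.
  assert (m * m <= 4) by nra.
  assert (Cmod a * (m * m) <= e * 4) by (apply Rmult_le_compat; auto using Rmult_le_pos).
  nra.
Qed.

End HalfPlane.

(** * Integral means *)

Lemma rpow_0 (a : R) : rpow 0 a = 0.
Proof. unfold rpow. destruct (Req_EM_T 0 0); congruence. Qed.

Lemma rpow_pos_eq (x a : R) : 0 < x -> rpow x a = Rpower x a.
Proof. intros Hx. unfold rpow. destruct (Req_EM_T x 0); lra. Qed.

Lemma Rpower_pos (x a : R) : 0 < Rpower x a.
Proof. apply exp_pos. Qed.

Lemma rpow_ge_0 (x a : R) : 0 <= rpow x a.
Proof.
  unfold rpow. destruct (Req_EM_T x 0); [lra| left; apply Rpower_pos].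
Qed.

Lemma rpow_le (x y a : R) : 0 < a -> 0 <= x <= y -> rpow x a <= rpow y a.
Proof.
  intros Ha [[Hx|<-] Hxy].
  - rewrite !rpow_pos_eq by lra. apply Rle_Rpower_l; lra.
  - rewrite rpow_0. apply rpow_ge_0.
Qed.

Lemma rpow_mult (x y a : R) : 0 <= x -> 0 <= y -> rpow (x * y) a = rpow x a * rpow y a.
Proof.
  intros [Hx|<-] [Hy|<-]; rewrite ?Rmult_0_l, ?Rmult_0_r, ?rpow_0; try ring.
  rewrite !rpow_pos_eq by (auto; now apply Rmult_lt_0_compat).
  now rewrite Rpower_mult_distr.
Qed.

Lemma rpow_rpow (x a : R) : 0 < a -> 0 <= x -> rpow (rpow x a) (/ a) = x.
Proof.
  intros Ha [Hx|<-].
  - rewrite (rpow_pos_eq x), rpow_pos_eq by (auto; apply Rpower_pos).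
    rewrite Rpower_mult, Rinv_r, Rpower_1; lra.
  - now rewrite !rpow_0.
Qed.

(** Zeros of [u] need a separate argument, [Rpower] having the wrong value there:
    [rpow (u s) a < eps] follows from [u s < eps^(1/a)]. *)
Lemma continuous_rpow (u : R -> R) (a t : R) : 0 < a -> (forall t, 0 <= u t) ->
  continuous u t -> continuous (fun t => rpow (u t) a) t.
Proof.
  intros Ha Hu Hc. destruct (Hu t) as [H|H].
  - apply (continuous_ext_loc _ (fun t => Rpower (u t) a)).
    + assert (L := Hc _ (open_gt 0 (u t) H)). unfold filtermap in L. revert L. apply filter_imp. intros s Hs.
      now rewrite rpow_pos_eq.
    + apply (continuous_comp u (fun x => Rpower x a)); auto.
      apply (ex_derive_continuous (V := R_NormedModule)). unfold Rpower. auto_derive; auto.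
  - intros P HP. rewrite <- H, rpow_0 in HP. destruct HP as [eps HP].
    assert (He : 0 < Rpower eps (/ a)) by apply Rpower_pos.
    unfold filtermap.
    assert (L := Hc _ (open_lt (Rpower eps (/ a)) (u t) ltac:(lra))).
    unfold filtermap in L. revert L. apply filter_imp.
    intros s Hs. apply HP. unfold ball; simpl; unfold AbsRing_ball, abs, minus, plus, opp; simpl.
    rewrite Ropp_0, Rplus_0_r, Rabs_pos_eq by apply rpow_ge_0.
    destruct (Hu s) as [Hus|Hus].
    + rewrite rpow_pos_eq by auto.
      apply Rlt_le_trans with (Rpower (Rpower eps (/ a)) a).
      * apply Rlt_Rpower_l; lra.
      * rewrite Rpower_mult, Rinv_l, Rpower_1; [lra| apply cond_pos| lra].
    + rewrite <- Hus, rpow_0. apply cond_pos.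
Qed.

(** Only the modulus on one circle is constrained, which admits sums of moduli such as [sum_mod]. *)
Definition circ_cont (r : R) (g : C -> C) : Prop :=
  forall t, continuous (fun t => Cmod (g (circle_pt r t))) t.

Lemma continuous_Cmod (u v : R -> R) (t : R) : continuous u t -> continuous v t ->
  continuous (fun t => Cmod (u t, v t)) t.
Proof.
  intros Hu Hv. unfold Cmod; simpl.
  apply (continuous_comp (fun t => u t * (u t * 1) + v t * (v t * 1)) sqrt).
  - apply (continuous_plus (V := R_NormedModule));
      apply (continuous_mult (K := R_AbsRing)); auto;
      apply (continuous_mult (K := R_AbsRing)); auto; apply continuous_const.
  - apply continuous_sqrt.
Qed.

Lemma ccont_circ_cont (r : R) (g : C -> C) : 0 <= r < 1 ->
  (forall z, disk z -> ccont g z) -> circ_cont r g.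
Proof.
  intros Hr Hg t. destruct (circle_continuous g r t) as [H1 H2].
  { apply Hg, circle_pt_disk, Hr. }
  apply (continuous_ext (fun t => Cmod (Re (g (circle_pt r t)), Im (g (circle_pt r t))))).
  - intros s. now destruct (g (circle_pt r s)).
  - now apply continuous_Cmod.
Qed.

Lemma circ_cont_rpow (r q : R) (g : C -> C) : 0 < q -> circ_cont r g ->
  forall t, continuous (fun t => rpow (Cmod (g (circle_pt r t))) q) t.
Proof.
  intros Hq Hg t. apply continuous_rpow; auto. intros s; apply Cmod_ge_0.
Qed.

Lemma circ_cont_ex_RInt (r q a b : R) (g : C -> C) : 0 < q -> circ_cont r g ->
  ex_RInt (fun t => rpow (Cmod (g (circle_pt r t))) q) a b.
Proof.
  intros Hq Hg. apply (ex_RInt_continuous (V := R_CompleteNormedModule)).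
  intros t _. now apply circ_cont_rpow.
Qed.

Lemma circle_pt_period (r t : R) : circle_pt r (t + 2 * PI) = circle_pt r t.
Proof.
  unfold circle_pt. replace (t + 2 * PI) with (t + 2 * INR 1 * PI) by (simpl; ring).
  now rewrite cos_period, sin_period.
Qed.

(** [Mp p_infty] takes its supremum over all real angles, while the maximum principle for continuous
    functions works on one compact period. *)
Lemma circle_pt_reduce (r t : R) :
  exists t0, 0 <= t0 <= 2 * PI /\ circle_pt r t0 = circle_pt r t.
Proof.
  assert (PP := PI_RGT_0).
  assert (K : forall n t, Rabs t <= INR n * (2 * PI) ->
    exists t0, 0 <= t0 <= 2 * PI /\ circle_pt r t0 = circle_pt r t).
  { induction n as [|n IH]; intros s Hs.
    - simpl in Hs. rewrite Rmult_0_l in Hs. assert (A := Rabs_pos s).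
      exists s; split; auto. apply Rabs_le_between in Hs. lra.
    - rewrite S_INR in Hs. apply Rabs_le_between in Hs.
      destruct (Rle_dec 0 s) as [H0|H0].
      + destruct (Rle_dec s (2 * PI)) as [H1|H1]; [exists s; auto|].
        destruct (IH (s - 2 * PI)) as [t0 [Ht0 E]]; [apply Rabs_le_between; lra|].
        exists t0; split; auto. rewrite E, <- circle_pt_period. f_equal; ring.
      + destruct (Rle_dec (- (2 * PI)) s) as [H1|H1].
        * exists (s + 2 * PI). split; [lra| apply circle_pt_period].
        * destruct (IH (s + 2 * PI)) as [t0 [Ht0 E]]; [apply Rabs_le_between; lra|].
          exists t0; split; auto. now rewrite E, circle_pt_period. }
  destruct (nfloor_ex (Rabs t / (2 * PI))) as [n [_ Hn]].
  { apply Rdiv_le_0_compat; [apply Rabs_pos| lra]. }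
  apply (K (S n) t). rewrite S_INR. apply Rlt_le. apply Rlt_div_l; [lra| exact Hn].
Qed.

Lemma circ_cont_bounded (r : R) (g : C -> C) : circ_cont r g ->
  exists B, forall t, Cmod (g (circle_pt r t)) <= B.
Proof.
  intros Hg. assert (PP := PI_RGT_0).
  destruct (continuity_ab_maj (fun t => Cmod (g (circle_pt r t))) 0 (2 * PI)) as [m [Hm _]].
  - lra.
  - intros t _. apply continuity_pt_filterlim, Hg.
  - exists (Cmod (g (circle_pt r m))). intros t.
    destruct (circle_pt_reduce r t) as [t0 [Ht0 <-]]. now apply Hm.
Qed.

(** [real] would send an infinite supremum to 0; boundedness on the circle excludes this. *)
Lemma Mp_infty_spec (r : R) (g : C -> C) : circ_cont r g ->
  (forall t, Cmod (g (circle_pt r t)) <= Mp p_infty r g) /\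
  (forall B, (forall t, Cmod (g (circle_pt r t)) <= B) -> Mp p_infty r g <= B).
Proof.
  intros Hg. destruct (circ_cont_bounded r g Hg) as [B HB]. unfold Mp.
  set (E := fun y => exists theta, y = Cmod (g (circle_pt r theta))).
  destruct (Lub_Rbar_correct E) as [H1 H2].
  assert (F : is_finite (Lub_Rbar E)).
  { assert (L : Rbar_le (Lub_Rbar E) B) by (apply H2; intros y [t ->]; apply HB).
    assert (L2 : Rbar_le (Cmod (g (circle_pt r 0))) (Lub_Rbar E)) by (apply H1; now exists 0).
    destruct (Lub_Rbar E); try reflexivity; simpl in *; tauto. }
  rewrite <- F in H1, H2. split.
  - intros t. apply (H1 (Cmod (g (circle_pt r t)))). now exists t.
  - intros B' HB'. apply (H2 (Finite B')). intros y [t ->]. apply HB'.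
Qed.

Definition exponent (p : Rbar) : Prop := p = p_infty \/ exists q, p = Finite q /\ 1 <= q.

Lemma exponent_le (p : Rbar) : Rbar_le 1 p -> exponent p.
Proof. destruct p; simpl; intros H; [right; eauto| now left| easy]. Qed.

Section Means.

Variables (p : Rbar) (r : R).
Hypothesis Hp : exponent p.

Lemma Mp_ge_0 (g : C -> C) : circ_cont r g -> 0 <= Mp p r g.
Proof.
  intros Hg. destruct Hp as [->|[q [-> Hq]]].
  - eapply Rle_trans; [apply (Cmod_ge_0 (g (circle_pt r 0)))|]. now apply Mp_infty_spec.
  - apply rpow_ge_0.
Qed.

Lemma Mp_le_bound (g : C -> C) (B : R) : circ_cont r g -> 0 <= B ->
  (forall t, Cmod (g (circle_pt r t)) <= B) -> Mp p r g <= B.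
Proof.
  intros Hg HB H. destruct Hp as [->|[q [-> Hq]]].
  - now apply Mp_infty_spec.
  - assert (PP := PI_RGT_0). unfold Mp.
    rewrite <- (rpow_rpow B q) by lra.
    apply rpow_le; [apply Rinv_0_lt_compat; lra|]. split.
    + apply Rdiv_le_0_compat; [|lra].
      apply RInt_ge_0; [lra| apply circ_cont_ex_RInt; auto; lra|].
      intros t _; apply rpow_ge_0.
    + apply Rle_div_l; [lra|].
      replace (rpow B q * (2 * PI)) with (RInt (fun _ => rpow B q) 0 (2 * PI))
        by (rewrite RInt_const; unfold scal; simpl; unfold mult; simpl; ring).
      apply RInt_le; [lra| apply circ_cont_ex_RInt; auto; lra| apply ex_RInt_const|].
      intros t _. apply rpow_le; [lra|]. split; [apply Cmod_ge_0| auto].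
Qed.

(** A substitute for Minkowski's inequality, from [(x + y)^q <= 2^q (x^q + y^q)]. One factor 2 is
    the [q]-th root of [2^q]; the other bounds [2^(1/q)], which arises when the sum of the two means
    of [q]-th powers is replaced by twice the larger one. *)
Lemma Mp_quasi (g g1 g2 : C -> C) : circ_cont r g -> circ_cont r g1 -> circ_cont r g2 ->
  (forall t, Cmod (g (circle_pt r t)) <= Cmod (g1 (circle_pt r t)) + Cmod (g2 (circle_pt r t))) ->
  Mp p r g <= 4 * (Mp p r g1 + Mp p r g2).
Proof.
  intros Hg Hg1 Hg2 H.
  assert (N1 := Mp_ge_0 g1 Hg1). assert (N2 := Mp_ge_0 g2 Hg2).
  destruct Hp as [->|[q [-> Hq]]].
  - apply Mp_infty_spec; auto. intros t. specialize (H t).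
    assert (A1 := proj1 (Mp_infty_spec r g1 Hg1) t).
    assert (A2 := proj1 (Mp_infty_spec r g2 Hg2) t). lra.
  - assert (PP := PI_RGT_0). unfold Mp in *.
    set (I1 := RInt (fun t => rpow (Cmod (g1 (circle_pt r t))) q) 0 (2 * PI)) in *.
    set (I2 := RInt (fun t => rpow (Cmod (g2 (circle_pt r t))) q) 0 (2 * PI)) in *.
    assert (E1 := circ_cont_ex_RInt r q 0 (2 * PI) g1 ltac:(lra) Hg1).
    assert (E2 := circ_cont_ex_RInt r q 0 (2 * PI) g2 ltac:(lra) Hg2).
    assert (P1 : 0 <= I1) by (apply RInt_ge_0; auto; [lra| intros; apply rpow_ge_0]).
    assert (P2 : 0 <= I2) by (apply RInt_ge_0; auto; [lra| intros; apply rpow_ge_0]).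
    assert (K : RInt (fun t => rpow (Cmod (g (circle_pt r t))) q) 0 (2 * PI) <= rpow 2 q * (I1 + I2)).
    { assert (E : is_RInt (fun t => rpow 2 q * (rpow (Cmod (g1 (circle_pt r t))) q + rpow (Cmod (g2 (circle_pt r t))) q))
        0 (2 * PI) (rpow 2 q * (I1 + I2))).
      { apply (is_RInt_scal (V := R_NormedModule)).
        apply (is_RInt_plus (V := R_NormedModule)); now apply (RInt_correct (V := R_CompleteNormedModule)). }
      rewrite <- (is_RInt_unique _ _ _ _ E).
      apply RInt_le; [lra| apply circ_cont_ex_RInt; auto; lra| eexists; eauto|].
      intros t _. specialize (H t).
      set (x := Cmod (g1 (circle_pt r t))) in *. set (y := Cmod (g2 (circle_pt r t))) in *.
      assert (Px : 0 <= x) by apply Cmod_ge_0. assert (Py : 0 <= y) by apply Cmod_ge_0.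
      assert (Rx := rpow_ge_0 x q). assert (Ry := rpow_ge_0 y q). assert (R2 := rpow_ge_0 2 q).
      destruct (Rle_dec x y) as [L|L].
      - apply Rle_trans with (rpow (2 * y) q).
        + apply rpow_le; [lra|]. split; [apply Cmod_ge_0| lra].
        + rewrite rpow_mult by lra. apply Rmult_le_compat_l; lra.
      - apply Rle_trans with (rpow (2 * x) q).
        + apply rpow_le; [lra|]. split; [apply Cmod_ge_0| lra].
        + rewrite rpow_mult by lra. apply Rmult_le_compat_l; lra. }
    assert (Hq' : 0 < / q) by (apply Rinv_0_lt_compat; lra).
    assert (H2q : rpow 2 (/ q) <= 2).
    { rewrite rpow_pos_eq by lra. rewrite <- (Rpower_1 2) at 2 by lra.
      apply Rle_Rpower; [lra|]. rewrite <- Rinv_1. apply Rinv_le_contravar; lra. }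
    assert (A1 : 0 <= I1 / (2 * PI)) by (apply Rdiv_le_0_compat; lra).
    assert (A2 : 0 <= I2 / (2 * PI)) by (apply Rdiv_le_0_compat; lra).
    assert (Key : forall A, 0 <= A -> I1 / (2 * PI) + I2 / (2 * PI) <= 2 * A ->
      rpow (RInt (fun t => rpow (Cmod (g (circle_pt r t))) q) 0 (2 * PI) / (2 * PI)) (/ q)
        <= 4 * rpow A (/ q)).
    { intros A HA HL.
      apply Rle_trans with (rpow (rpow 2 q * (2 * A)) (/ q)).
      - apply rpow_le; auto. split.
        + apply Rdiv_le_0_compat; [|lra].
          apply RInt_ge_0; [lra| apply circ_cont_ex_RInt; auto; lra|].
          intros t _; apply rpow_ge_0.
        + apply Rle_trans with (rpow 2 q * (I1 + I2) / (2 * PI)).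
          * apply Rmult_le_compat_r; [left; apply Rinv_0_lt_compat; lra| auto].
          * replace (rpow 2 q * (I1 + I2) / (2 * PI)) with (rpow 2 q * (I1 / (2 * PI) + I2 / (2 * PI))) by (field; lra).
            apply Rmult_le_compat_l; auto. apply rpow_ge_0.
      - rewrite rpow_mult, rpow_rpow, rpow_mult; try lra; [|apply rpow_ge_0].
        assert (RA := rpow_ge_0 A (/ q)). nra. }
    destruct (Rle_dec (I1 / (2 * PI)) (I2 / (2 * PI))) as [L|L].
    + assert (K2 := Key _ A2 ltac:(lra)). lra.
    + assert (K2 := Key _ A1 ltac:(lra)). lra.
Qed.

Definition sum_mod (l : list (C -> C)) (z : C) : R :=
  fold_right (fun f s => Cmod (f z) + s) 0 l.

Lemma sum_mod_ge_0 (l : list (C -> C)) (z : C) : 0 <= sum_mod l z.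
Proof.
  induction l as [|f l IH]; simpl; [lra|]. assert (P := Cmod_ge_0 (f z)). lra.
Qed.

Lemma sum_mod_circ_cont (l : list (C -> C)) :
  (forall f, In f l -> circ_cont r f) -> circ_cont r (fun z => RtoC (sum_mod l z)).
Proof.
  intros H t. apply (continuous_ext (fun t => sum_mod l (circle_pt r t))).
  { intros s. rewrite Cmod_R, Rabs_pos_eq; auto. apply sum_mod_ge_0. }
  induction l as [|f l IH]; simpl; [apply continuous_const|].
  apply (continuous_plus (V := R_NormedModule)).
  - apply H; now left.
  - apply IH. intros; apply H; now right.
Qed.

(** Each further function costs [4 * (B + 8^n * B) <= 8^(n+1) * B]. *)
Lemma Mp_quasi_list (l : list (C -> C)) (g : C -> C) (B : R) :
  circ_cont r g -> 0 <= B ->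
  (forall f, In f l -> circ_cont r f /\ Mp p r f <= B) ->
  (forall t, Cmod (g (circle_pt r t)) <= sum_mod l (circle_pt r t)) ->
  Mp p r g <= 8 ^ length l * B.
Proof.
  intros Hg HB. revert g Hg. induction l as [|f l IH]; intros g Hg Hl H; simpl in *.
  - rewrite Rmult_1_l. apply Mp_le_bound; auto. intros t; specialize (H t); lra.
  - destruct (Hl f (or_introl eq_refl)) as [Hf1 Hf2].
    assert (Cs := sum_mod_circ_cont l (fun f Hf => proj1 (Hl f (or_intror Hf)))).
    assert (K := IH _ Cs (fun f Hf => Hl f (or_intror Hf))).
    assert (Es : forall z, Cmod (RtoC (sum_mod l z)) = sum_mod l z).
    { intros z. rewrite Cmod_R, Rabs_pos_eq; auto. apply sum_mod_ge_0. }
    specialize (K ltac:(intros t; cbv beta; rewrite Es; lra)).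
    assert (Q := Mp_quasi g f (fun z => RtoC (sum_mod l z)) Hg Hf1 Cs
      ltac:(intros t; cbv beta; rewrite Es; apply H)).
    assert (1 <= 8 ^ length l) by (apply pow_R1_Rle; lra). nra.
Qed.

End Means.

(** * Real bounds on the norm of H(p, infinity, alpha) *)

Definition Hbound (p : Rbar) (alpha : R) (f : C -> C) (B : R) : Prop :=
  forall r, 0 <= r < 1 -> Rpower (1 - r) alpha * Mp p r f <= B.

Lemma Hnorm_le_iff (p : Rbar) (alpha : R) (f : C -> C) (B : R) :
  Rbar_le (Hnorm p alpha f) B <-> Hbound p alpha f B.
Proof.
  unfold Hnorm. destruct (Lub_Rbar_correct (fun y => exists r, 0 <= r < 1 /\
    y = Rpower (1 - r) alpha * Mp p r f)) as [H1 H2]. split.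
  - intros H r Hr. assert (K := H1 _ (ex_intro _ r (conj Hr eq_refl))).
    apply (Rbar_le_trans _ _ _ K H).
  - intros H. apply H2. intros y [r [Hr ->]]. now apply H.
Qed.

Lemma Hnorm_finite (p : Rbar) (alpha : R) (f : C -> C) :
  Rbar_lt (Hnorm p alpha f) p_infty -> exists B, Hnorm p alpha f = Finite B.
Proof.
  intros H. assert (L : Rbar_le (Rpower (1 - 0) alpha * Mp p 0 f) (Hnorm p alpha f)).
  { apply Lub_Rbar_correct. exists 0; split; [lra| auto]. }
  destruct (Hnorm p alpha f); simpl in *; try tauto. eauto.
Qed.

Lemma Hspace_bound (p : Rbar) (alpha : R) (f : C -> C) :
  Hspace p alpha f <-> analytic f /\ exists B, Hbound p alpha f B.
Proof.
  split.
  - intros [H1 H2]; split; auto. destruct (Hnorm_finite _ _ _ H2) as [B HB].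
    exists B. apply Hnorm_le_iff. rewrite HB. apply Rbar_le_refl.
  - intros [H1 [B HB]]; split; auto. apply Hnorm_le_iff in HB.
    eapply Rbar_le_lt_trans; [exact HB| exact I].
Qed.

Lemma analytic_circ_cont (r : R) (f : C -> C) : 0 <= r < 1 -> analytic f -> circ_cont r f.
Proof. intros Hr Hf. apply ccont_circ_cont; auto. intros z Hz. now apply analytic_ccont. Qed.

Lemma op_norm_bound (p : Rbar) (alpha : R) (S : (C -> C) -> C -> C) (M B : R) (f : C -> C) :
  op_norm_le (Hspace p alpha) (Hnorm p alpha) S M -> Hspace p alpha f ->
  Hbound p alpha f B -> Hspace p alpha (S f) /\ Hbound p alpha (S f) (M * B).
Proof.
  intros [HM H] Hf HB. destruct (H f Hf) as [H1 H2]. split; auto.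
  apply Hnorm_le_iff. apply Hnorm_le_iff in HB.
  destruct Hf as [_ Hf]. destruct (Hnorm_finite _ _ _ Hf) as [n En]. rewrite En in *.
  eapply Rbar_le_trans; [exact H2|]. simpl in *. now apply Rmult_le_compat_l.
Qed.

Lemma Rpower_le_1 (x a : R) : 0 < x <= 1 -> 0 < a -> Rpower x a <= 1.
Proof.
  intros Hx Ha. unfold Rpower. rewrite <- exp_0. apply exp_le.
  assert (ln x <= 0) by (rewrite <- ln_1; apply ln_le; lra). nra.
Qed.

Lemma Hbound_bounded (p : Rbar) (alpha : R) (f : C -> C) (B : R) : exponent p -> 0 < alpha ->
  (forall z, disk z -> ccont f z) -> 0 <= B -> (forall z, disk z -> Cmod (f z) <= B) ->
  Hbound p alpha f B.
Proof.
  intros Hp Ha Hc HB H r Hr.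
  assert (K : Mp p r f <= B).
  { apply Mp_le_bound; auto; [now apply ccont_circ_cont|].
    intros t. apply H, circle_pt_disk, Hr. }
  assert (R1 := Rpower_le_1 (1 - r) alpha ltac:(lra) Ha).
  assert (N := Mp_ge_0 p r Hp f (ccont_circ_cont r f Hr Hc)).
  assert (P := Rpower_pos (1 - r) alpha). nra.
Qed.

(** The constant depends on the number of functions alone, a number that stays fixed while their
    norms are made small. *)
Lemma Hbound_list (p : Rbar) (alpha : R) (l : list (C -> C)) (g : C -> C) (B : R) :
  exponent p -> 0 <= B -> (forall z, disk z -> ccont g z) ->
  (forall f, In f l -> (forall z, disk z -> ccont f z) /\ Hbound p alpha f B) ->
  (forall z, disk z -> Cmod (g z) <= sum_mod l z) ->
  Hbound p alpha g (8 ^ length l * B).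
Proof.
  intros Hp HB Hg Hl H r Hr. assert (P := Rpower_pos (1 - r) alpha).
  set (c := Rpower (1 - r) alpha) in *.
  assert (K : Mp p r g <= 8 ^ length l * (B / c)).
  { apply (Mp_quasi_list p r Hp l); auto.
    - now apply ccont_circ_cont.
    - apply Rdiv_le_0_compat; lra.
    - intros f Hf. destruct (Hl f Hf) as [H1 H2]. split; [now apply ccont_circ_cont|].
      apply Rle_div_r; auto. rewrite Rmult_comm. now apply H2.
    - intros t. apply H, circle_pt_disk, Hr. }
  replace (8 ^ length l * B) with (c * (8 ^ length l * (B / c))) by (field; lra).
  apply Rmult_le_compat_l; lra.
Qed.

(** * A criterion for strong continuity *)

Lemma analytic_ext (f g : C -> C) : (forall z, disk z -> f z = g z) -> analytic f -> analytic g.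
Proof.
  intros E H. apply (cderiv_analytic _ (C_derive f)). intros z Hz.
  apply (cderiv_ext_loc f g disk); auto; [apply open_disk| now apply analytic_cderiv].
Qed.

Lemma analytic_minus (f g : C -> C) : analytic f -> analytic g ->
  analytic (fun z => f z - g z)%C.
Proof.
  intros Hf Hg. apply (cderiv_analytic _ (fun z => C_derive f z - C_derive g z)%C).
  intros z Hz. apply cderiv_minus; now apply analytic_cderiv.
Qed.

Lemma analytic_const (c : C) : analytic (fun _ => c).
Proof. apply (cderiv_analytic _ (fun _ => 0%C)). intros z _. apply cderiv_const. Qed.

Lemma analytic_monomial (c : C) (n : nat) : analytic (fun z => c * z ^ n)%C.
Proof.
  intros z _. destruct (cderiv_pow z n) as [l Hl].
  exists (c * l)%C. now apply cderiv_is_derive, cderiv_scal.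
Qed.

Lemma at_right_intro (P : R -> Prop) (d : R) : 0 < d ->
  (forall t, 0 < t < d -> P t) -> at_right 0 P.
Proof.
  intros Hd H. exists (mkposreal d Hd). intros t Ht H0. apply H. split; auto.
  unfold ball in Ht; simpl in Ht; unfold AbsRing_ball, abs, minus, plus, opp in Ht; simpl in Ht.
  apply Rabs_def2 in Ht. lra.
Qed.

Lemma at_right_elim (P : R -> Prop) : at_right 0 P ->
  exists d, 0 < d /\ forall t, 0 < t < d -> P t.
Proof.
  intros [d Hd]. exists d; split; [apply cond_pos|]. intros t Ht. apply Hd; [|lra].
  unfold ball; simpl; unfold AbsRing_ball, abs, minus, plus, opp; simpl.
  apply Rabs_def1; lra.
Qed.

Lemma pow_ge_linear (x : R) (n : nat) : 0 <= x <= 1 -> 1 - INR n * x <= (1 - x) ^ n.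
Proof.
  intros Hx. induction n as [|n IH]; [simpl; lra|]. rewrite S_INR. simpl.
  assert (0 <= INR n) by apply pos_INR. nra.
Qed.

Lemma Rpower_small (alpha eps : R) : 0 < alpha -> 0 < eps ->
  exists d, 0 < d < 1 /\ forall x, 0 < x <= d -> Rpower x alpha <= eps.
Proof.
  intros Ha He. exists (Rmin (1/2) (Rpower eps (/ alpha))). split.
  - split; [apply Rmin_glb_lt; [lra| apply Rpower_pos]|].
    eapply Rle_lt_trans; [apply Rmin_l| lra].
  - intros x Hx. apply Rle_trans with (Rpower (Rpower eps (/ alpha)) alpha).
    + apply Rle_Rpower_l; [lra|]. split; [lra|].
      eapply Rle_trans; [apply Hx| apply Rmin_r].
    + rewrite Rpower_mult, Rinv_l, Rpower_1; lra.
Qed.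

(** Near the boundary the weight [(1 - r)^alpha] is small, and on the remaining radii [r^n] is small
    for large [n]. *)
Lemma monomial_small (p : Rbar) (alpha A eps : R) : exponent p -> 0 < alpha ->
  0 <= A -> 0 < eps -> exists n, Hbound p alpha (fun z => A * z ^ n)%C eps.
Proof.
  intros Hp Ha HA He.
  set (e := eps / (A + 1)).
  assert (He1 : 0 < e) by (apply Rdiv_lt_0_compat; lra).
  assert (Ee : e * (A + 1) = eps) by (unfold e; field; lra).
  destruct (Rpower_small alpha e Ha He1) as [d [Hd D]].
  destruct (pow_lt_1_zero (1 - d) ltac:(rewrite Rabs_pos_eq; lra) e He1) as [n Hn].
  specialize (Hn n (Nat.le_refl n)).
  exists n. intros r Hr.
  assert (P := Rpower_pos (1 - r) alpha).
  assert (Hc : circ_cont r (fun z => A * z ^ n)%C) by (apply analytic_circ_cont; auto; apply analytic_monomial).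
  assert (Hpow : 0 <= r ^ n) by (apply pow_le; lra).
  assert (K : Mp p r (fun z => A * z ^ n)%C <= A * r ^ n).
  { apply Mp_le_bound; auto; [now apply Rmult_le_pos|]. intros t.
    rewrite Cmod_mult, Cmod_pow, Cmod_circle_pt, Cmod_R, Rabs_pos_eq by lra. lra. }
  assert (N := Mp_ge_0 p r Hp _ Hc).
  assert (Q : Rpower (1 - r) alpha * r ^ n <= e).
  { destruct (Rle_dec (1 - r) d) as [L|L].
    - assert (D1 := D (1 - r) ltac:(lra)).
      assert (r ^ n <= 1) by (rewrite <- (pow1 n); apply pow_incr; lra). nra.
    - assert (R1 := Rpower_le_1 (1 - r) alpha ltac:(lra) Ha).
      assert (r ^ n <= (1 - d) ^ n) by (apply pow_incr; lra).
      rewrite Rabs_pos_eq in Hn by (apply pow_le; lra). nra. }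
  apply Rle_trans with (A * (Rpower (1 - r) alpha * r ^ n)); nra.
Qed.

(** [Re W] is the Poisson kernel with pole [b]. *)
Lemma to_hplane_re (b z : C) : Cmod b = 1 -> disk z ->
  Re (to_hplane b z) * (Cmod (b - z)%C * Cmod (b - z)%C) = 1 - Cmod z * Cmod z.
Proof.
  intros Hb Hz. assert (H1 := b_minus_neq_0 b Hb z Hz).
  assert (P := Cmod_neq_0 _ H1). assert (E := Cmod_sqr (b - z)%C).
  assert (Eb := Cmod_sqr b). rewrite Hb in Eb. rewrite (Cmod_sqr z).
  rewrite E in *. unfold to_hplane.
  assert (P2 : 0 < Re (b - z)%C * Re (b - z)%C + Im (b - z)%C * Im (b - z)%C) by nra.
  destruct b as [b1 b2], z as [x y]; simpl in *. field_simplify; nra.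
Qed.

Lemma Cmod_b_minus (b z : C) : Cmod b = 1 -> disk z ->
  1 - Cmod z <= Cmod (b - z)%C <= 2.
Proof.
  intros Hb Hz. assert (T := Cmod_triangle_inv b z). rewrite Hb in T. split; auto.
  assert (T2 := Cmod_triangle b (- z)%C). rewrite Cmod_opp, Hb in T2.
  unfold disk in Hz. change (b - z)%C with (b + - z)%C. lra.
Qed.

Lemma Cmod_to_hplane_succ (b z : C) : Cmod b = 1 -> disk z ->
  Cmod (to_hplane b z + 1)%C = 2 / Cmod (b - z)%C.
Proof.
  intros Hb Hz. rewrite to_hplane_succ by auto.
  rewrite Cmod_div, Cmod_mult, Hb, Cmod_R, Rabs_pos_eq; try lra.
  now apply b_minus_neq_0.
Qed.

(** Outside the cone [k * (1 - |z|^2) < 2 * |b - z| <= 4]. *)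
Lemma outside_cone_near_boundary (b z : C) (k : R) : Cmod b = 1 -> disk z -> 0 < k ->
  ~ cone k (to_hplane b z) -> 1 - Cmod z <= 4 / k.
Proof.
  intros Hb Hz Hk H.
  assert (Hw := to_hplane_hplane b Hb z Hz). unfold hplane in Hw.
  assert (L : k * Re (to_hplane b z) < 2 / Cmod (b - z)%C).
  { rewrite <- Cmod_to_hplane_succ by auto. apply Rnot_le_lt. intros L. apply H. now split. }
  assert (E := to_hplane_re b z Hb Hz). assert (B := Cmod_b_minus b z Hb Hz).
  unfold disk in Hz. set (d := Cmod (b - z)%C) in *. assert (Pd : 0 < d) by lra.
  apply Rlt_div_r in L; auto.
  apply Rle_div_r; auto. assert (P := Cmod_ge_0 z).
  assert (k * (1 - Cmod z * Cmod z) <= 4).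
  { rewrite <- E. replace (k * (Re (to_hplane b z) * (d * d))) with (k * Re (to_hplane b z) * d * d) by ring. nra. }
  nra.
Qed.

(* [F] is a multiple of a monomial of high degree: small in norm, but large near
   the boundary, hence outside [cone k] for large [k]. *)
Lemma outside_cone_small (p : Rbar) (alpha A eps : R) (b : C) : exponent p -> 0 < alpha ->
  Cmod b = 1 -> 0 <= A -> 0 < eps -> exists F k0, Hspace p alpha F /\ Hbound p alpha F eps /\
    2 <= k0 /\ forall k z, k0 <= k -> disk z -> ~ cone k (to_hplane b z) -> A <= Cmod (F z).
Proof.
  intros Hp Ha Hb HA He.
  destruct (monomial_small p alpha (2 * A) eps Hp Ha ltac:(lra) He) as [n Hn].
  assert (Pn := pos_INR n).
  (* For [k] above this threshold [n * (1 - |z|) <= 4 * n / k <= 1/2], so [|z|^n >= 1/2] by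
     Bernoulli's inequality; the coefficient [2 * A] makes up for the half. *)
  exists (fun z => RtoC (2 * A) * z ^ n)%C, (8 * INR n + 4).
  split; [|split; [|split]].
  - apply Hspace_bound. split; [apply analytic_monomial| eauto].
  - exact Hn.
  - lra.
  - intros k z Hk Hz Hc.
    assert (B := outside_cone_near_boundary b z k Hb Hz ltac:(lra) Hc).
    assert (P := Cmod_ge_0 z). unfold disk in Hz.
    rewrite Cmod_mult, Cmod_pow, Cmod_R, Rabs_pos_eq by lra.
    assert (Q := pow_ge_linear (1 - Cmod z) n ltac:(lra)).
    replace (1 - (1 - Cmod z)) with (Cmod z) in Q by ring.
    apply Rle_div_r in B; [|lra].
    assert (INR n * (1 - Cmod z) <= 1 / 2) by nra. nra.
Qed.

Section Criterion.

Variables (p : Rbar) (alpha : R) (phi : R -> C -> C) (b : C) (M : R).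
Hypothesis Hp : exponent p.
Hypothesis Ha : 0 < alpha.
Hypothesis Hb : Cmod b = 1.
Hypothesis sg : analytic_semigroup phi.
Hypothesis dw : Denjoy_Wolff_point phi b.
Hypothesis dphi_analytic : forall t, 0 <= t -> analytic (C_derive (phi t)).
Hypothesis HM : forall t, 0 <= t <= 1 ->
  op_norm_le (Hspace p alpha) (Hnorm p alpha) (Top phi t) M.

Let W := to_hplane b.

Lemma M_ge_0 : 0 <= M.
Proof. destruct (HM 0 ltac:(lra)) as [H _]. exact H. Qed.

Lemma Top_ccont (t : R) (f : C -> C) (z : C) : 0 <= t -> analytic f -> disk z ->
  ccont (Top phi t f) z.
Proof.
  intros Ht Hf Hz. apply ccont_mult.
  - now apply analytic_ccont; [apply dphi_analytic|].
  - apply (ccont_comp f (phi t)).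
    + apply analytic_ccont; auto. now apply (semigroup_analytic _ sg).
    + apply analytic_ccont; auto. now apply (semigroup_self_map _ sg).
Qed.

Lemma sum_mod_Top (l : list (C -> C)) (t : R) (z : C) :
  sum_mod (map (Top phi t) l) z = Cmod (C_derive (phi t) z) * sum_mod l (phi t z).
Proof.
  induction l as [|f l IH]; simpl; [ring|].
  rewrite IH. unfold Top. rewrite Cmod_mult. ring.
Qed.

Lemma sum_mod_app (l l' : list (C -> C)) (z : C) :
  sum_mod (l ++ l') z = sum_mod l z + sum_mod l' z.
Proof. induction l as [|f l IH]; simpl; [ring| rewrite IH; ring]. Qed.

(** The number [n] of majorants is fixed before [eps], because the constant of the quasi-triangle
    inequality depends on it. In [cone (2 * k)] the function [h] does the work. Elsewhere
    [no_fast_entry] keeps both [z] and [phi_t z] outside [cone k], so the majorization applies at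
    both points and [T_t] carries the second one back to [z]. *)
Lemma continuity_criterion (f : C -> C) (n : nat) :
  Hspace p alpha f ->
  (forall eps, 0 < eps -> exists k l, 2 <= k /\ length l = n /\
     (forall F, In F l -> Hspace p alpha F /\ Hbound p alpha F eps) /\
     forall z, disk z -> ~ cone k (W z) -> Cmod (f z) <= sum_mod l z) ->
  (forall k eps, 1 <= k -> 0 < eps -> exists d, 0 < d /\ forall t, 0 <= t < d ->
     exists h, (forall z, disk z -> ccont h z) /\ Hbound p alpha h eps /\
       forall z, disk z -> cone k (W z) -> Cmod (Top phi t f z - f z)%C <= Cmod (h z)) ->
  continuity_space phi (Hspace p alpha) (Hnorm p alpha) f.
Proof.
  intros Hf Hout Hin. split; auto. intros eps.
  assert (PM := M_ge_0). assert (Pe := cond_pos eps).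
  (* There are [2 n + 1] majorants: [h], the [n] functions of [l] and their images under [T_t]. *)
  set (c := 8 ^ (2 * n + 1)). assert (Pc : 0 < c) by (apply pow_lt; lra).
  set (e := eps / (2 * c * (M + 1))).
  assert (He : 0 < e).
  { apply Rdiv_lt_0_compat; auto. repeat apply Rmult_lt_0_compat; lra. }
  destruct (Hout e He) as [k [l [Hk [Hl [HF Hdom]]]]].
  destruct (no_fast_entry b Hb phi sg dphi_analytic dw k Hk) as [d1 [Hd1 D1]].
  destruct (Hin (2 * k) e) as [d2 [Hd2 D2]]; [lra| auto|].
  apply at_right_intro with (Rmin 1 (Rmin d1 d2)).
  { repeat apply Rmin_glb_lt; lra. }
  intros t [Ht0 Ht].
  assert (T1 := Rlt_le_trans _ _ _ Ht (Rmin_l _ _)).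
  assert (T := Rlt_le_trans _ _ _ Ht (Rmin_r _ _)).
  assert (T2 := Rlt_le_trans _ _ _ T (Rmin_l _ _)).
  assert (T3 := Rlt_le_trans _ _ _ T (Rmin_r _ _)).
  destruct (D2 t ltac:(lra)) as [h [Hh1 [Hh2 Hh3]]].
  assert (Hfa := proj1 Hf).
  set (B := (M + 1) * e).
  assert (HB : Hbound p alpha (fun z => Top phi t f z - f z)%C (c * B)).
  { unfold c. replace (2 * n + 1)%nat with (length (h :: map (Top phi t) l ++ l)).
    2:{ simpl. rewrite length_app, length_map, Hl. lia. }
    apply Hbound_list; auto.
    - unfold B; nra.
    - intros z Hz. apply ccont_minus; [now apply Top_ccont; try lra| now apply analytic_ccont].
    - assert (Mono : forall F B', Hbound p alpha F B' -> B' <= B -> Hbound p alpha F B).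
      { intros F B' H1 H2 r Hr. specialize (H1 r Hr). lra. }
      intros F [<-|HinF].
      + split; auto. apply (Mono _ e); auto. unfold B; nra.
      + apply in_app_or in HinF. destruct HinF as [HinF|HinF].
        * apply in_map_iff in HinF. destruct HinF as [F' [<- HF']].
          destruct (HF F' HF') as [A1 A2]. split.
          -- intros z Hz. apply Top_ccont; auto; [lra| apply A1].
          -- apply (Mono _ (M * e)); [|unfold B; nra].
             eapply op_norm_bound; eauto. apply HM. lra.
        * destruct (HF F HinF) as [A1 A2]. split.
          -- intros z Hz. apply analytic_ccont; auto. apply A1.
          -- apply (Mono _ e); auto. unfold B; nra.
    - intros z Hz. simpl. rewrite sum_mod_app, sum_mod_Top.
      assert (Hw := to_hplane_hplane b Hb z Hz).
      assert (Hpz := semigroup_self_map _ sg t z ltac:(lra) Hz).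
      assert (S1 := sum_mod_ge_0 l z). assert (S2 := sum_mod_ge_0 l (phi t z)).
      assert (Pd := Cmod_ge_0 (C_derive (phi t) z)). assert (Ph := Cmod_ge_0 (h z)).
      destruct (Classical_Prop.classic (cone (2 * k) (W z))) as [Hc|Hc].
      + assert (K := Hh3 z Hz Hc). nra.
      + assert (N1 : ~ cone k (W z)).
        { intros [C1 C2]. apply Hc. split; auto. nra. }
        assert (N2 : ~ cone k (W (phi t z))).
        { intros C1. apply Hc. apply (D1 t (W z) ltac:(lra) Hw).
          unfold psi, W. now rewrite to_disk_hplane. }
        assert (K1 := Hdom z Hz N1). assert (K2 := Hdom _ Hpz N2).
        assert (Tr := Cmod_triangle (Top phi t f z) (- f z)%C). rewrite Cmod_opp in Tr.
        change (Top phi t f z - f z)%C with (Top phi t f z + - f z)%C.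
        unfold Top in Tr at 2. rewrite Cmod_mult in Tr. nra. }
  apply Hnorm_le_iff in HB. eapply Rbar_le_lt_trans; [exact HB|]. simpl.
  unfold B, e. replace (c * ((M + 1) * (eps / (2 * c * (M + 1))))) with (eps / 2) by (field; lra). lra.
Qed.

(** A relative error in the half plane becomes an absolute one in the disk: points [v], [w] have
    preimages at distance [2 |v - w| / (|v + 1| |w + 1|)], where the denominator is at least
    [Re w]. *)
Lemma phi_close_on_cone (k eta : R) : 1 <= k -> 0 < eta ->
  exists d, 0 < d /\ forall t z, 0 <= t < d -> disk z -> cone k (W z) ->
    Cmod (phi t z - z)%C <= eta /\ Cmod (C_derive (phi t) z - 1)%C <= eta.
Proof.
  intros Hk Heta.
  destruct (dphi_close_on_cone b Hb phi sg dphi_analytic dw k (eta / 2) Hk ltac:(lra)) as [d [Hd D]].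
  exists d; split; auto. intros t z Ht Hz Hc. destruct (D t z Ht Hz Hc) as [B1 B2].
  split; [|lra].
  assert (Hw := to_hplane_hplane b Hb z Hz).
  assert (Hpz := semigroup_self_map _ sg t z (proj1 Ht) Hz).
  assert (Hpw := to_hplane_hplane b Hb _ Hpz).
  unfold psi in B1. rewrite to_disk_hplane in B1 by auto.
  rewrite <- (to_disk_hplane b Hb z Hz) at 2. rewrite <- (to_disk_hplane b Hb _ Hpz).
  set (w := to_hplane b z) in *. set (v := to_hplane b (phi t z)) in *.
  assert (N1 := hplane_succ_neq_0 w Hw). assert (N2 := hplane_succ_neq_0 v Hpw).
  replace (to_disk b v - to_disk b w)%C with (2 * b * (v - w) / ((v + 1) * (w + 1)))%C
    by (unfold to_disk; field; auto).
  rewrite Cmod_div, !Cmod_mult, Hb, Cmod_R, Rabs_pos_eq by (try lra; now apply Cmult_neq_0).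
  assert (R1 := re_le_Cmod (w + 1)%C). assert (R2 := re_le_Cmod (v + 1)%C).
  apply Rabs_le_between in R1. apply Rabs_le_between in R2.
  replace (Re (w + 1)%C) with (Re w + 1) in R1 by reflexivity.
  replace (Re (v + 1)%C) with (Re v + 1) in R2 by reflexivity.
  unfold hplane in Hw, Hpw.
  assert (Pw := Cmod_neq_0 _ N1). assert (Pv := Cmod_neq_0 _ N2).
  apply Rle_div_l; [now apply Rmult_lt_0_compat|].
  assert (Re w <= Cmod (v + 1)%C * Cmod (w + 1)%C) by nra. nra.
Qed.

End Criterion.

(** * The little space *)

(** Radial retraction onto the closed disk of radius [r]. Composition with it extends a function
    continuously to the plane, where uniform continuity on a square is available. *)
Definition retract (r : R) (z : C) : C := (r / RtoC (Rmax r (Cmod z)) * z)%C.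

Lemma Rmax_r_pos (r x : R) : 0 < r -> 0 < Rmax r x.
Proof. intros H. eapply Rlt_le_trans; [exact H| apply Rmax_l]. Qed.

Lemma Cmod_retract (r : R) (z : C) : 0 < r -> Cmod (retract r z) <= r.
Proof.
  intros Hr. assert (P := Rmax_r_pos r (Cmod z) Hr). unfold retract.
  rewrite Cmod_mult, Cmod_div, !Cmod_R, !Rabs_pos_eq by
    (first [lra | intros E; apply RtoC_inj in E; lra]).
  assert (Q := Rmax_r r (Cmod z)). assert (0 < r / Rmax r (Cmod z)) by now apply Rdiv_lt_0_compat.
  apply Rle_trans with (r / Rmax r (Cmod z) * Rmax r (Cmod z)).
  - apply Rmult_le_compat_l; lra.
  - right; field; lra.
Qed.

Lemma retract_id (r : R) (z : C) : 0 < r -> Cmod z <= r -> retract r z = z.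
Proof.
  intros Hr Hz. unfold retract. rewrite Rmax_left by auto. field.
  intros E; apply RtoC_inj in E; lra.
Qed.

Lemma retract_ccont (r : R) (z : C) : 0 < r -> ccont (retract r) z.
Proof.
  intros Hr. unfold retract. ccont_tac.
  - intros eps He. exists eps; split; auto. intros y Hy.
    rewrite <- RtoC_minus, Cmod_R.
    assert (T1 := Cmod_triangle_inv y z). assert (T2 := Cmod_triangle_inv z y).
    rewrite (Cmod_minus_sym z y) in T2.
    apply Rabs_def1; unfold Rmax; repeat destruct Rle_dec; lra.
  - intros E; apply RtoC_inj in E. assert (P := Rmax_r_pos r (Cmod z) Hr). lra.
Qed.

Lemma uniformly_continuous_disk (f : C -> C) (r eps : R) :
  (forall z, disk z -> ccont f z) -> 0 < r < 1 -> 0 < eps ->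
  exists d, 0 < d /\ forall z z', Cmod z <= r -> Cmod z' <= r ->
    Cmod (z' - z)%C < d -> Cmod (f z' - f z)%C < eps.
Proof.
  intros Hf Hr He. set (g := fun z => f (retract r z)).
  assert (Hg : forall u v, continuity_2d_pt (fun u v => Re (g (u, v))) u v /\
    continuity_2d_pt (fun u v => Im (g (u, v))) u v).
  { intros u v. apply (ccont_2d g (fun u _ => u) (fun _ v => v)).
    - apply (ccont_comp f (retract r)); [now apply retract_ccont|].
      apply Hf. unfold disk. assert (K := Cmod_retract r (u, v) (proj1 Hr)). lra.
    - apply continuity_2d_pt_id1.
    - apply continuity_2d_pt_id2. }
  assert (He2 : 0 < eps / 2) by lra.
  destruct (uniform_continuity_2d (fun u v => Re (g (u, v))) (-1) 1 (-1) 1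
    (fun u v _ _ => proj1 (Hg u v)) (mkposreal _ He2)) as [d1 D1].
  destruct (uniform_continuity_2d (fun u v => Im (g (u, v))) (-1) 1 (-1) 1
    (fun u v _ _ => proj2 (Hg u v)) (mkposreal _ He2)) as [d2 D2].
  exists (Rmin d1 d2). split; [apply Rmin_glb_lt; apply cond_pos|].
  intros [x y] [x' y'] Hz Hz' H.
  assert (H1 := Rlt_le_trans _ _ _ H (Rmin_l _ _)).
  assert (H2 := Rlt_le_trans _ _ _ H (Rmin_r _ _)).
  assert (A1 := re_le_Cmod (x, y)). assert (A2 := im_le_Cmod (x, y)).
  assert (A3 := re_le_Cmod (x', y')). assert (A4 := im_le_Cmod (x', y')).
  assert (A5 := re_le_Cmod ((x', y') - (x, y))%C). assert (A6 := im_le_Cmod ((x', y') - (x, y))%C).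
  rewrite Re_minus in A5. rewrite Im_minus in A6. simpl in A1, A2, A3, A4, A5, A6.
  assert (B1 : -1 <= x <= 1) by (apply Rabs_le_between; lra).
  assert (B2 : -1 <= y <= 1) by (apply Rabs_le_between; lra).
  assert (B3 : -1 <= x' <= 1) by (apply Rabs_le_between; lra).
  assert (B4 : -1 <= y' <= 1) by (apply Rabs_le_between; lra).
  specialize (D1 x y x' y' B1 B2 B3 B4 ltac:(lra) ltac:(lra)).
  specialize (D2 x y x' y' B1 B2 B3 B4 ltac:(lra) ltac:(lra)).
  simpl in D1, D2. unfold g in D1, D2. rewrite !retract_id in D1, D2 by lra.
  eapply Rle_lt_trans; [apply Cmod_le_Rabs|]. rewrite Re_minus, Im_minus. lra.
Qed.

(** The segment from 0 to [z] is cut into [n] steps shorter than [d], and on each of them [|f|]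
    grows by less than 1. *)
Lemma bounded_on_disk (f : C -> C) (r : R) :
  (forall z, disk z -> ccont f z) -> 0 < r < 1 ->
  exists K, 0 <= K /\ forall z, Cmod z <= r -> Cmod (f z) <= K.
Proof.
  intros Hf Hr.
  destruct (uniformly_continuous_disk f r 1 Hf Hr Rlt_0_1) as [d [Hd D]].
  destruct (nfloor_ex (/ d)) as [N [_ HN]]. { left; now apply Rinv_0_lt_compat. }
  set (n := S N). assert (Hn : / d < INR n) by (unfold n; rewrite S_INR; exact HN).
  assert (Pd : 0 < / d) by now apply Rinv_0_lt_compat.
  assert (Pf := Cmod_ge_0 (f 0%C)).
  exists (Cmod (f 0%C) + INR n). split; [lra|]. intros z Hz.
  assert (K : forall j, (j <= n)%nat -> Cmod (f (RtoC (INR j / INR n) * z)%C) <= Cmod (f 0%C) + INR j).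
  { induction j as [|j IH]; intros Hj.
    - change (INR 0) with 0. replace (RtoC (0 / INR n) * z)%C with (RtoC 0).
      + lra.
      + replace (0 / INR n) with 0 by (field; lra). ring.
    - assert (IH' := IH ltac:(lia)). clear IH.
      assert (Bd : forall i, (i <= n)%nat -> Cmod (RtoC (INR i / INR n) * z)%C <= r).
      { intros i Hi. assert (Ii := pos_INR i). apply le_INR in Hi.
        assert (0 <= INR i / INR n <= 1).
        { split; [apply Rdiv_le_0_compat; lra| apply Rle_div_l; lra]. }
        rewrite Cmod_mult, Cmod_R, Rabs_pos_eq by lra. assert (Cz := Cmod_ge_0 z). nra. }
      assert (St : Cmod (RtoC (INR (S j) / INR n) * z - RtoC (INR j / INR n) * z)%C < d).
      { replace (RtoC (INR (S j) / INR n) * z - RtoC (INR j / INR n) * z)%C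
          with (RtoC (/ INR n) * z)%C.
        - assert (0 < / INR n) by (apply Rinv_0_lt_compat; lra).
          rewrite Cmod_mult, Cmod_R, Rabs_pos_eq by lra. assert (Cz := Cmod_ge_0 z).
          assert (/ INR n < d).
          { rewrite <- (Rinv_inv d). apply Rinv_lt_contravar; auto.
            apply Rmult_lt_0_compat; lra. }
          nra.
        - replace (/ INR n) with (INR (S j) / INR n - INR j / INR n) by (rewrite S_INR; field; lra).
          rewrite RtoC_minus. ring. }
      assert (Df := D _ _ (Bd j ltac:(lia)) (Bd (S j) Hj) St).
      assert (T := Cmod_triangle_inv (f (RtoC (INR (S j) / INR n) * z)%C) (f (RtoC (INR j / INR n) * z)%C)).
      rewrite S_INR at 2. lra. }
  specialize (K n (le_n n)). replace (INR n / INR n) with 1 in K by (field; lra).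
  rewrite Cmult_1_l in K. exact K.
Qed.

Definition dilate (rho : R) (f : C -> C) (z : C) : C := f (rho * z)%C.

Lemma dilate_disk (rho : R) (z : C) : 0 < rho < 1 -> disk z -> Cmod (rho * z)%C <= rho.
Proof.
  intros Hr Hz. unfold disk in Hz. rewrite Cmod_mult, Cmod_R, Rabs_pos_eq by lra.
  assert (P := Cmod_ge_0 z). nra.
Qed.

Lemma analytic_dilate (rho : R) (f : C -> C) : 0 < rho < 1 -> analytic f -> analytic (dilate rho f).
Proof.
  intros Hr Hf. apply (cderiv_analytic _ (fun z => C_derive f (rho * z)%C * (rho * 1))%C).
  intros z Hz. apply (cderiv_comp f (fun z => rho * z)%C).
  - apply cderiv_scal, cderiv_id.
  - apply analytic_cderiv; auto. unfold disk. assert (K := dilate_disk rho z Hr Hz). lra.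
Qed.

Lemma Mp_dilate (p : Rbar) (r rho : R) (f : C -> C) : Mp p r (dilate rho f) = Mp p (rho * r) f.
Proof.
  assert (E : forall t, (rho * circle_pt r t)%C = circle_pt (rho * r) t).
  { intros t. unfold circle_pt, RtoC, Cmult; simpl; f_equal; ring. }
  unfold Mp, dilate. destruct p as [q| |]; auto.
  - f_equal. f_equal. apply RInt_ext. intros t _. now rewrite E.
  - f_equal. apply Lub_Rbar_eqset. intros y. split; intros [t ->]; exists t; now rewrite E.
Qed.

(** Up to the radius [1 - e] uniform continuity applies. Beyond it both functions have small
    weighted means: the mean of the dilate at [r] is that of [f] at [rho * r], with the larger
    weight [(1 - rho * r)^alpha]. *)
Lemma dilate_approx (p : Rbar) (alpha eps : R) (f : C -> C) : exponent p -> 0 < alpha ->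
  Hspace0 p alpha f -> 0 < eps ->
  exists rho, 0 < rho < 1 /\ Hbound p alpha (fun z => f z - dilate rho f z)%C eps.
Proof.
  intros Hp Ha [[Hf _] H0] He.
  assert (Hcf : forall z, disk z -> ccont f z) by (intros; now apply analytic_ccont).
  (* Two terms of size [eps / 8] and the constant 4 of [Mp_quasi] add up to [eps]. *)
  destruct (H0 (fun y => y < eps / 8)) as [d D].
  { exists (mkposreal (eps / 8) ltac:(lra)). intros y Hy.
    unfold ball in Hy; simpl in Hy; unfold AbsRing_ball, abs, minus, plus, opp in Hy; simpl in Hy.
    apply Rabs_def2 in Hy. lra. }
  assert (D' : forall r, 1 - d < r < 1 -> Rpower (1 - r) alpha * Mp p r f < eps / 8).
  { intros r Hr. apply D; [|lra].
    unfold ball; simpl; unfold AbsRing_ball, abs, minus, plus, opp; simpl.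
    apply Rabs_def1; lra. }
  clear D H0. assert (Pd := cond_pos d).
  (* If neither [r] nor [rho] is below [1 - e], the product [rho * r] still exceeds [1 - d]. *)
  set (e := Rmin (d / 4) (1 / 4)).
  assert (He0 : 0 < e) by (apply Rmin_glb_lt; lra).
  assert (He1 : e <= d / 4) by apply Rmin_l. assert (He2 : e <= 1 / 4) by apply Rmin_r.
  destruct (uniformly_continuous_disk f (1 - e) eps Hcf ltac:(lra) He) as [s [Hs S]].
  set (rho := 1 - Rmin e (s / 2)).
  assert (R1 : Rmin e (s / 2) <= e) by apply Rmin_l.
  assert (R2 : Rmin e (s / 2) <= s / 2) by apply Rmin_r.
  assert (R3 : 0 < Rmin e (s / 2)) by (apply Rmin_glb_lt; lra).
  exists rho. assert (Hrho : 0 < rho < 1) by (unfold rho; lra). split; auto.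
  assert (Hd := analytic_dilate rho f Hrho Hf).
  intros r Hr.
  assert (C0 := analytic_circ_cont r _ Hr (analytic_minus _ _ Hf Hd)). cbv beta in C0.
  assert (C1 := analytic_circ_cont r _ Hr Hf).
  assert (C2 := analytic_circ_cont r _ Hr Hd).
  assert (P := Rpower_pos (1 - r) alpha).
  destruct (Rle_dec r (1 - e)) as [L|L].
  - assert (K : Mp p r (fun z => f z - dilate rho f z)%C <= eps).
    { apply Mp_le_bound; auto; [lra|]. intros t. left. rewrite Cmod_minus_sym.
      assert (Cz := Cmod_circle_pt r t (proj1 Hr)).
      apply S.
      - lra.
      - rewrite Cmod_mult, Cmod_R, Rabs_pos_eq by lra. nra.
      - replace (rho * circle_pt r t - circle_pt r t)%C with (RtoC (rho - 1) * circle_pt r t)%C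
          by (rewrite RtoC_minus; ring).
        rewrite Cmod_mult, Cmod_R, Rabs_left, Cz by lra. unfold rho. nra. }
    assert (N := Mp_ge_0 p r Hp _ C0).
    assert (R4 := Rpower_le_1 (1 - r) alpha ltac:(lra) Ha). nra.
  - assert (Q := Mp_quasi p r Hp _ f (dilate rho f) C0 C1 C2).
    assert (K1 := D' r ltac:(lra)).
    assert (Hrr : 1 - d < rho * r < 1) by (unfold rho; nra).
    assert (K2 := D' (rho * r) Hrr). rewrite Mp_dilate in Q.
    assert (N2 : 0 <= Mp p (rho * r) f).
    { apply Mp_ge_0; auto. apply analytic_circ_cont; auto. nra. }
    assert (K3 : Rpower (1 - r) alpha <= Rpower (1 - rho * r) alpha).
    { apply Rle_Rpower_l; [lra|]. nra. }
    assert (K4 : Rpower (1 - r) alpha * Mp p (rho * r) f <= eps / 8) by nra.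
    assert (Q' := Q ltac:(intros t; rewrite <- (Cmod_opp (dilate rho f (circle_pt r t))); apply Cmod_triangle)).
    apply Rle_trans with (Rpower (1 - r) alpha * (4 * (Mp p r f + Mp p (rho * r) f))).
    + apply Rmult_le_compat_l; lra.
    + lra.
Qed.

Section LittleSpace.

Variables (p : Rbar) (alpha : R) (phi : R -> C -> C) (b : C) (M : R).
Hypothesis Hp : exponent p.
Hypothesis Ha : 0 < alpha.
Hypothesis Hb : Cmod b = 1.
Hypothesis sg : analytic_semigroup phi.
Hypothesis dw : Denjoy_Wolff_point phi b.
Hypothesis dphi_analytic : forall t, 0 <= t -> analytic (C_derive (phi t)).
Hypothesis HM : forall t, 0 <= t <= 1 ->
  op_norm_le (Hspace p alpha) (Hnorm p alpha) (Top phi t) M.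

(** A dilate is bounded and uniformly continuous on the disk: outside a cone one monomial majorizes
    it, and on cones a small constant serves as [h]. *)
Lemma dilate_continuity (f : C -> C) (rho : R) : analytic f -> 0 < rho < 1 ->
  continuity_space phi (Hspace p alpha) (Hnorm p alpha) (dilate rho f).
Proof.
  intros Hf Hr.
  assert (Hcf : forall z, disk z -> ccont f z) by (intros; now apply analytic_ccont).
  destruct (bounded_on_disk f rho Hcf Hr) as [K [HK Kf]].
  assert (Kd : forall z, disk z -> Cmod (dilate rho f z) <= K).
  { intros z Hz. apply Kf. now apply dilate_disk. }
  assert (Hda := analytic_dilate rho f Hr Hf).
  apply (continuity_criterion p alpha phi b M Hp Hb sg dw dphi_analytic HM _ 1).
  - apply Hspace_bound; split; auto. exists K. apply Hbound_bounded; auto.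
    intros z Hz. now apply analytic_ccont.
  - intros eps He.
    destruct (outside_cone_small p alpha K eps b Hp Ha Hb HK He) as [F [k0 [F1 [F2 [Hk0 F3]]]]].
    exists k0, (F :: nil). repeat split; auto.
    + destruct H as [<-|[]]; apply F1.
    + destruct H as [<-|[]]; apply F1.
    + destruct H as [<-|[]]; apply F2.
    + intros z Hz Hc. simpl. rewrite Rplus_0_r.
      eapply Rle_trans; [now apply Kd|]. apply (F3 k0); auto. lra.
  - intros k eps Hk He.
    set (e := eps / (2 + K)). assert (He1 : 0 < e) by (apply Rdiv_lt_0_compat; lra).
    assert (Ee : e * (2 + K) = eps) by (unfold e; field; lra).
    destruct (uniformly_continuous_disk f rho e Hcf Hr He1) as [s [Hs S]].
    set (eta := Rmin 1 (Rmin e (s / 2))).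
    assert (E0 : 0 < eta) by (repeat apply Rmin_glb_lt; lra).
    assert (E1 : eta <= 1) by (unfold eta; eapply Rle_trans; [apply Rmin_l| lra]).
    assert (E2 : eta <= e) by (unfold eta; eapply Rle_trans; [apply Rmin_r| apply Rmin_l]).
    assert (E3 : eta <= s / 2) by (unfold eta; eapply Rle_trans; [apply Rmin_r| apply Rmin_r]).
    destruct (phi_close_on_cone phi b Hb sg dw dphi_analytic k eta Hk E0) as [d [Hd D]].
    exists d; split; auto. intros t Ht. exists (fun _ => RtoC eps). split; [|split].
    + intros; apply ccont_const.
    + apply Hbound_bounded; auto.
      * intros; apply ccont_const.
      * lra.
      * intros z Hz. rewrite Cmod_R, Rabs_pos_eq; lra.
    + intros z Hz Hc. rewrite Cmod_R, Rabs_pos_eq by lra.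
      destruct (D t z Ht Hz Hc) as [B1 B2].
      assert (Hpz := semigroup_self_map _ sg t z (proj1 Ht) Hz).
      unfold Top. set (u := C_derive (phi t) z) in *. set (v := phi t z) in *.
      replace (u * dilate rho f v - dilate rho f z)%C
        with ((u - 1) * dilate rho f v + (dilate rho f v - dilate rho f z))%C by ring.
      eapply Rle_trans; [apply Cmod_triangle|]. rewrite Cmod_mult.
      assert (Q : Cmod (dilate rho f v - dilate rho f z)%C < e).
      { apply S; try (now apply dilate_disk).
        replace (rho * v - rho * z)%C with (rho * (v - z))%C by ring.
        rewrite Cmod_mult, Cmod_R, Rabs_pos_eq by lra. assert (Pz := Cmod_ge_0 (v - z)%C). nra. }
      assert (Q2 := Kd v Hpz). assert (P1 := Cmod_ge_0 (u - 1)%C).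
      assert (P2 := Cmod_ge_0 (dilate rho f v)).
      assert (Cmod (u - 1)%C * Cmod (dilate rho f v) <= e * K) by (apply Rmult_le_compat; lra).
      nra.
Qed.

(** With [g = f - dilate rho f] small in norm, the difference [T_t f - f] splits into [T_t g], the
    same difference for the dilate, and [- g]; the bound on [T_t] handles the first term uniformly
    in [t]. *)
Lemma Hspace0_continuity (f : C -> C) : Hspace0 p alpha f ->
  continuity_space phi (Hspace p alpha) (Hnorm p alpha) f.
Proof.
  intros Hf. assert (Hfa := proj1 (proj1 Hf)). split; [apply Hf|]. intros eps.
  assert (PM := M_ge_0 p alpha phi M HM). assert (Pe := cond_pos eps).
  set (e := eps / (8 ^ 3 * 2 * (M + 1))).
  assert (He : 0 < e) by (apply Rdiv_lt_0_compat; [auto| nra]).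
  destruct (dilate_approx p alpha e f Hp Ha Hf He) as [rho [Hrho A]].
  assert (Hda := analytic_dilate rho f Hrho Hfa).
  assert (Hg := analytic_minus _ _ Hfa Hda).
  set (g := fun z => (f z - dilate rho f z)%C) in *.
  assert (Hgs : Hspace p alpha g) by (apply Hspace_bound; eauto).
  destruct (dilate_continuity f rho Hfa Hrho) as [_ Hc].
  destruct (at_right_elim _ (Hc (mkposreal e He))) as [d [Hd D]]. simpl in D.
  apply at_right_intro with (Rmin 1 d); [apply Rmin_glb_lt; lra|].
  intros t [Ht0 Ht].
  assert (T1 := Rlt_le_trans _ _ _ Ht (Rmin_l _ _)).
  assert (T2 := Rlt_le_trans _ _ _ Ht (Rmin_r _ _)).
  specialize (D t (conj Ht0 T2)).
  assert (Dn : Hbound p alpha (fun z => Top phi t (dilate rho f) z - dilate rho f z)%C e).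
  { apply Hnorm_le_iff. now apply Rbar_lt_le. }
  destruct (op_norm_bound p alpha (Top phi t) M e g (HM t ltac:(lra)) Hgs A) as [Tg1 Tg2].
  assert (Cont : forall h, analytic h -> forall z, disk z -> ccont h z)
    by (intros; now apply analytic_ccont).
  assert (TC : forall h, analytic h -> forall z, disk z -> ccont (Top phi t h) z).
  { intros h Hh z Hz. apply Top_ccont; auto. lra. }
  set (B := (M + 1) * e).
  assert (Mono : forall F B', Hbound p alpha F B' -> B' <= B -> Hbound p alpha F B).
  { intros F B' H1 H2 r Hr. specialize (H1 r Hr). lra. }
  assert (HB : Hbound p alpha (fun z => Top phi t f z - f z)%C (8 ^ 3 * B)).
  { apply (Hbound_list p alpha (Top phi t g ::
      (fun z => Top phi t (dilate rho f) z - dilate rho f z)%C :: g :: nil)); auto.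
    - unfold B; nra.
    - intros z Hz. apply ccont_minus; [apply TC| apply Cont]; auto.
    - intros F [<-|[<-|[<-|[]]]]; split.
      + now apply Cont, Tg1.
      + apply (Mono _ (M * e)); auto. unfold B; nra.
      + intros z Hz. apply ccont_minus; [apply TC| apply Cont]; auto.
      + apply (Mono _ e); auto. unfold B; nra.
      + now apply Cont.
      + apply (Mono _ e); auto. unfold B; nra.
    - intros z Hz. simpl. rewrite Rplus_0_r.
      replace (Top phi t f z - f z)%C with
        (Top phi t g z + ((Top phi t (dilate rho f) z - dilate rho f z) + - g z))%C
        by (unfold Top, g; ring).
      eapply Rle_trans; [apply Cmod_triangle|]. apply Rplus_le_compat_l.
      eapply Rle_trans; [apply Cmod_triangle|]. rewrite Cmod_opp. lra. }
  apply Hnorm_le_iff in HB. eapply Rbar_le_lt_trans; [exact HB|]. simpl.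
  unfold B, e.
  replace (8 * (8 * (8 * 1)) * ((M + 1) * (eps / (8 ^ 3 * 2 * (M + 1))))) with (eps / 2) by (field; lra).
  lra.
Qed.

End LittleSpace.

(** * Complex powers *)

(** Serves functions given by real formulas: derivatives along lines suffice once the candidate [D]
    is continuous, by the mean value theorem on the segment from [w] to [y]. *)
Lemma cderiv_of_lines (U : C -> Prop) (f D : C -> C) (w : C) :
  copen U -> U w -> ccont D w ->
  (forall h s, U (w + RtoC s * h)%C ->
     is_derive (fun s => Re (f (w + RtoC s * h)%C)) s (Re (D (w + RtoC s * h) * h)%C) /\
     is_derive (fun s => Im (f (w + RtoC s * h)%C)) s (Im (D (w + RtoC s * h) * h)%C)) ->
  cderiv f w (D w).
Proof.
  intros HU Hw HD H eps He.
  destruct (HU w Hw) as [d1 [Hd1 D1]]. destruct (HD eps He) as [d2 [Hd2 D2]].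
  exists (Rmin d1 d2). split; [now apply Rmin_glb_lt|]. intros y Hy.
  set (h := (y - w)%C) in *.
  assert (Hs : forall s, 0 <= s <= 1 -> Cmod (w + s * h - w)%C < Rmin d1 d2).
  { intros s Hs. replace (w + s * h - w)%C with (s * h)%C by ring.
    rewrite Cmod_mult, Cmod_R, Rabs_pos_eq by lra. assert (P := Cmod_ge_0 h). nra. }
  apply Cmod_le_of_dir. intros c Hc.
  assert (K : Re c * Re (f (w + 1%R * h)%C) - Im c * Im (f (w + 1%R * h)%C) - 1 * (Re (c * (D w * h))%C + eps * Cmod h)
    <= Re c * Re (f (w + 0%R * h)%C) - Im c * Im (f (w + 0%R * h)%C) - 0 * (Re (c * (D w * h))%C + eps * Cmod h)).
  { set (k := Re (c * (D w * h))%C + eps * Cmod h).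
    apply (derive_nonpos_le (fun s => Re c * Re (f (w + RtoC s * h)%C) - Im c * Im (f (w + RtoC s * h)%C) - s * k)
      (fun s => Re c * Re (D (w + RtoC s * h) * h)%C - Im c * Im (D (w + RtoC s * h) * h)%C - k)); [lra| |].
    - intros s Hs'. destruct (H h s) as [H1 H2].
      { apply D1. eapply Rlt_le_trans; [now apply Hs| apply Rmin_l]. }
      apply (is_derive_minus (V := R_NormedModule)).
      + apply (is_derive_minus (V := R_NormedModule));
          apply is_derive_scal; auto.
      + generalize k; intros a. auto_derive; auto; ring.
    - intros s Hs'. assert (B := D2 _ (Rlt_le_trans _ _ _ (Hs s Hs') (Rmin_r _ _))).
      set (v := D (w + s * h)%C) in *.
      assert (Q := Re_mult_le c ((v - D w) * h)%C Hc). rewrite Cmod_mult in Q.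
      replace (Re c * Re (v * h)%C - Im c * Im (v * h)%C) with (Re (c * ((v - D w) * h))%C + Re (c * (D w * h))%C).
      + assert (P := Cmod_ge_0 h). unfold k. nra.
      + replace (c * ((v - D w) * h))%C with (c * (v * h) - c * (D w * h))%C by ring.
        rewrite Re_minus. unfold Rminus. rewrite Rplus_assoc, Rplus_opp_l, Rplus_0_r. reflexivity. }
  replace (w + 1%R * h)%C with y in K by (unfold h; ring).
  replace (w + 0%R * h)%C with w in K by ring.
  replace (c * (f y - f w - D w * h))%C with (c * f y - c * f w - c * (D w * h))%C by ring.
  rewrite !Re_minus.
  change (Re (c * f y)%C) with (Re c * Re (f y) - Im c * Im (f y)).
  change (Re (c * f w)%C) with (Re c * Re (f w) - Im c * Im (f w)). lra.
Qed.

Definition Cexp (z : C) : C := circle_pt (exp (Re z)) (Im z).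

(** On the right half plane this is the principal logarithm, the argument there being an
    arctangent. *)
Definition Clog (w : C) : C :=
  (ln (Re w * Re w + Im w * Im w) / 2, atan (Im w / Re w)).

Definition cpow (a w : C) : C := Cexp (a * Clog w)%C.

Lemma Cmod_Cexp (z : C) : Cmod (Cexp z) = exp (Re z).
Proof. apply Cmod_circle_pt. left; apply exp_pos. Qed.

Lemma segment_pair (w h : C) (s : R) :
  (w + s * h)%C = (Re w + s * Re h, Im w + s * Im h) :> C.
Proof. destruct w, h; unfold Cplus, Cmult, RtoC, Re, Im; simpl; f_equal; ring. Qed.

Lemma ccont_Cexp (z : C) : ccont Cexp z.
Proof.
  assert (CR : forall (g : R -> R) x, continuity g -> forall eps, 0 < eps ->
    exists d, 0 < d /\ forall y, Rabs (y - x) < d -> Rabs (g y - g x) < eps).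
  { intros g x Hg eps He. destruct (proj1 (continuity_pt_locally _ _) (Hg x) (mkposreal eps He)) as [d D].
    exists d; split; [apply cond_pos|]. intros y Hy. now apply D. }
  assert (K : forall (g1 g2 : R -> R), continuity g1 -> continuity g2 ->
    ccont (fun z => RtoC (g1 (Re z) * g2 (Im z))) z).
  { intros g1 g2 C1 C2.
    assert (C3 : forall g, continuity g -> ccont (fun z => RtoC (g (Re z))) z).
    { intros g Cg eps He. destruct (CR g (Re z) Cg eps He) as [d [Hd D]]. exists d; split; auto.
      intros y Hy. rewrite <- RtoC_minus, Cmod_R. apply D.
      rewrite <- Re_minus. eapply Rle_lt_trans; [apply re_le_Cmod| auto]. }
    assert (C4 : forall g, continuity g -> ccont (fun z => RtoC (g (Im z))) z).
    { intros g Cg eps He. destruct (CR g (Im z) Cg eps He) as [d [Hd D]]. exists d; split; auto.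
      intros y Hy. rewrite <- RtoC_minus, Cmod_R. apply D.
      rewrite <- Im_minus. eapply Rle_lt_trans; [apply im_le_Cmod| auto]. }
    apply (ccont_ext_loc (fun z => RtoC (g1 (Re z)) * RtoC (g2 (Im z)))%C _ (fun _ => True)); auto.
    - intros y _. exists 1; split; [lra| auto].
    - intros y _. now rewrite RtoC_mult.
    - apply ccont_mult; auto. }
  apply (ccont_ext_loc (fun z => RtoC (exp (Re z) * cos (Im z)) + Ci * RtoC (exp (Re z) * sin (Im z)))%C
    _ (fun _ => True)); auto.
  - intros y _. exists 1; split; [lra| auto].
  - intros y _. unfold Cexp, circle_pt, Ci, Cplus, Cmult, RtoC; simpl; f_equal; ring.
  - assert (Ce : continuity exp) by (apply derivable_continuous, derivable_exp).
    apply ccont_plus; [|apply ccont_mult; [apply ccont_const|]]; apply K; auto.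
    + apply continuity_cos.
    + apply continuity_sin.
Qed.

Lemma cderiv_Cexp (z : C) : cderiv Cexp z (Cexp z).
Proof.
  apply (cderiv_of_lines (fun _ => True)); auto.
  - intros y _. exists 1; split; [lra| auto].
  - apply ccont_Cexp.
  - intros h s _. destruct z as [x y], h as [a b].
    split.
    + apply (is_derive_ext (fun s => exp (x + s * a) * cos (y + s * b))).
      { intros u. rewrite segment_pair. reflexivity. }
      rewrite segment_pair. unfold Cexp, circle_pt, Cmult, Re, Im; simpl. auto_derive; auto. ring.
    + apply (is_derive_ext (fun s => exp (x + s * a) * sin (y + s * b))).
      { intros u. rewrite segment_pair. reflexivity. }
      rewrite segment_pair. unfold Cexp, circle_pt, Cmult, Re, Im; simpl. auto_derive; auto. ring.
Qed.

Lemma cderiv_Clog (w : C) : hplane w -> cderiv Clog w (/ w).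
Proof.
  intros Hw. apply (cderiv_of_lines hplane Clog Cinv); auto.
  - apply open_hplane.
  - eapply cderiv_ccont, cderiv_inv. now apply hplane_neq_0.
  - intros h s. rewrite segment_pair. destruct w as [x y], h as [a b].
    intros Hx0. assert (Hx : 0 < x + s * a) by exact Hx0. clear Hx0.
    assert (Hn : 0 < (x + s * a) * (x + s * a) + (y + s * b) * (y + s * b)).
    { apply Rplus_lt_le_0_compat; [now apply Rmult_lt_0_compat| apply Rle_0_sqr]. }
    assert (Hn2 : x + s * a <> 0) by lra.
    split.
    + apply (is_derive_ext (fun s => ln ((x + s * a) * (x + s * a) + (y + s * b) * (y + s * b)) / 2)).
      { intros u. rewrite segment_pair. reflexivity. }
      unfold Cinv, Cmult, Re, Im; simpl. auto_derive; auto. field. nra.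
    + apply (is_derive_ext (fun s => atan ((y + s * b) / (x + s * a)))).
      { intros u. rewrite segment_pair. reflexivity. }
      unfold Cinv, Cmult, Re, Im; simpl. auto_derive; auto. unfold Rsqr. field.
      repeat split; auto; nra.
Qed.

Lemma cderiv_cpow (a w : C) : hplane w -> cderiv (cpow a) w (cpow a w * (a * / w)).
Proof.
  intros Hw. apply (cderiv_comp Cexp (fun w => a * Clog w)%C).
  - apply cderiv_scal. now apply cderiv_Clog.
  - apply cderiv_Cexp.
Qed.

Definition carg (w : C) : R := atan (Im w / Re w).

Lemma Cmod_cpow (a w : C) : hplane w ->
  Cmod (cpow a w) = Rpower (Cmod w) (Re a) * exp (- Im a * carg w).
Proof.
  intros Hw. unfold cpow. rewrite Cmod_Cexp. unfold Rpower. rewrite <- exp_plus. f_equal.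
  assert (P := Cmod_neq_0 w (hplane_neq_0 w Hw)).
  replace (ln (Cmod w)) with (ln (Re w * Re w + Im w * Im w) / 2).
  - unfold Clog, carg, Cmult, Re, Im; simpl. ring.
  - rewrite <- Cmod_sqr, ln_mult by auto. field.
Qed.

Lemma Cmod_cpow_real (g : R) (w : C) : hplane w -> Cmod (cpow g w) = Rpower (Cmod w) g.
Proof.
  intros Hw. rewrite Cmod_cpow by auto. simpl. rewrite Ropp_0, Rmult_0_l, exp_0. ring.
Qed.

Lemma cos_carg (w : C) : hplane w -> cos (carg w) = Re w / Cmod w.
Proof.
  intros Hw. assert (P := Cmod_neq_0 w (hplane_neq_0 w Hw)). unfold hplane in Hw.
  unfold carg. rewrite cos_atan.
  replace (1 + (Im w / Re w)²) with ((Cmod w / Re w) * (Cmod w / Re w)).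
  - rewrite sqrt_square; [field; lra|]. left; now apply Rdiv_lt_0_compat.
  - replace (Cmod w / Re w * (Cmod w / Re w)) with (Cmod w * Cmod w / (Re w * Re w)) by (field; lra).
    rewrite Cmod_sqr. unfold Rsqr. field. lra.
Qed.

Lemma carg_bounds (w : C) : - (PI / 2) < carg w < PI / 2.
Proof. assert (B := atan_bound (Im w / Re w)). unfold carg. lra. Qed.

(** [Re w / |w|] is the cosine of the argument, hence the sine of its distance to either of [pi / 2]
    and [- pi / 2]. *)
Lemma carg_gap_lower (w : C) : hplane w ->
  Re w / Cmod w <= PI / 2 - carg w /\ Re w / Cmod w <= PI / 2 + carg w.
Proof.
  intros Hw. rewrite <- cos_carg by auto. assert (B := carg_bounds w). split.
  - rewrite <- sin_shift. left. apply sin_lt_x. lra.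
  - rewrite <- cos_neg, <- sin_shift. replace (PI / 2 - - carg w) with (PI / 2 + carg w) by ring.
    left. apply sin_lt_x. lra.
Qed.

Lemma atan_le_id (x : R) : 0 <= x -> atan x <= x.
Proof.
  intros Hx.
  assert (K : atan x - x <= atan 0 - 0).
  { apply (derive_nonpos_le (fun x => atan x - x) (fun x => / (1 + x * x) - 1) 0 x Hx).
    - intros t Ht. auto_derive; auto. unfold Rsqr. field. nra.
    - intros t Ht. assert (/ (1 + t * t) <= / 1) by (apply Rinv_le_contravar; nra). lra. }
  rewrite atan_0 in K. lra.
Qed.

(** When [Re w] is small against [|w|], the imaginary part has modulus at least [|w| / 2], and
    [pi / 2 - atan x = atan (1 / x) <= 1 / x]. *)
Lemma carg_gap_upper (w : C) (e : R) : hplane w -> 0 < e <= 1 / 2 -> Re w <= e * Cmod w ->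
  PI / 2 - carg w <= 2 * e \/ PI / 2 + carg w <= 2 * e.
Proof.
  intros Hw He Hr. unfold hplane in Hw.
  assert (P := Cmod_neq_0 w (hplane_neq_0 w Hw)).
  assert (T := Cmod_le_Rabs w). rewrite (Rabs_pos_eq (Re w)) in T by lra.
  assert (Gap : forall y, Cmod w <= Re w + y -> PI / 2 - atan (y / Re w) <= 2 * e).
  { intros y Hy. assert (Hy2 : Cmod w / 2 <= y) by nra.
    rewrite <- atan_inv by (apply Rdiv_lt_0_compat; lra).
    eapply Rle_trans.
    - apply atan_le_id. left; apply Rinv_0_lt_compat, Rdiv_lt_0_compat; lra.
    - replace (/ (y / Re w)) with (Re w / y) by (field; lra). apply Rle_div_l; [lra|]. nra. }
  destruct (Rle_dec 0 (Im w)) as [H|H].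
  - left. rewrite Rabs_pos_eq in T by auto. now apply Gap.
  - right. rewrite (Rabs_left (Im w)) in T by lra.
    unfold carg. replace (Im w / Re w) with (- (- Im w / Re w)) by (field; lra).
    rewrite atan_opp. apply (Gap (- Im w)). lra.
Qed.

(** * Means of powers of the Cayley transform *)

(** Jordan's inequality with the convenient constant 2/5 in place of [2 / pi]. Up to [pi / 3] the
    derivative is at least 1/2; beyond, [sin x >= sqrt 3 / 2 >= 0.85], while [2/5 * x <= 0.8]. *)
Lemma sin_ge_linear (x : R) : 0 <= x <= PI / 2 -> 2 / 5 * x <= sin x.
Proof.
  intros Hx. assert (PP := PI_RGT_0). assert (P4 := PI_4).
  assert (K : forall y, 0 <= y <= PI / 3 -> 2 / 5 * y <= sin y).
  { intros y Hy.
    assert (K : 2 / 5 * y - sin y <= 2 / 5 * 0 - sin 0).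
    { apply (derive_nonpos_le (fun x => 2 / 5 * x - sin x) (fun x => 2 / 5 - cos x) 0 y); [lra| |].
      - intros t Ht. auto_derive; auto. field.
      - intros t Ht. assert (cos (PI / 3) <= cos t) by (apply cos_decr_1; lra).
        rewrite cos_PI3 in *. lra. }
    rewrite sin_0 in K. lra. }
  destruct (Rle_dec x (PI / 3)) as [L|L]; [apply K; lra|].
  assert (S : sin (PI / 3) <= sin x) by (apply sin_incr_1; lra).
  assert (Q := K (PI / 3)). rewrite sin_PI3 in S.
  assert (17 / 10 <= sqrt 3).
  { rewrite <- (sqrt_square (17 / 10)) by lra. apply sqrt_le_1; lra. }
  lra.
Qed.

Lemma one_minus_cos_ge (t : R) : - PI <= t <= PI -> 2 / 25 * (t * t) <= 1 - cos t.
Proof.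
  assert (K : forall t, 0 <= t <= PI -> 2 / 25 * (t * t) <= 1 - cos t).
  { intros s Hs. assert (S := sin_ge_linear (s / 2) ltac:(lra)).
    replace (cos s) with (cos (2 * (s / 2))) by (f_equal; field).
    rewrite cos_2a_sin. nra. }
  intros Ht. destruct (Rle_dec 0 t) as [L|L]; [apply K; lra|].
  rewrite <- cos_neg. replace (t * t) with (- t * - t) by ring. apply K; lra.
Qed.

Lemma one_minus_cos_le (t : R) : 0 <= t <= 1 -> 1 - cos t <= t * t / 2.
Proof.
  intros Ht. assert (P2 := PI2_1). replace (cos t) with (cos (2 * (t / 2))) by (f_equal; field).
  rewrite cos_2a_sin.
  assert (S1 : 0 <= sin (t / 2)) by (apply sin_ge_0; lra).
  assert (S2 : sin (t / 2) <= t / 2).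
  { destruct (Rle_lt_or_eq_dec 0 t (proj1 Ht)) as [L|<-].
    - left; apply sin_lt_x; lra.
    - replace (0 / 2) with 0 by field. rewrite sin_0; lra. }
  nra.
Qed.

Lemma unit_angle (b : C) : Cmod b = 1 -> exists t0, b = circle_pt 1 t0.
Proof.
  intros Hb. assert (E := Cmod_sqr b). rewrite Hb in E.
  destruct b as [x y]; simpl in E. assert (Hx : -1 <= x <= 1) by nra.
  assert (Es : sqrt (1 - x²) = Rabs y).
  { rewrite <- sqrt_Rsqr_abs. f_equal. unfold Rsqr. lra. }
  destruct (Rle_dec 0 y) as [H|H].
  - exists (acos x). unfold circle_pt. rewrite cos_acos, sin_acos, Es, Rabs_pos_eq by auto.
    f_equal; ring.
  - exists (- acos x). unfold circle_pt. rewrite cos_neg, sin_neg, cos_acos, sin_acos, Es, Rabs_left by (auto; lra).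
    f_equal; ring.
Qed.

Lemma circle_dist (r t0 t : R) :
  let d := Cmod (circle_pt 1 t0 - circle_pt r t)%C in
  d * d = (1 - r) * (1 - r) + 2 * r * (1 - cos (t - t0)).
Proof.
  intros d. unfold d. rewrite Cmod_sqr, cos_minus. unfold circle_pt. simpl.
  assert (S1 := sin2_cos2 t). assert (S2 := sin2_cos2 t0). unfold Rsqr in *.
  set (A := sin t) in *. set (B := cos t) in *. set (A0 := sin t0) in *. set (B0 := cos t0) in *.
  transitivity ((A0 * A0 + B0 * B0) + r * r * (A * A + B * B) - 2 * r * (B * B0 + A * A0)); [ring|].
  rewrite S1, S2. ring.
Qed.

(** For [r >= 1/4] the angular term of the squared distance is bounded below by a multiple of
    [(t - t0)^2]. For smaller [r] the distance is at least 3/4, while the left side is at most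
    5/8. *)
Lemma circle_dist_ge (r t0 t : R) : 0 <= r < 1 -> - PI <= t - t0 <= PI ->
  (1 - r + Rabs (t - t0)) / 8 <= Cmod (circle_pt 1 t0 - circle_pt r t)%C.
Proof.
  intros Hr Ht. assert (E := circle_dist r t0 t). cbv zeta in E.
  assert (L := one_minus_cos_ge _ Ht). assert (P4 := PI_4).
  set (d := Cmod (circle_pt 1 t0 - circle_pt r t)%C) in *. set (s := t - t0) in *.
  assert (Pd : 0 <= d) by apply Cmod_ge_0.
  assert (Ha : Rabs s * Rabs s = s * s) by (rewrite <- Rabs_mult; apply Rabs_pos_eq; nra).
  assert (Pa := Rabs_pos s).
  assert (La : Rabs s <= PI) by (apply Rabs_le_between; lra).
  set (a := Rabs s) in *.
  assert (K : (1 - r + a) * (1 - r + a) <= 64 * (d * d)).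
  { rewrite E. destruct (Rle_dec (1 / 4) r) as [H|H].
    - assert (r * (a * a) * (4 / 25) <= 2 * r * (1 - cos s)).
      { rewrite Ha. apply Rle_trans with (2 * r * (2 / 25 * (s * s))); [lra|].
        apply Rmult_le_compat_l; lra. }
      assert (a * a / 25 <= r * (a * a) * (4 / 25)).
      { assert (0 <= a * a) by apply Rle_0_sqr. nra. }
      assert (0 <= (1 - r - a) * (1 - r - a)) by apply Rle_0_sqr.
      nra.
    - assert (0 <= 1 - cos s) by nra.
      assert (0 <= 2 * r * (1 - cos s)) by nra.
      assert ((1 - r + a) * (1 - r + a) <= 5 * 5) by (apply Rmult_le_compat; lra).
      assert (3 / 4 * (3 / 4) <= (1 - r) * (1 - r)) by (apply Rmult_le_compat; lra).
      lra. }
  apply Rnot_lt_le. intros N. nra.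
Qed.

(** Allows the period to be placed relative to the angle of [b], near which the means
    concentrate. *)
Lemma RInt_shift_period (g : R -> R) (c : R) :
  (forall t, continuous g t) -> (forall t, g (t + 2 * PI) = g t) ->
  RInt g c (c + 2 * PI) = RInt g 0 (2 * PI).
Proof.
  intros Hc Hg.
  assert (Ex : forall a b, ex_RInt g a b).
  { intros a b. apply (ex_RInt_continuous (V := R_CompleteNormedModule)). intros t _; auto. }
  assert (S : RInt g (2 * PI) (c + 2 * PI) = RInt g 0 c).
  { assert (K := RInt_comp_lin (V := R_CompleteNormedModule) g 1 (2 * PI) 0 c (Ex _ _)).
    replace (1 * 0 + 2 * PI) with (2 * PI) in K by ring.
    replace (1 * c + 2 * PI) with (c + 2 * PI) in K by ring.
    rewrite <- K. apply RInt_ext. intros t _. unfold scal; simpl; unfold mult; simpl.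
    rewrite !Rmult_1_l. apply Hg. }
  assert (C1 := RInt_Chasles (V := R_CompleteNormedModule) g 0 c (c + 2 * PI) (Ex _ _) (Ex _ _)).
  assert (C2 := RInt_Chasles (V := R_CompleteNormedModule) g 0 (2 * PI) (c + 2 * PI) (Ex _ _) (Ex _ _)).
  unfold plus in C1, C2; simpl in C1, C2. lra.
Qed.

(** The sign [sg] treats both sides of [c] at once; on each of them [dl + |t - c|] is affine. *)
Lemma is_RInt_power_tail (dl s sg c a b : R) : 0 < s -> sg * sg = 1 ->
  (forall t, Rmin a b <= t <= Rmax a b -> 0 < dl + sg * (t - c)) ->
  is_RInt (fun t => Rpower (dl + sg * (t - c)) (- (s + 1))) a b
    (sg / s * (Rpower (dl + sg * (a - c)) (- s) - Rpower (dl + sg * (b - c)) (- s))).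
Proof.
  intros Hs Hsg Hpos.
  replace (sg / s * (Rpower (dl + sg * (a - c)) (- s) - Rpower (dl + sg * (b - c)) (- s)))
    with (minus (- (sg / s) * Rpower (dl + sg * (b - c)) (- s)) (- (sg / s) * Rpower (dl + sg * (a - c)) (- s)))
    by (unfold minus, plus, opp; simpl; ring).
  apply (is_RInt_derive (V := R_CompleteNormedModule) (fun t => - (sg / s) * Rpower (dl + sg * (t - c)) (- s))).
  - intros t Ht. assert (P := Hpos t Ht).
    unfold Rpower. auto_derive; auto.
    replace (dl + sg * (t + - c)) with (dl + sg * (t - c)) by ring.
    set (X := dl + sg * (t - c)) in *.
    replace (- (s + 1) * ln X) with (- s * ln X + - ln X) by ring.
    rewrite exp_plus, exp_Ropp, exp_ln by auto.
    transitivity ((sg * sg) * (exp (- s * ln X) * / X)); [field; lra|]. rewrite Hsg; ring.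
  - intros t Ht. assert (P := Hpos t Ht).
    apply (ex_derive_continuous (V := R_NormedModule)). unfold Rpower. auto_derive. lra.
Qed.

Definition inv_exponent (p : Rbar) : R :=
  match p with Finite q => / q | _ => 0 end.

Section PowerMeans.

Variable b : C.
Hypothesis Hb : Cmod b = 1.

Let N (z : C) : R := Cmod (to_hplane b z).

Lemma to_hplane_pos (z : C) : disk z -> 0 < N z.
Proof. intros Hz. apply Cmod_neq_0, hplane_neq_0, to_hplane_hplane; auto. Qed.

Lemma Cmod_to_hplane_le (z : C) : disk z -> N z <= 2 / Cmod (b - z)%C.
Proof.
  intros Hz. unfold N, to_hplane. assert (Hn := b_minus_neq_0 b Hb z Hz).
  rewrite Cmod_div by auto. apply Rmult_le_compat_r.
  - left. apply Rinv_0_lt_compat, Cmod_neq_0, Hn.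
  - assert (T := Cmod_triangle b z). unfold disk in Hz. lra.
Qed.

Lemma Cmod_to_hplane_circ (r t : R) : 0 <= r < 1 -> N (circle_pt r t) <= 2 / (1 - r).
Proof.
  intros Hr. assert (Hz := circle_pt_disk r t Hr).
  eapply Rle_trans; [now apply Cmod_to_hplane_le|].
  apply Rmult_le_compat_l; [lra|]. apply Rinv_le_contravar; [lra|].
  assert (B := Cmod_b_minus b _ Hb Hz). rewrite Cmod_circle_pt in B; lra.
Qed.

Lemma to_hplane_circ_continuous (r a t : R) : 0 <= r < 1 ->
  continuous (fun t => Rpower (N (circle_pt r t)) a) t.
Proof.
  intros Hr.
  assert (Hc : circ_cont r (to_hplane b)).
  { apply ccont_circ_cont; auto. intros z Hz. eapply cderiv_ccont. now apply to_hplane_holo. }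
  apply (continuous_comp (fun t => N (circle_pt r t)) (fun x => Rpower x a)); [apply Hc|].
  apply (ex_derive_continuous (V := R_NormedModule)). unfold Rpower. auto_derive.
  apply to_hplane_pos. now apply circle_pt_disk.
Qed.

(** With [t0] the angle of [b], [|W| <= 16 / (1 - r + |t - t0|)], where 16 is the 2 of
    [Cmod_to_hplane_le] times the 8 of [circle_dist_ge]. The power of the right side is integrated
    explicitly on each side of [t0]. *)
Lemma power_mean_bound (s : R) : 0 < s -> exists K, 0 < K /\ forall r, 0 <= r < 1 ->
  RInt (fun t => Rpower (N (circle_pt r t)) (s + 1)) 0 (2 * PI) <= K * Rpower (1 - r) (- s).
Proof.
  intros Hs. destruct (unit_angle b Hb) as [t0 Et0]. assert (PP := PI_RGT_0).
  set (A := Rpower 16 (s + 1)). assert (PA : 0 < A) by apply Rpower_pos.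
  exists (A * (2 / s)). split.
  { apply Rmult_lt_0_compat; auto. apply Rdiv_lt_0_compat; lra. }
  intros r Hr.
  set (g := fun t => Rpower (N (circle_pt r t)) (s + 1)).
  assert (Cg : forall t, continuous g t) by (intros t; now apply to_hplane_circ_continuous).
  assert (Ex : forall a b, ex_RInt g a b).
  { intros a c. apply (ex_RInt_continuous (V := R_CompleteNormedModule)). intros t _; auto. }
  rewrite <- (RInt_shift_period g (t0 - PI)); auto.
  2:{ intros t. unfold g. now rewrite circle_pt_period. }
  rewrite <- (RInt_Chasles (V := R_CompleteNormedModule) g _ t0) by apply Ex.
  assert (Pt : forall t, - PI <= t - t0 <= PI -> g t <= A * Rpower (1 - r + Rabs (t - t0)) (- (s + 1))).
  { intros t Ht. assert (D := circle_dist_ge r t0 t Hr Ht). rewrite <- Et0 in D.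
    assert (Hz := circle_pt_disk r t Hr). assert (L := Cmod_to_hplane_le _ Hz).
    assert (Pa := Rabs_pos (t - t0)). set (x := 1 - r + Rabs (t - t0)) in *.
    assert (Px : 0 < x) by (unfold x; lra).
    assert (L2 : N (circle_pt r t) <= 16 * / x).
    { eapply Rle_trans; [exact L|]. unfold Rdiv.
      apply Rle_trans with (2 * / (x / 8)).
      - apply Rmult_le_compat_l; [lra|]. apply Rinv_le_contravar; lra.
      - right; field; lra. }
    unfold g, A.
    apply Rle_trans with (Rpower (16 * / x) (s + 1)).
    - apply Rle_Rpower_l; [lra|]. split; [now apply to_hplane_pos| auto].
    - assert (0 < / x) by now apply Rinv_0_lt_compat.
      rewrite <- Rpower_mult_distr by lra. right. f_equal.
      unfold Rpower. rewrite ln_Rinv by auto. f_equal; ring. }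
  assert (P1 : forall x, 0 < Rpower x (- s)) by (intros; apply Rpower_pos).
  assert (I1 : RInt g (t0 - PI) t0 <= A * (1 / s * Rpower (1 - r) (- s))).
  { assert (I := is_RInt_power_tail (1 - r) s (-1) t0 (t0 - PI) t0 Hs ltac:(ring)).
    rewrite Rmin_left, Rmax_right in I by lra.
    specialize (I ltac:(intros; lra)).
    assert (I' := is_RInt_scal (V := R_NormedModule) _ _ _ A _ I).
    apply Rle_trans with (RInt (fun t => scal A (Rpower (1 - r + -1 * (t - t0)) (- (s + 1)))) (t0 - PI) t0).
    - apply RInt_le; [lra| apply Ex| eexists; exact I'|]. intros t Ht.
      eapply Rle_trans; [apply Pt; lra|]. rewrite Rabs_left by lra. right.
      unfold scal; simpl; unfold mult; simpl. f_equal. f_equal. ring.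
    - eapply Rle_trans; [apply Req_le, (is_RInt_unique (V := R_CompleteNormedModule) _ _ _ _ I')|].
      apply Rmult_le_compat_l; [lra|].
      replace (1 - r + -1 * (t0 - t0)) with (1 - r) by ring.
      assert (Q := P1 (1 - r + -1 * (t0 - PI - t0))).
      assert (0 < / s) by now apply Rinv_0_lt_compat. unfold Rdiv. nra. }
  assert (I2 : RInt g t0 (t0 - PI + 2 * PI) <= A * (1 / s * Rpower (1 - r) (- s))).
  { assert (I := is_RInt_power_tail (1 - r) s 1 t0 t0 (t0 - PI + 2 * PI) Hs ltac:(ring)).
    rewrite Rmin_left, Rmax_right in I by lra.
    specialize (I ltac:(intros; lra)).
    assert (I' := is_RInt_scal (V := R_NormedModule) _ _ _ A _ I).
    apply Rle_trans with (RInt (fun t => scal A (Rpower (1 - r + 1 * (t - t0)) (- (s + 1)))) t0 (t0 - PI + 2 * PI)).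
    - apply RInt_le; [lra| apply Ex| eexists; exact I'|]. intros t Ht.
      eapply Rle_trans; [apply Pt; lra|]. rewrite Rabs_pos_eq by lra. right.
      unfold scal; simpl; unfold mult; simpl. f_equal. f_equal. ring.
    - eapply Rle_trans; [apply Req_le, (is_RInt_unique (V := R_CompleteNormedModule) _ _ _ _ I')|].
      apply Rmult_le_compat_l; [lra|].
      replace (1 - r + 1 * (t0 - t0)) with (1 - r) by ring.
      assert (Q := P1 (1 - r + 1 * (t0 - PI + 2 * PI - t0))).
      assert (0 < / s) by now apply Rinv_0_lt_compat. unfold Rdiv. nra. }
  change (RInt g (t0 - PI) t0 + RInt g t0 (t0 - PI + 2 * PI) <= A * (2 / s) * Rpower (1 - r) (- s)).
  replace (A * (2 / s) * Rpower (1 - r) (- s))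
    with (A * (1 / s * Rpower (1 - r) (- s)) + A * (1 / s * Rpower (1 - r) (- s))) by (field; lra).
  lra.
Qed.

Variable p : Rbar.
Hypothesis Hp : exponent p.

(** The [q]-th power turns the exponent [beta + 1/q] into [beta * q + 1], which is
    [power_mean_bound] with [s = beta * q]. For [p] infinite [|W| <= 2 / (1 - r)] is enough. *)
Lemma Mp_power_upper (beta : R) : 0 < beta -> exists K, 0 < K /\
  forall r B g, 0 <= r < 1 -> 0 <= B -> circ_cont r g ->
  (forall t, Cmod (g (circle_pt r t)) <= B * Rpower (N (circle_pt r t)) (beta + inv_exponent p)) ->
  Mp p r g <= B * K * Rpower (1 - r) (- beta).
Proof.
  intros Hbeta. destruct Hp as [->|[q [-> Hq]]]; simpl.
  - exists (Rpower 2 beta). split; [apply Rpower_pos|]. intros r B g Hr HB Hg H.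
    apply Mp_infty_spec; auto. intros t. eapply Rle_trans; [apply H|].
    rewrite Rplus_0_r, Rmult_assoc. apply Rmult_le_compat_l; auto.
    apply Rle_trans with (Rpower (2 * / (1 - r)) beta).
    + apply Rle_Rpower_l; [lra|]. split; [now apply to_hplane_pos, circle_pt_disk|].
      now apply Cmod_to_hplane_circ.
    + assert (0 < / (1 - r)) by (apply Rinv_0_lt_compat; lra).
      rewrite <- Rpower_mult_distr by lra. right. f_equal.
      unfold Rpower. rewrite ln_Rinv by lra. f_equal; ring.
  - assert (Hs : 0 < beta * q) by nra.
    destruct (power_mean_bound (beta * q) Hs) as [K [HK Int]].
    assert (PP := PI_RGT_0).
    exists (Rpower (K / (2 * PI)) (/ q)). split; [apply Rpower_pos|]. intros r B g Hr HB Hg H.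
    assert (Hq' : 0 < / q) by (apply Rinv_0_lt_compat; lra).
    assert (Ex : ex_RInt (fun t => rpow B q * Rpower (N (circle_pt r t)) (beta * q + 1)) 0 (2 * PI)).
    { apply (ex_RInt_scal (V := R_NormedModule)).
      apply (ex_RInt_continuous (V := R_CompleteNormedModule)). intros t _.
      now apply to_hplane_circ_continuous. }
    apply Rle_trans with (rpow (rpow B q * (K / (2 * PI) * Rpower (1 - r) (- (beta * q)))) (/ q)).
    + unfold Mp. apply rpow_le; auto. split.
      { apply Rdiv_le_0_compat; [|lra].
        apply RInt_ge_0; [lra| apply circ_cont_ex_RInt; auto; lra|].
        intros t _; apply rpow_ge_0. }
      apply Rle_div_l; [lra|].
      replace (rpow B q * (K / (2 * PI) * Rpower (1 - r) (- (beta * q))) * (2 * PI))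
        with (rpow B q * (K * Rpower (1 - r) (- (beta * q)))) by (field; lra).
      apply Rle_trans with (RInt (fun t => rpow B q * Rpower (N (circle_pt r t)) (beta * q + 1)) 0 (2 * PI)).
      * apply RInt_le; auto; [lra| apply circ_cont_ex_RInt; auto; lra|]. intros t _.
        assert (Hz := to_hplane_pos _ (circle_pt_disk r t Hr)).
        apply Rle_trans with (rpow (B * Rpower (N (circle_pt r t)) (beta + / q)) q).
        -- apply rpow_le; [lra|]. split; [apply Cmod_ge_0| apply H].
        -- rewrite rpow_mult by (auto; left; apply Rpower_pos).
           right. f_equal. rewrite rpow_pos_eq by apply Rpower_pos.
           rewrite Rpower_mult. f_equal. field. lra.
      * replace (RInt (fun t => rpow B q * Rpower (N (circle_pt r t)) (beta * q + 1)) 0 (2 * PI))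
          with (rpow B q * RInt (fun t => Rpower (N (circle_pt r t)) (beta * q + 1)) 0 (2 * PI)).
        -- apply Rmult_le_compat_l; [apply rpow_ge_0| now apply Int].
        -- symmetry. apply (RInt_scal (V := R_CompleteNormedModule)).
           apply (ex_RInt_continuous (V := R_CompleteNormedModule)). intros t _.
           now apply to_hplane_circ_continuous.
    + assert (PK : 0 < K / (2 * PI)) by (apply Rdiv_lt_0_compat; lra).
      assert (PR := Rpower_pos (1 - r) (- (beta * q))).
      rewrite rpow_mult by (try apply rpow_ge_0; nra). rewrite rpow_rpow by lra.
      rewrite rpow_pos_eq by now apply Rmult_lt_0_compat.
      rewrite <- Rpower_mult_distr, Rpower_mult by auto.
      right. rewrite Rmult_assoc. do 3 f_equal. field. lra.
Qed.

(** On the arc of length [1 - r] that starts at the angle of [b], [|b - z| <= 3/2 * (1 - r)], hence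
    [|W| >= 1 / (3 * (1 - r))]. This arc alone gives a mean of the full order. *)
Lemma Mp_power_lower (beta : R) : 0 < beta -> exists c, 0 < c /\
  forall r g, 1 / 2 <= r < 1 -> circ_cont r g ->
  (forall t, Cmod (g (circle_pt r t)) = Rpower (N (circle_pt r t)) (beta + inv_exponent p)) ->
  c * Rpower (1 - r) (- beta) <= Mp p r g.
Proof.
  intros Hbeta. destruct (unit_angle b Hb) as [t0 Et0].
  assert (Low : forall r t, 1 / 2 <= r < 1 -> 0 <= t - t0 <= 1 - r ->
    / (3 * (1 - r)) <= N (circle_pt r t)).
  { intros r t Hr Ht. assert (Hz := circle_pt_disk r t ltac:(lra)).
    assert (E := circle_dist r t0 t). cbv zeta in E. rewrite <- Et0 in E.
    assert (U := one_minus_cos_le (t - t0) ltac:(lra)).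
    assert (S := Cmod_to_hplane_succ b _ Hb Hz).
    assert (T := Cmod_triangle (to_hplane b (circle_pt r t)) 1%C). rewrite Cmod_1, S in T.
    fold (N (circle_pt r t)) in T.
    set (d := Cmod (b - circle_pt r t)%C) in *.
    assert (Pd : 0 < d) by (apply Cmod_neq_0, b_minus_neq_0; auto).
    assert (Dd : d <= 3 / 2 * (1 - r)).
    { assert (d * d <= 2 * ((1 - r) * (1 - r))).
      { rewrite E. set (x := t - t0) in *.
        assert (2 * r * (1 - cos x) <= 2 * r * (x * x / 2)) by (apply Rmult_le_compat_l; lra).
        assert (x * x <= (1 - r) * (1 - r)) by (apply Rmult_le_compat; lra).
        assert (r * (x * x) <= 1 * (x * x)) by (apply Rmult_le_compat_r; [apply Rle_0_sqr| lra]).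
        lra. }
      apply Rnot_lt_le. intros L. nra. }
    assert (2 / (3 / 2 * (1 - r)) <= 2 / d).
    { apply Rmult_le_compat_l; [lra|]. apply Rinv_le_contravar; lra. }
    replace (2 / (3 / 2 * (1 - r))) with (4 * / (3 * (1 - r))) in H by (field; lra).
    assert (1 <= / (1 - r)) by (rewrite <- Rinv_1; apply Rinv_le_contravar; lra).
    rewrite Rinv_mult in *. lra. }
  assert (LowP : forall r t a, 0 < a -> 1 / 2 <= r < 1 -> 0 <= t - t0 <= 1 - r ->
    Rpower (/ 3) a * Rpower (1 - r) (- a) <= Rpower (N (circle_pt r t)) a).
  { intros r t a Pa Hr Ht.
    assert (0 < / (1 - r)) by (apply Rinv_0_lt_compat; lra).
    apply Rle_trans with (Rpower (/ (3 * (1 - r))) a).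
    - rewrite Rinv_mult, <- Rpower_mult_distr by lra. right. f_equal.
      unfold Rpower. rewrite ln_Rinv by lra. f_equal; ring.
    - apply Rle_Rpower_l; [lra|]. split; [apply Rinv_0_lt_compat; lra| now apply Low]. }
  destruct Hp as [->|[q [-> Hq]]]; simpl.
  - exists (Rpower (/ 3) beta). split; [apply Rpower_pos|]. intros r g Hr Hg H.
    eapply Rle_trans; [|apply (Mp_infty_spec r g Hg) with (t := t0)].
    rewrite H, Rplus_0_r. apply LowP; auto. lra.
  - assert (Hs : 0 < beta * q + 1) by nra.
    assert (PP := PI_RGT_0). assert (P21 := PI2_1).
    set (c := Rpower (/ 3) (beta * q + 1)). assert (Pc : 0 < c) by apply Rpower_pos.
    assert (Pc2 : 0 < c / (2 * PI)) by (apply Rdiv_lt_0_compat; lra).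
    assert (Hq' : 0 < / q) by (apply Rinv_0_lt_compat; lra).
    exists (Rpower (c / (2 * PI)) (/ q)). split; [apply Rpower_pos|]. intros r g Hr Hg H.
    assert (PR := Rpower_pos (1 - r) (- (beta * q))).
    apply Rle_trans with (rpow (c / (2 * PI) * Rpower (1 - r) (- (beta * q))) (/ q)).
    + rewrite rpow_pos_eq by now apply Rmult_lt_0_compat.
      rewrite <- Rpower_mult_distr, Rpower_mult by auto. right. do 2 f_equal. field. lra.
    + unfold Mp. apply rpow_le; auto. split; [left; now apply Rmult_lt_0_compat|].
      apply (Rle_div_r _ _ (2 * PI)); [lra|].
      replace (c / (2 * PI) * Rpower (1 - r) (- (beta * q)) * (2 * PI))
        with (c * Rpower (1 - r) (- (beta * q))) by (field; lra).
      set (G := fun t => rpow (Cmod (g (circle_pt r t))) q).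
      assert (Ex : forall a b, ex_RInt G a b) by (intros; apply circ_cont_ex_RInt; auto; lra).
      rewrite <- (RInt_shift_period G t0).
      2:{ intros t. apply circ_cont_rpow; auto; lra. }
      2:{ intros t. unfold G. now rewrite circle_pt_period. }
      rewrite <- (RInt_Chasles (V := R_CompleteNormedModule) G _ (t0 + (1 - r))) by apply Ex.
      assert (I2 : 0 <= RInt G (t0 + (1 - r)) (t0 + 2 * PI)).
      { apply RInt_ge_0; [lra| apply Ex|]. intros t _; apply rpow_ge_0. }
      change (c * Rpower (1 - r) (- (beta * q)) <= RInt G t0 (t0 + (1 - r)) + RInt G (t0 + (1 - r)) (t0 + 2 * PI)).
      enough (c * Rpower (1 - r) (- (beta * q)) <= RInt G t0 (t0 + (1 - r))) by lra.
      set (m := c * Rpower (1 - r) (- (beta * q + 1))).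
      replace (c * Rpower (1 - r) (- (beta * q))) with (RInt (fun _ => m) t0 (t0 + (1 - r))).
      * apply RInt_le; [lra| apply ex_RInt_const| apply Ex|]. intros t Ht.
        unfold m, c, G. rewrite H.
        rewrite rpow_pos_eq by apply Rpower_pos. rewrite Rpower_mult.
        replace ((beta + / q) * q) with (beta * q + 1) by (field; lra).
        apply LowP; auto; lra.
      * rewrite RInt_const. unfold scal; simpl; unfold mult; simpl. unfold m.
        replace (- (beta * q)) with (- (beta * q + 1) + 1) by ring.
        rewrite Rpower_plus, Rpower_1 by lra. ring.
Qed.

End PowerMeans.

(** * Strictness of the inclusion *)

(** The right side is the maximum of [s^a * exp (- s)], attained at [s = a]; the bound is
    [1 + x <= exp x] at [x = ln (s / a)]. *)
Lemma Rpower_exp_bounded (a s : R) : 0 < a -> 0 < s ->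
  Rpower s a * exp (- s) <= exp (a * ln a - a).
Proof.
  intros Ha Hs. unfold Rpower. rewrite <- exp_plus. apply exp_le.
  assert (P : 0 < s / a) by now apply Rdiv_lt_0_compat.
  assert (L := exp_ineq1_le (ln (s / a))). rewrite exp_ln in L by auto.
  unfold Rdiv in L. rewrite ln_mult, ln_Rinv in L by (auto; now apply Rinv_0_lt_compat).
  apply (Rmult_le_compat_l a) in L; [|lra].
  replace (a * (s * / a)) with s in L by (field; lra). lra.
Qed.

Lemma Rpower_opp_cancel (x a : R) : 0 < x -> Rpower x a * Rpower x (- a) = 1.
Proof. intros Hx. rewrite <- Rpower_plus, Rplus_opp_r. now apply Rpower_O. Qed.

Section Strictness.

Variables (p : Rbar) (alpha : R) (b : C).
Hypothesis Hp : exponent p.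
Hypothesis Ha : 0 < alpha.
Hypothesis Hb : Cmod b = 1.

Let W := to_hplane b.
(** The exponent for which the [p]-means of [|W|^gam] have the exact order [(1 - r)^(-alpha)]. *)
Let gam := alpha + inv_exponent p.

Lemma inv_exponent_ge_0 : 0 <= inv_exponent p.
Proof.
  destruct Hp as [->|[q [-> Hq]]]; simpl; [lra|]. left; apply Rinv_0_lt_compat; lra.
Qed.

(** The scalar [c] is carried along so that the test function (with [c = 1]), its small multiples
    and [ray_power] share one form. *)
Lemma analytic_cpow (c a : C) : analytic (fun z => c * cpow a (W z))%C.
Proof.
  apply (cderiv_analytic _ (fun z => c * (cpow a (W z) * (a * / W z) * d_to_hplane b z))%C).
  intros z Hz. apply cderiv_scal. apply (cderiv_comp (cpow a) W).
  - now apply to_hplane_holo.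
  - apply cderiv_cpow. now apply to_hplane_hplane.
Qed.

Lemma power_Hbound : exists K, 0 < K /\ forall c, 0 <= c ->
  Hbound p alpha (fun z => c * cpow gam (W z))%C (c * K).
Proof.
  destruct (Mp_power_upper b Hb p Hp alpha Ha) as [K [HK U]].
  exists K; split; auto. intros c Hc r Hr.
  assert (M : Mp p r (fun z => c * cpow gam (W z))%C <= c * K * Rpower (1 - r) (- alpha)).
  { apply U; auto.
    - apply analytic_circ_cont; auto. apply analytic_cpow.
    - intros t. rewrite Cmod_mult, Cmod_R, Rabs_pos_eq by auto.
      rewrite Cmod_cpow_real; [right; reflexivity|].
      apply to_hplane_hplane; auto. now apply circle_pt_disk. }
  assert (P := Rpower_pos (1 - r) alpha).
  apply (Rmult_le_compat_l (Rpower (1 - r) alpha)) in M; [|lra].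
  eapply Rle_trans; [exact M|]. right.
  transitivity (c * K * (Rpower (1 - r) alpha * Rpower (1 - r) (- alpha))); [ring|].
  rewrite Rpower_opp_cancel; lra.
Qed.

(** Combines [Re W * |b - z|^2 = 1 - |z|^2] with [|W| * |b - z| <= 2]. It keeps the argument of [W]
    away from [pi / 2] and [- pi / 2] where [|W|] is of order [1 / (1 - |z|)]. *)
Lemma to_hplane_gap (z : C) : disk z ->
  (1 - Cmod z) * Cmod (W z) / 4 <= Re (W z) / Cmod (W z).
Proof.
  intros Hz. assert (Pw := to_hplane_pos b Hb z Hz). fold W in Pw.
  assert (E := to_hplane_re b z Hb Hz). fold W in E.
  assert (L := Cmod_to_hplane_le b Hb z Hz). fold W in L.
  assert (Pd : 0 < Cmod (b - z)%C) by (apply Cmod_neq_0, b_minus_neq_0; auto).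
  assert (Pz := Cmod_ge_0 z). unfold disk in Hz.
  apply Rle_div_r in L; auto. set (d := Cmod (b - z)%C) in *. set (n := Cmod (W z)) in *.
  apply (Rle_div_r _ _ n); auto.
  apply Rmult_le_reg_r with (d * d); [nra|]. rewrite E.
  assert (Q : (n * d) * (n * d) <= 2 * 2) by (apply Rmult_le_compat; nra).
  assert ((1 - Cmod z) * ((n * d) * (n * d)) <= (1 - Cmod z) * (2 * 2)) by (apply Rmult_le_compat_l; lra).
  replace ((1 - Cmod z) * n / 4 * n * (d * d)) with ((1 - Cmod z) * ((n * d) * (n * d)) / 4) by field.
  nra.
Qed.

(* The imaginary part of the exponent makes the modulus decay away from one of
   the two boundary rays of the half plane. *)
Definition ray_power (lam sg : R) (z : C) : C :=
  (RtoC (2 * exp (- (lam * (PI / 2)))) * cpow (gam, sg * lam)%R (W z))%C.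

Lemma Cmod_ray_power (lam sg : R) (z : C) : disk z ->
  Cmod (ray_power lam sg z) =
  2 * Rpower (Cmod (W z)) gam * exp (- (lam * (PI / 2 + sg * carg (W z)))).
Proof.
  intros Hz. unfold ray_power.
  assert (E := exp_pos (- (lam * (PI / 2)))).
  rewrite Cmod_mult, Cmod_R, Rabs_pos_eq by lra.
  rewrite Cmod_cpow by now apply to_hplane_hplane. simpl.
  replace (- (lam * (PI / 2 + sg * carg (W z))))
    with (- (lam * (PI / 2)) + - (sg * lam) * carg (W z)) by ring.
  rewrite exp_plus. ring.
Qed.

(** Half of the growth is traded for the parameter. With [a = alpha / 2] and
    [s = (1 - r) * |W| / d], the exponential factor is at most [exp (- s)], and
    [s^a * exp (- s) <= E] replaces a factor [|W|^a] by [E * (d / (1 - r))^a]. The remaining power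
    has means of order [(1 - r)^(-a)], so the norm is [O(d^a)]. *)
Lemma ray_power_small (eps : R) : 0 < eps -> exists lam, 0 < lam /\
  forall sg, sg = 1 \/ sg = -1 -> Hspace p alpha (ray_power lam sg) /\
    Hbound p alpha (ray_power lam sg) eps.
Proof.
  intros He. set (a := alpha / 2). assert (Pa : 0 < a) by (unfold a; lra).
  destruct (Mp_power_upper b Hb p Hp a Pa) as [K [HK U]].
  set (E := exp (a * ln a - a)). assert (PE : 0 < E) by apply exp_pos.
  destruct (Rpower_small a (eps / (2 * E * K)) Pa) as [d [Hd D]].
  { apply Rdiv_lt_0_compat; auto. repeat apply Rmult_lt_0_compat; lra. }
  specialize (D d ltac:(lra)).
  (* The 4 cancels the one in [to_hplane_gap], so that [lam] times the gap is at least [s]. *)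
  set (lam := 4 / d). assert (Pl : 0 < lam) by (apply Rdiv_lt_0_compat; lra).
  exists lam. split; auto. intros sg Hsg.
  assert (An : analytic (ray_power lam sg)) by apply analytic_cpow.
  assert (HB : Hbound p alpha (ray_power lam sg) eps).
  { intros r Hr. assert (P1 := Rpower_pos (1 - r) (- a)). assert (P2 := Rpower_pos d a).
    assert (M : Mp p r (ray_power lam sg) <=
      2 * E * Rpower d a * Rpower (1 - r) (- a) * K * Rpower (1 - r) (- a)).
    { apply U; auto.
      - repeat (apply Rmult_le_pos; try lra).
      - now apply analytic_circ_cont.
      - intros t. set (z := circle_pt r t).
        assert (Hz : disk z) by now apply circle_pt_disk.
        assert (Ez : Cmod z = r) by (apply Cmod_circle_pt; lra).
        rewrite Cmod_ray_power by auto.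
        assert (Pw := to_hplane_pos b Hb z Hz). fold W in Pw |- *.
        assert (G := to_hplane_gap z Hz). rewrite Ez in G.
        destruct (carg_gap_lower (W z) (to_hplane_hplane b Hb z Hz)) as [G1 G2].
        set (n := Cmod (W z)) in *.
        set (s := (1 - r) * n / d).
        assert (Ps : 0 < s) by (apply Rdiv_lt_0_compat; [apply Rmult_lt_0_compat|]; lra).
        assert (X : exp (- (lam * (PI / 2 + sg * carg (W z)))) <= exp (- s)).
        { apply exp_le, Ropp_le_contravar.
          replace s with (lam * ((1 - r) * n / 4)) by (unfold s, lam; field; lra).
          apply Rmult_le_compat_l; [lra|]. destruct Hsg as [->| ->]; lra. }
        assert (Q := Rpower_exp_bounded a s Pa Ps). fold E in Q.
        assert (Sp : Rpower n a = Rpower d a * Rpower (1 - r) (- a) * Rpower s a).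
        { replace (Rpower (1 - r) (- a)) with (Rpower (/ (1 - r)) a)
            by (unfold Rpower; rewrite ln_Rinv by lra; f_equal; ring).
          assert (0 < / (1 - r)) by (apply Rinv_0_lt_compat; lra).
          rewrite !Rpower_mult_distr by (first [assumption | lra | apply Rmult_lt_0_compat; lra]).
          f_equal. unfold s. field. lra. }
        replace gam with (a + (a + inv_exponent p)) by (unfold gam, a; field).
        rewrite Rpower_plus, Sp.
        assert (P3 := Rpower_pos n (a + inv_exponent p)).
        assert (P4 := Rpower_pos s a).
        apply Rle_trans with (2 * (Rpower d a * Rpower (1 - r) (- a) * Rpower s a *
           Rpower n (a + inv_exponent p)) * exp (- s)).
        + apply Rmult_le_compat_l; auto.
          repeat (apply Rmult_le_pos; try lra).
        + replace (2 * (Rpower d a * Rpower (1 - r) (- a) * Rpower s a *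
            Rpower n (a + inv_exponent p)) * exp (- s))
            with (2 * (Rpower d a * Rpower (1 - r) (- a) * Rpower n (a + inv_exponent p)) *
              (Rpower s a * exp (- s))) by ring.
          replace (2 * E * Rpower d a * Rpower (1 - r) (- a) * Rpower n (a + inv_exponent p))
            with (2 * (Rpower d a * Rpower (1 - r) (- a) * Rpower n (a + inv_exponent p)) * E) by ring.
          apply Rmult_le_compat_l; auto.
          repeat (apply Rmult_le_pos; try lra). }
    assert (P := Rpower_pos (1 - r) alpha).
    apply (Rmult_le_compat_l (Rpower (1 - r) alpha)) in M; [|lra].
    eapply Rle_trans; [exact M|].
    replace alpha with (a + a) by (unfold a; field). rewrite Rpower_plus.
    transitivity (2 * E * K * Rpower d a * (Rpower (1 - r) a * Rpower (1 - r) (- a))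
      * (Rpower (1 - r) a * Rpower (1 - r) (- a))).
    { right; ring. }
    rewrite Rpower_opp_cancel by lra.
    apply Rle_div_r in D; [|repeat apply Rmult_lt_0_compat; lra]. lra. }
  split; auto. apply Hspace_bound; eauto.
Qed.

(** Since [|W| >= 1], lying outside the cone gives [Re W <= (2 / k) * |W|], so one of the two gaps
    is at most [4 / k]. As [8 * lam <= k], the corresponding exponential is at least 1/2, which the
    factor 2 in [ray_power] offsets. *)
Lemma ray_power_dominates (lam k : R) (z : C) : 0 < lam -> 4 <= k -> 8 * lam <= k ->
  disk z -> ~ cone k (W z) -> 1 <= Cmod (W z) ->
  Rpower (Cmod (W z)) gam <= Cmod (ray_power lam 1 z) + Cmod (ray_power lam (-1) z).
Proof.
  intros Hl Hk Hlk Hz Hc H1.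
  assert (Hw := to_hplane_hplane b Hb z Hz). fold W in Hw.
  assert (L : Re (W z) <= 2 / k * Cmod (W z)).
  { assert (L : k * Re (W z) < Cmod (W z + 1)%C).
    { apply Rnot_le_lt. intros L. apply Hc. now split. }
    assert (T := Cmod_triangle (W z) 1%C). rewrite Cmod_1 in T.
    apply Rmult_le_reg_l with k; [lra|].
    replace (k * (2 / k * Cmod (W z))) with (2 * Cmod (W z)) by (field; lra). lra. }
  assert (Hk2 : 0 < 2 / k <= 1 / 2).
  { split; [apply Rdiv_lt_0_compat; lra| apply Rle_div_l; lra]. }
  assert (P := Rpower_pos (Cmod (W z)) gam).
  assert (X : forall g, g <= 2 * (2 / k) -> 1 / 2 <= exp (- (lam * g))).
  { intros g Hg. assert (I := exp_ineq1_le (- (lam * g))).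
    assert (lam * g <= lam * (2 * (2 / k))) by (apply Rmult_le_compat_l; lra).
    assert (lam * (2 * (2 / k)) <= 1 / 2).
    { replace (lam * (2 * (2 / k))) with (4 * lam / k) by (field; lra). apply Rle_div_l; lra. }
    lra. }
  destruct (carg_gap_upper (W z) (2 / k) Hw Hk2 L) as [G|G].
  - assert (Q := Cmod_ray_power lam (-1) z Hz). assert (Q0 := Cmod_ge_0 (ray_power lam 1 z)).
    assert (X' := X (PI / 2 + -1 * carg (W z)) ltac:(lra)). rewrite Q. nra.
  - assert (Q := Cmod_ray_power lam 1 z Hz). assert (Q0 := Cmod_ge_0 (ray_power lam (-1) z)).
    assert (X' := X (PI / 2 + 1 * carg (W z)) ltac:(lra)). rewrite Q. nra.
Qed.

(** A relative perturbation by at most 1/2 keeps all moduli on the segment within a factor 2 of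
    [|w|], where the derivative [gam * w^gam / w] is under control. *)
Lemma cpow_lipschitz (w v : C) (eta : R) : hplane w -> hplane v -> 0 < gam ->
  0 < eta <= 1 / 2 -> Cmod (v - w)%C <= eta * Cmod w ->
  Cmod (cpow gam v) <= Rpower 2 gam * Cmod (cpow gam w) /\
  Cmod (cpow gam v - cpow gam w)%C <= 2 * gam * Rpower 2 gam * eta * Cmod (cpow gam w).
Proof.
  intros Hw Hv Hg He Hd. set (h := (v - w)%C) in *.
  assert (Pw := Cmod_neq_0 w (hplane_neq_0 w Hw)).
  assert (Sg : forall s, 0 <= s <= 1 -> hplane (w + s * h)%C /\
    Cmod w / 2 <= Cmod (w + s * h)%C <= 2 * Cmod w).
  { intros s Hs. split.
    - unfold hplane in *. replace (Re (w + s * h)%C) with ((1 - s) * Re w + s * Re v).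
      + destruct (Rle_dec s (1 / 2)); nra.
      + unfold h. destruct w, v; simpl; ring.
    - assert (Ph := Cmod_ge_0 h).
      assert (B : Cmod (s * h)%C <= Cmod w / 2).
      { rewrite Cmod_mult, Cmod_R, Rabs_pos_eq by lra. nra. }
      assert (T1 := Cmod_triangle w (s * h)%C).
      assert (T2 := Cmod_triangle_inv w (- (s * h))%C). rewrite Cmod_opp in T2.
      replace (w - - (s * h))%C with (w + s * h)%C in T2 by ring. lra. }
  assert (Sz : forall s, 0 <= s <= 1 -> Cmod (cpow gam (w + s * h)%C) <= Rpower 2 gam * Cmod (cpow gam w)).
  { intros s Hs. destruct (Sg s Hs) as [S1 S2].
    rewrite !Cmod_cpow_real by auto. rewrite Rpower_mult_distr by lra.
    apply Rle_Rpower_l; [lra|]. split; [|lra]. apply Cmod_neq_0, hplane_neq_0, S1. }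
  assert (Ev : v = (w + h)%C) by (unfold h; ring).
  split.
  - rewrite Ev. replace (w + h)%C with (w + 1%R * h)%C by ring. apply Sz; lra.
  - assert (P2 := Rpower_pos 2 gam). assert (Pc := Cmod_ge_0 (cpow gam w)).
    rewrite Ev.
    eapply Rle_trans.
    + apply (mean_value_ineq (cpow gam) (fun w => cpow gam w * (gam * / w))%C w h
        (Rpower 2 gam * Cmod (cpow gam w) * (gam * (2 / Cmod w)))).
      * intros s Hs. apply cderiv_cpow. now apply Sg.
      * intros s Hs. destruct (Sg s Hs) as [S1 S2].
        rewrite !Cmod_mult, Cmod_inv, Cmod_R, Rabs_pos_eq by (auto using hplane_neq_0; lra).
        assert (Ps : 0 < Cmod (w + s * h)%C) by lra.
        apply Rmult_le_compat; [apply Cmod_ge_0| | now apply Sz|].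
        -- apply Rmult_le_pos; [lra|]. left; now apply Rinv_0_lt_compat.
        -- apply Rmult_le_compat_l; [lra|].
           replace (2 / Cmod w) with (/ (Cmod w / 2)) by (field; lra).
           apply Rinv_le_contravar; lra.
    + apply Rle_trans with (Rpower 2 gam * Cmod (cpow gam w) * (gam * (2 / Cmod w)) * (eta * Cmod w)).
      * apply Rmult_le_compat_l; auto.
        apply Rmult_le_pos; [apply Rmult_le_pos; lra|].
        apply Rmult_le_pos; [lra|]. left; apply Rdiv_lt_0_compat; lra.
      * right; field; lra.
Qed.

(** For [r >= 1/2] the weighted mean stays above the constant of [Mp_power_lower]. *)
Lemma power_not_little : ~ Hspace0 p alpha (fun z => 1 * cpow gam (W z))%C.
Proof.
  intros [_ H0].
  destruct (Mp_power_lower b Hb p Hp alpha Ha) as [c [Hc L]].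
  destruct (H0 (fun y => y < c)) as [d D].
  { exists (mkposreal c Hc). intros y Hy.
    unfold ball in Hy; simpl in Hy; unfold AbsRing_ball, abs, minus, plus, opp in Hy; simpl in Hy.
    apply Rabs_def2 in Hy. lra. }
  assert (Pd := cond_pos d).
  set (e := Rmin (1 / 2) (d / 2)).
  assert (E0 : 0 < e) by (apply Rmin_glb_lt; lra).
  assert (E1 : e <= 1 / 2) by apply Rmin_l. assert (E2 : e <= d / 2) by apply Rmin_r.
  set (r := 1 - e).
  specialize (D r). simpl in D.
  assert (K : Rpower (1 - r) alpha * Mp p r (fun z => 1 * cpow gam (W z))%C < c).
  { apply D; [|unfold r; lra].
    unfold ball; simpl; unfold AbsRing_ball, abs, minus, plus, opp; simpl.
    apply Rabs_def1; unfold r; lra. }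
  assert (L' := L r (fun z => 1 * cpow gam (W z))%C ltac:(unfold r; lra)).
  assert (Cc : circ_cont r (fun z => 1 * cpow gam (W z))%C).
  { apply analytic_circ_cont; [unfold r; lra| apply analytic_cpow]. }
  specialize (L' Cc). lapply L'; clear L'.
  - intros L'. assert (P := Rpower_pos (1 - r) alpha).
    apply (Rmult_le_compat_l (Rpower (1 - r) alpha)) in L'; [|lra].
    replace (Rpower (1 - r) alpha * (c * Rpower (1 - r) (- alpha))) with c in L'.
    + lra.
    + transitivity (c * (Rpower (1 - r) alpha * Rpower (1 - r) (- alpha))); [|ring].
      rewrite Rpower_opp_cancel; [ring| unfold r; lra].
  - intros t. rewrite Cmult_1_l. apply Cmod_cpow_real.
    apply to_hplane_hplane; auto. apply circle_pt_disk. unfold r; lra.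
Qed.

Variables (phi : R -> C -> C) (M : R).
Hypothesis sg : analytic_semigroup phi.
Hypothesis dw : Denjoy_Wolff_point phi b.
Hypothesis dphi_analytic : forall t, 0 <= t -> analytic (C_derive (phi t)).
Hypothesis HM : forall t, 0 <= t <= 1 ->
  op_norm_le (Hspace p alpha) (Hnorm p alpha) (Top phi t) M.

(** Outside a cone the monomial majorizes the points with [|W| < 1], and the two ray powers those
    with [|W| >= 1]. On a cone the displacement is small relative to [|W|], so [T_t f - f] is
    bounded by a small multiple of [f] itself, which serves as [h]. *)
Lemma power_continuity :
  continuity_space phi (Hspace p alpha) (Hnorm p alpha) (fun z => 1 * cpow gam (W z))%C.
Proof.
  assert (Ig := inv_exponent_ge_0). assert (Hg : 0 < gam) by (unfold gam; lra).
  destruct power_Hbound as [K [HK PB]].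
  assert (Cf : forall z, disk z -> Cmod (1 * cpow gam (W z))%C = Rpower (Cmod (W z)) gam).
  { intros z Hz. rewrite Cmult_1_l. apply Cmod_cpow_real. now apply to_hplane_hplane. }
  apply (continuity_criterion p alpha phi b M Hp Hb sg dw dphi_analytic HM _ 3).
  - apply Hspace_bound. split; [apply analytic_cpow|]. exists (1 * K). apply PB. lra.
  - intros eps He.
    destruct (outside_cone_small p alpha 1 eps b Hp Ha Hb Rle_0_1 He) as [F [k0 [F1 [F2 [Hk0 F3]]]]].
    destruct (ray_power_small eps He) as [lam [Hl R]].
    set (k := Rmax k0 (Rmax 4 (8 * lam))).
    assert (K1 : k0 <= k) by apply Rmax_l.
    assert (K2 : Rmax 4 (8 * lam) <= k) by apply Rmax_r.
    assert (K3 : 4 <= Rmax 4 (8 * lam)) by apply Rmax_l.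
    assert (K4 : 8 * lam <= Rmax 4 (8 * lam)) by apply Rmax_r.
    exists k, (F :: ray_power lam 1 :: ray_power lam (-1) :: nil).
    split; [lra|]. split; [reflexivity|]. split.
    + intros G [<-|[<-|[<-|[]]]]; auto.
    + intros z Hz Hc. rewrite Cf by auto. simpl. rewrite Rplus_0_r.
      assert (N1 := Cmod_ge_0 (F z)). assert (N2 := Cmod_ge_0 (ray_power lam 1 z)).
      assert (N3 := Cmod_ge_0 (ray_power lam (-1) z)).
      destruct (Rle_dec 1 (Cmod (W z))) as [H1|H1].
      * assert (D := ray_power_dominates lam k z Hl ltac:(lra) ltac:(lra) Hz Hc H1). lra.
      * assert (D := F3 k z K1 Hz Hc).
        assert (Rpower (Cmod (W z)) gam <= 1); [|lra].
        apply Rpower_le_1; auto. split; [now apply to_hplane_pos| lra].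
  - intros k eps Hk He.
    assert (P2 := Rpower_pos 2 gam).
    (* The first summand accounts for [phi_t' - 1] times the power at the displaced point, the
       second for the change of the power. *)
    set (A := Rpower 2 gam + 2 * gam * Rpower 2 gam).
    assert (PA : 0 < A) by (unfold A; nra).
    set (eta := Rmin (1 / 2) (eps / (A * K))).
    assert (E0 : 0 < eta).
    { apply Rmin_glb_lt; [lra|]. apply Rdiv_lt_0_compat; auto. now apply Rmult_lt_0_compat. }
    assert (E1 : eta <= 1 / 2) by apply Rmin_l.
    assert (E2 : eta * (A * K) <= eps).
    { apply Rle_div_r; [now apply Rmult_lt_0_compat| apply Rmin_r]. }
    destruct (dphi_close_on_cone b Hb phi sg dphi_analytic dw k eta Hk E0) as [d [Hd D]].
    exists d; split; auto. intros t Ht.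
    exists (fun z => RtoC (A * eta) * cpow gam (W z))%C. split; [|split].
    + intros z Hz. apply analytic_ccont; auto. apply analytic_cpow.
    + intros r Hr. eapply Rle_trans; [apply PB; auto; nra|]. lra.
    + intros z Hz Hc. destruct (D t z Ht Hz Hc) as [B1 B2].
      assert (Hw := to_hplane_hplane b Hb z Hz).
      assert (Hpz := semigroup_self_map _ sg t z (proj1 Ht) Hz).
      assert (Hv := to_hplane_hplane b Hb _ Hpz).
      unfold psi in B1. rewrite to_disk_hplane in B1 by auto.
      unfold Top. fold W in B1, Hw, Hv |- *. set (w := W z) in *. set (v := W (phi t z)) in *.
      set (u := C_derive (phi t) z) in *.
      destruct (cpow_lipschitz w v eta Hw Hv Hg (conj E0 E1)) as [L1 L2].
      { eapply Rle_trans; [exact B1|]. apply Rmult_le_compat_l; [lra|].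
        eapply Rle_trans; [apply Rle_abs| apply re_le_Cmod]. }
      rewrite Cmod_mult, Cmod_R, (Rabs_pos_eq (A * eta)) by nra.
      replace (u * (1 * cpow gam v) - 1 * cpow gam w)%C
        with ((u - 1) * cpow gam v + (cpow gam v - cpow gam w))%C by ring.
      eapply Rle_trans; [apply Cmod_triangle|]. rewrite Cmod_mult.
      assert (Pu := Cmod_ge_0 (u - 1)%C). assert (Pv := Cmod_ge_0 (cpow gam v)).
      assert (Cmod (u - 1)%C * Cmod (cpow gam v) <= eta * (Rpower 2 gam * Cmod (cpow gam w)))
        by (apply Rmult_le_compat; auto).
      unfold A. lra.
Qed.

End Strictness.

Theorem theorem18 :
  forall (p : Rbar) (alpha : R) (phi : R -> C -> C) (b : C),
    Rbar_le 1 p -> 0 < alpha ->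
    analytic_semigroup phi -> nontrivial phi ->
    Denjoy_Wolff_point phi b -> Cmod b = 1 ->
    (forall t, 0 <= t ->
       exists M, op_norm_le (Hspace p alpha) (Hnorm p alpha) (Top phi t) M) ->
    (exists M, forall t, 0 <= t <= 1 ->
       op_norm_le (Hspace p alpha) (Hnorm p alpha) (Top phi t) M) ->
    (forall f, Hspace0 p alpha f ->
       continuity_space phi (Hspace p alpha) (Hnorm p alpha) f) /\
    (exists f, continuity_space phi (Hspace p alpha) (Hnorm p alpha) f /\
       ~ Hspace0 p alpha f).
Proof.
  intros p alpha phi b Hp Ha sg _ dw Hb Hop [M HM].
  apply exponent_le in Hp.
  (* The constant 1 belongs to the space and its image under [T_t] is [phi_t']. *)
  assert (dphi_analytic : forall t, 0 <= t -> analytic (C_derive (phi t))).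
  { intros t Ht. destruct (Hop t Ht) as [M' [_ H]].
    destruct (H (fun _ => 1%C)) as [[H1 _] _].
    - apply Hspace_bound. split; [apply analytic_const|]. exists 1.
      apply Hbound_bounded; auto; [intros; apply ccont_const| lra|].
      intros z _. rewrite Cmod_1. lra.
    - apply (analytic_ext (Top phi t (fun _ => 1%C))); auto.
      intros z _. unfold Top. ring. }
  split.
  - intros f Hf. eapply Hspace0_continuity; eauto.
  - exists (fun z => 1 * cpow (alpha + inv_exponent p)%R (to_hplane b z))%C. split.
    + eapply power_continuity; eauto.
    + now apply power_not_little.
Qed.
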